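(* Let $H$ be a fixed graph of constant size. There is a polynomial-time algorithm which, given an $n$-node undirected $H$-minor-free graph $G$, constructs a radio gossip schedule for $G$ of length $O(OPT\cdot\log^2 n)$, where $OPT$ is the length of an optimal radio gossip schedule for $G$.
   Context: A graph is $H$-minor-free if $H$ cannot be obtained from it by deleting vertices and edges and contracting edges. Radio model: communication proceeds in synchronous rounds; in each round some set of nodes transmit, a transmitting node sends all messages it knows to all its neighbors, and a node receives (without interference) only if exactly one of its neighbors transmits in that round. Radio gossip: every node initially holds its own message, and every node's message must be delivered to every other node. The length of a schedule is its number of rounds; $OPT$ is the minimum length of a schedule completing gossip. *)

(* Defs.v *)
From mathcomp Require Import all_boot.

Set Implicit Arguments.
Unset Strict Implicit.
Unset Printing Implicit Defensive.

(** * Finite simple graphs and minors *)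

Record sgraph (V : finType) := SGraph {
  adj : rel V;
  adj_sym : symmetric adj;
  adj_irr : irreflexive adj
}.

Section GraphOperations.
Variables (V : finType) (G : sgraph V).

Definition delv_rel (x : V) : rel {u : V | u != x} :=
  fun u v => adj G (val u) (val v).

Lemma delv_sym x : symmetric (@delv_rel x).
Proof. by move=> u v; exact: adj_sym. Qed.

Lemma delv_irr x : irreflexive (@delv_rel x).
Proof. by move=> u; exact: adj_irr. Qed.

Definition del_vertex (x : V) : sgraph {u : V | u != x} :=
  SGraph (@delv_sym x) (@delv_irr x).

Definition dele_rel (x y : V) : rel V :=
  fun u v => adj G u v && ([set u; v] != [set x; y]).

Lemma dele_sym x y : symmetric (dele_rel x y).
Proof. by move=> u v; rewrite /dele_rel adj_sym setUC. Qed.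

Lemma dele_irr x y : irreflexive (dele_rel x y).
Proof. by move=> u; rewrite /dele_rel adj_irr. Qed.

Definition del_edge (x y : V) : sgraph V :=
  SGraph (dele_sym x y) (dele_irr x y).

(** Contraction of the edge [xy]: the merged vertex keeps the name [x], and
    the loop and the parallel edges that arise are discarded. *)
Definition contract_rel (x y : V) : rel {u : V | u != y} :=
  fun u v => (u != v) &&
    [|| adj G (val u) (val v),
        (val u == x) && adj G y (val v) |
        (val v == x) && adj G (val u) y].

Lemma contract_sym x y : symmetric (@contract_rel x y).
Proof.
move=> u v; rewrite /contract_rel eq_sym (adj_sym G (val v) (val u)).
by rewrite (adj_sym G y (val u)) (adj_sym G y (val v)) [X in _ || X]orbC.
Qed.

Lemma contract_irr x y : irreflexive (@contract_rel x y).
Proof. by move=> u; rewrite /contract_rel eqxx. Qed.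

Definition contract_edge (x y : V) : sgraph {u : V | u != y} :=
  SGraph (@contract_sym x y) (@contract_irr x y).

End GraphOperations.

Definition isomorphic (V W : finType) (G : sgraph V) (H : sgraph W) : Prop :=
  exists2 f : V -> W, bijective f & forall u v, adj H (f u) (f v) = adj G u v.

Inductive has_minor (W : finType) (H : sgraph W) :
    forall V : finType, sgraph V -> Prop :=
| minor_iso (V : finType) (G : sgraph V) :
    isomorphic G H -> has_minor H G
| minor_del_vertex (V : finType) (G : sgraph V) (x : V) :
    has_minor H (del_vertex G x) -> has_minor H G
| minor_del_edge (V : finType) (G : sgraph V) (x y : V) :
    has_minor H (del_edge G x y) -> has_minor H G
| minor_contract_edge (V : finType) (G : sgraph V) (x y : V) :
    adj G x y -> has_minor H (contract_edge G x y) -> has_minor H G.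

Definition minor_free (W V : finType) (H : sgraph W) (G : sgraph V) : Prop :=
  ~ has_minor H G.

(** * Radio gossip *)

Section Radio.
Variables (V : finType) (G : sgraph V).

(** [K v] is the set of (origins of) messages known to [v] before the round,
    [T] the set of transmitting nodes.  Whether [v] itself transmits has no
    influence on its reception. *)
Definition radio_round (K : V -> {set V}) (T : {set V}) : V -> {set V} :=
  fun v =>
    let senders := [set u in T | adj G u v] in
    K v :|: (if #|senders| == 1 then \bigcup_(u in senders) K u else set0).

Definition knowledge (s : seq {set V}) : V -> {set V} :=
  foldl radio_round (fun v => [set v]) s.

Definition gossip_schedule (s : seq {set V}) : Prop :=
  forall v, knowledge s v = setT.

(** No [opt] satisfies this when gossip is impossible (disconnected [G]). *)
Definition is_opt (opt : nat) : Prop :=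
  (exists2 s, gossip_schedule s & size s = opt) /\
  (forall s, gossip_schedule s -> opt <= size s).

End Radio.

(** * Polynomial-time algorithms

    A random access machine with structured control.  The memory consists of
    arrays of natural numbers; [mem a i] is cell [i] of array [a].  Array names
    are literals of the program, so a program uses finitely many arrays, while
    indices are computed.  The only arithmetic is addition and truncated
    subtraction, so the bit length of the values grows by O(1) per step: at
    unit cost per elementary command, polynomial time on this machine is
    polynomial time on Turing machines.  (Multiplication as a unit-cost
    operation would break this.) *)

Definition memory := nat -> nat -> nat.

Inductive expr :=
| Const of nat
| Read of nat & expr
| Add of expr & expr
| Sub of expr & expr.

Inductive cmd :=
| Skip
| Write of nat & expr & expr
| Seq of cmd & cmd
| If of expr & cmd & cmd
| While of expr & cmd.

Fixpoint eval (mem : memory) (e : expr) : nat :=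
  match e with
  | Const m => m
  | Read a e1 => mem a (eval mem e1)
  | Add e1 e2 => eval mem e1 + eval mem e2
  | Sub e1 e2 => eval mem e1 - eval mem e2
  end.

Definition update (mem : memory) (a i x : nat) : memory :=
  fun b j => if (b == a) && (j == i) then x else mem b j.

(** [exec p mem t mem']: started in [mem], the program [p] halts after [t]
    steps in [mem'].  A test costs one step, and holds if the value is not 0.
    Expressions are free of charge beyond that of the command, since their
    size is bounded by a constant of the program. *)
Inductive exec : cmd -> memory -> nat -> memory -> Prop :=
| exec_skip mem : exec Skip mem 1 mem
| exec_write mem a e1 e2 :
    exec (Write a e1 e2) mem 1 (update mem a (eval mem e1) (eval mem e2))
| exec_seq p q mem mem1 mem2 t1 t2 :
    exec p mem t1 mem1 -> exec q mem1 t2 mem2 ->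
    exec (Seq p q) mem (t1 + t2) mem2
| exec_if e p q mem mem1 t :
    exec (if eval mem e != 0 then p else q) mem t mem1 ->
    exec (If e p q) mem t.+1 mem1
| exec_while_done e p mem :
    eval mem e = 0 -> exec (While e p) mem 1 mem
| exec_while_loop e p mem mem1 mem2 t1 t2 :
    eval mem e != 0 -> exec p mem t1 mem1 -> exec (While e p) mem1 t2 mem2 ->
    exec (While e p) mem (t1 + t2).+1 mem2.

(** Input: cell 0 of array 0 holds [n], and array 1 holds the adjacency matrix
    row by row; all other cells are 0. *)
Definition graph_input (n : nat) (G : sgraph 'I_n) : memory :=
  fun a i =>
    match a with
    | 0 => if i == 0 then n else 0
    | 1 => [exists u : 'I_n, exists v : 'I_n, (i == u * n + v) && adj G u v]
    | _ => 0
    end.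

(** Output: cell 0 of array 2 holds the number of rounds, and array 3 holds the
    characteristic vectors of the transmitting sets, round by round. *)
Definition schedule_output (n : nat) (mem : memory) : seq {set 'I_n} :=
  mkseq (fun r => [set v : 'I_n | mem 3 (r * n + v) != 0]) (mem 2 0).

(* Main.v *)
(** Read backwards, an optimal schedule of length [L] yields a tree gathering all messages at a
    root, with depth and in-degrees at most [L].  Such a tree is approximated greedily: two active
    vertices are merged along a cheapest path, where the price of a vertex doubles when a path
    uses it.  Pairing the active vertices inside the optimal tree shows that cheap paths exist,
    so the union of all the paths has degree and radius [O(L log n)].  In a breadth-first tree of
    this union every vertex serves its ready children one per round; since a late vertex has
    exponentially many descendants, [O(L log^2 n)] rounds suffice.  Each of these rounds is a
    matching; contracting it gives an [H]-minor-free graph, which by Mader's theorem is degenerate,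
    so the interference is resolved by [O(1)] colors.  Broadcasting is gathering in reverse. *)

Require Import Defs.
From mathcomp Require Import all_boot zify.

Set Implicit Arguments.
Unset Strict Implicit.
Unset Printing Implicit Defensive.

(** * Minors and degeneracy *)

(** The algorithm never learns [OPT]: the length of an optimal schedule occurs in the analysis
    alone, so no guess has to be searched for. This is why a price has two summands. The sum of all
    weights is charged for each vertex of a path and keeps paths short; the weight of the vertex
    itself, scaled by the number of active vertices, keeps them away from busy vertices. One bound
    on the cost of a cheapest path thus controls length and load together. Merging in arbitrary
    order could stretch distances linearly, so it runs in phases: a vertex merges at most once per
    phase, and a phase ends when at most half of the active vertices are unmatched, which leaves at
    most two thirds of those it started with. [H] enters only through the constant [2 ^ #|W|] of the
    colouring. The machine is dealt with once, by compiling a small language all of whose loops run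
    [n] times: every program in it is polynomial, and the algorithm becomes a function on
    memories. *)

Lemma embedding_minor (W V : finType) (H : sgraph W) (G : sgraph V) (g : W -> V) :
  injective g -> (forall u v, adj H u v -> adj G (g u) (g v)) -> has_minor H G.
Proof.
(* Vertices outside the image are deleted, then edges that do not come from [H]. Each deletion
   lowers the number of vertices and arcs, and when none is possible [g] is an isomorphism. *)
have [k] := ubnP (#|V| + #|[set e | adj G e.1 e.2]|).
elim: k V G g => // k IHk V G g; rewrite ltnS => le_k g_inj g_hom.
have [/existsP[x xNg]|] := boolP [exists x, x \notin codom g].
  have gx w : g w != x by apply: contraNneq xNg => <-; exact: codom_f.
  apply: (@minor_del_vertex _ _ _ _ x).
  apply: (IHk _ _ (fun w => exist _ (g w) (gx w))).
  - apply: leq_trans le_k; rewrite -addSn.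
    apply: leq_add.
      by rewrite card_sig [X in _ <= X](cardD1 x) inE add1n ltnS; apply/eq_leq/eq_card => u; rewrite !inE andbT.
    pose f (e : {u | u != x} * {u | u != x}) := (val e.1, val e.2).
    have f_inj : injective f by move=> [a b] [c d] [/val_inj-> /val_inj->].
    rewrite -(card_imset _ f_inj); apply: subset_leq_card; apply/subsetP => e.
    by case/imsetP=> e'; rewrite !inE /= => He ->.
  - by move=> u v [/g_inj].
  - by move=> u v /g_hom.
rewrite negb_exists => /forallP allg.
have g_cod x : x \in codom g by have := allg x; rewrite negbK.
have [h gK hK] : bijective g.
  apply: (inj_card_bij g_inj).
  by rewrite -(card_codom g_inj); apply: subset_leq_card; apply/subsetP => x _.
have [/existsP[x /existsP[y /andP[Gxy NHxy]]]|] :=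
  boolP [exists x, exists y, adj G x y && ~~ adj H (h x) (h y)].
  apply: (@minor_del_edge _ _ _ _ x y); apply: (IHk _ _ g) => //.
    apply: leq_trans le_k; rewrite -addnS leq_add2l; apply: proper_card.
    apply/properP; split; first by apply/subsetP => e; rewrite !inE => /andP[].
    by exists (x, y); rewrite !inE //= /dele_rel eqxx andbF.
  move=> u v Huv; rewrite /= /dele_rel g_hom //=.
  apply: contra NHxy => /eqP Exy.
  have: x \in [set g u; g v] by rewrite Exy set21.
  have: y \in [set g u; g v] by rewrite Exy set22.
  have := adj_irr G x; rewrite !inE => Gxx /pred2P[] Ey /pred2P[] Ex; subst x y; rewrite !gK //.
  - by rewrite Gxx in Gxy.
  - by rewrite adj_sym.
  - by rewrite Gxx in Gxy.
rewrite negb_exists => /forallP noextra.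
apply: minor_iso; exists h; first by exists g.
move=> u v; apply/idP/idP => [/g_hom|Guv]; first by rewrite !hK.
by have := noextra u; apply: contraNT => NH; apply/existsP; exists v; rewrite Guv.
Qed.

(** Only the contractions are repeated in [G]; the deletions are postponed to the final isomorphism,
    where [embedding_minor] performs them all. *)
Lemma minor_mono (W V : finType) (H : sgraph W) (F : sgraph V) :
  has_minor H F -> forall (V' : finType) (G : sgraph V') (f : V -> V'),
  injective f -> (forall u v, adj F u v -> adj G (f u) (f v)) -> has_minor H G.
Proof.
elim=> {V F} [V F [h [g hK gK] hE]|V F x _ IH|V F x y _ IH|V F x y Fxy _ IH] V' G f f_inj f_hom.
- apply: (@embedding_minor _ _ _ _ (f \o g)) => [|u v Huv].
    by apply: inj_comp => //; exact: can_inj gK.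
  by apply: f_hom; rewrite -hE !gK.
- by apply: (IH _ G (f \o val)) => [|u v /f_hom//]; apply: inj_comp => //; exact: val_inj.
- by apply: (IH _ G f) => // u v /andP[/f_hom].
have fy (u : {u | u != y}) : f (val u) != f y by rewrite (inj_eq f_inj); exact: (valP u).
apply: (minor_contract_edge (f_hom _ _ Fxy)).
apply: (IH _ _ (fun u => exist _ (f (val u)) (fy u))) => [u v [/f_inj/val_inj]//|u v].
rewrite /= /contract_rel -!val_eqE /= !(inj_eq f_inj) => /andP[-> /or3P[/f_hom->|/andP[-> /f_hom->]|/andP[-> /f_hom->]]];
  by rewrite ?orbT.
Qed.

Lemma complete_sym h : symmetric (fun u v : 'I_h => u != v).
Proof. by move=> u v; rewrite eq_sym. Qed.
Lemma complete_irr h : irreflexive (fun u v : 'I_h => u != v).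
Proof. by move=> u; rewrite eqxx. Qed.
Definition complete h : sgraph 'I_h := SGraph (@complete_sym h) (@complete_irr h).

(** The apex [x] sees the whole image of [F], and a contraction inside the image keeps this true, so
    [x] survives as the additional vertex of [complete h.+1]. *)
Lemma cone_minor h (V : finType) (F : sgraph V) :
  has_minor (complete h) F -> forall (V' : finType) (G : sgraph V') (x : V') (f : V -> V'),
  injective f -> (forall u, adj G x (f u)) ->
  (forall u v, adj F u v -> adj G (f u) (f v)) -> has_minor (complete h.+1) G.
Proof.
elim=> {V F} [V F [k [g kK gK] kE]|V F y _ IH|V F y z _ IH|V F y z Fyz _ IH] V' G x f f_inj fx f_hom.
- have adjN u v : adj G u v -> u != v by apply: contraTneq => ->; rewrite adj_irr.
  pose e (i : 'I_h.+1) := if unlift ord0 i is Some j then f (g j) else x.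
  apply: (@embedding_minor _ _ _ _ e) => u v; rewrite /e.
    case: unliftP => [j|] ->; case: unliftP => [i|] -> //.
    - by move/f_inj/(can_inj gK)->.
    - by move/eqP; rewrite eq_sym (negPf (adjN _ _ (fx _))).
    - by move/eqP; rewrite (negPf (adjN _ _ (fx _))).
  rewrite /=; case: unliftP => [j|] ->; case: unliftP => [i|] -> //; rewrite ?eqxx //.
    by move=> ij; apply: f_hom; rewrite -kE !gK /=; apply: contraNneq ij => ->.
  by rewrite adj_sym.
- apply: (IH _ G x (f \o val)) => [|u|u v /f_hom//].
    by apply: inj_comp => //; exact: val_inj.
  exact: fx.
- by apply: (IH _ G x f) => // u v /andP[/f_hom].
have fz (u : {u | u != z}) : f (val u) != f z by rewrite (inj_eq f_inj); exact: (valP u).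
have xz : x != f z by apply: contraTneq (fx z) => ->; rewrite adj_irr.
apply: (minor_contract_edge (f_hom _ _ Fyz)).
apply: (IH _ _ (exist _ x xz) (fun u => exist _ (f (val u)) (fz u))) => [u v [/f_inj/val_inj]//|u|u v].
  rewrite /= /contract_rel -val_eqE /= fx andbT.
  by apply: contraTneq (fx (val u)) => ->; rewrite adj_irr.
rewrite /= /contract_rel -!val_eqE /= !(inj_eq f_inj) => /andP[-> /or3P[/f_hom->|/andP[-> /f_hom->]|/andP[-> /f_hom->]]];
  by rewrite ?orbT.
Qed.

Lemma sum_sig (V : finType) (P : pred V) (F : V -> nat) :
  \sum_(u : {u | P u}) F (val u) = \sum_(u | P u) F u.
Proof.
rewrite [RHS](@reindex_omap _ _ _ _ {u | P u} val insub) => [|u Pu]; last by rewrite insubT.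
by apply: eq_bigl => u; rewrite valK eqxx (valP u).
Qed.

(** Mader's argument; the double sum is twice the number of edges. Either some edge has few common
    neighbours, and contracting it preserves the density, or every edge has many, and then the
    neighbourhood of a vertex is dense enough to contain the next smaller complete minor. *)
Lemma dense_minor h (V : finType) (G : sgraph V) :
  0 < #|V| -> 2 ^ h * #|V| <= \sum_u \sum_v adj G u v -> has_minor (complete h) G.
Proof.
elim: h V G => [|h IHh] V G; first by move=> _ _; apply: (@embedding_minor _ _ _ _ (fun i : 'I_0 => match i with Ordinal _ lt_i0 => False_rect V (notF lt_i0) end)) => -[].
have [m] := ubnP #|V|; elim: m V G => // m IHm V G; rewrite ltnS => le_m V_gt0 dense.
pose common x y := \sum_v (adj G x v && adj G y v).
have degC x : \sum_v adj G v x = \sum_v adj G x v.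
  by apply: eq_bigr => v _; rewrite adj_sym.
have [/existsP[x /existsP[y /andP[Gxy few]]]|] :=
  boolP [exists x, exists y, adj G x y && (common x y < 2 ^ h)].
  have xy : x != y by apply: contraTneq Gxy => ->; rewrite adj_irr.
  have cardV : #|V| = #|{: {u | u != y}}|.+1.
    by rewrite card_sig [LHS](cardD1 y) inE add1n; congr _.+1; apply: eq_card => u; rewrite !inE andbT.
  apply: (minor_contract_edge Gxy); apply: IHm.
  - by rewrite -cardV.
  - by rewrite card_sig (cardD1 x) inE xy.
  (* [gain] moves the edges of [y] to [x]. [loss] counts one of two parallel edges for each common
     neighbour; its term [v == x] pays for the loop that the edge between [x] and [y] becomes. *)
  pose merged u v := (u != v) && [|| adj G u v, (u == x) && adj G y v | (v == x) && adj G u y].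
  pose gain u v : nat := (u == x) * adj G y v.
  pose loss u v : nat := (u == x) * ((adj G x v && adj G y v) + (v == x)).
  have pointwise u v : u != y -> v != y ->
      adj G u v + (gain u v + gain v u) <= merged u v + (loss u v + loss v u).
    rewrite /gain /loss /merged (adj_sym G y u) => uy vy; have [<-|uv] /= := eqVneq u v.
      rewrite adj_irr; have [->|_] := eqVneq u x; last by [].
      by rewrite (adj_sym G y x) Gxy adj_irr.
    have [Eu|_] := eqVneq u x; have [Ev|_] := eqVneq v x; subst; rewrite ?eqxx // in uv *.
    - rewrite !mul1n !mul0n !addn0; do 2![case: adj => //].
    - rewrite !mul1n !mul0n !add0n !addn0 (adj_sym G u x) (adj_sym G u y); do 2![case: adj => //].
    - by rewrite !mul0n !addn0 !orbF.
  have off_y (F : V -> nat) : F y = 0 -> \sum_(v | v != y) F v = \sum_v F v.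
    by move=> Fy; rewrite [RHS](bigD1 y) //= Fy.
  have sum_x (F : V -> nat) : \sum_(u | u != y) \sum_(v | v != y) (u == x) * F v = \sum_(v | v != y) F v.
    rewrite (bigD1 x) //= [X in _ + X]big1 ?addn0.
      by apply: eq_bigr => v _; rewrite eqxx mul1n.
    by move=> u /andP[_ /negPf->]; apply: big1.
  have sum_gain : \sum_(u | u != y) \sum_(v | v != y) gain u v = \sum_v adj G y v.
    by rewrite sum_x off_y ?adj_irr.
  have sum_loss : \sum_(u | u != y) \sum_(v | v != y) loss u v = (common x y).+1.
    rewrite sum_x big_split /= off_y ?adj_irr ?andbF // -addn1; congr (_ + _).
    by rewrite (bigD1 x) //= eqxx big1 // => v /andP[_ /negPf->].
  have edges : \sum_u \sum_v adj G u v =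
      \sum_(u | u != y) \sum_(v | v != y) adj G u v + (\sum_v adj G y v + \sum_v adj G y v).
    rewrite [LHS](bigD1 y) //= [LHS]addnC addnA; congr (_ + _).
    rewrite -(off_y (adj G y)) ?adj_irr // -big_split /=; apply: eq_bigr => u _.
    by rewrite (bigD1 y) //= addnC adj_sym.
  have -> : \sum_u \sum_v adj (contract_edge G x y) u v = \sum_(u | u != y) \sum_(v | v != y) merged u v.
    rewrite -(sum_sig (fun u => u != y) (fun u => \sum_(v | v != y) merged u v)); apply: eq_bigr => u _.
    by rewrite -(sum_sig (fun v => v != y) (merged (val u))); apply: eq_bigr.
  have := leq_sum (P := fun u => u != y) _ (fun u uy =>
    leq_sum (P := fun v => v != y) _ (fun v vy => pointwise u v uy vy)).
  have double_sum (F K : V -> V -> nat) : \sum_(u | u != y) \sum_(v | v != y) (F u v + (K u v + K v u)) =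
     \sum_(u | u != y) \sum_(v | v != y) F u v + (\sum_(u | u != y) \sum_(v | v != y) K u v).*2.
    rewrite -addnn [X in _ = _ + (_ + X)]exchange_big /= -!big_split /=.
    by apply: eq_bigr => u _; rewrite -!big_split.
  move=> /(_ (index_enum V) (index_enum V)).
  rewrite !double_sum // sum_gain sum_loss.
  (* With fewer than [2 ^ h] common neighbours the sum drops by at most [2 * 2 ^ h], which is the
     share of the vanished vertex. *)
  move: dense few; rewrite edges cardV !expnS mulnS -!mulnA; set P := 2 ^ h * _; set p := 2 ^ h; lia.
rewrite negb_exists => /forallP many.
have [/existsP[x /existsP[y Gxy]]|] := boolP [exists x, exists y, adj G x y]; last first.
  rewrite negb_exists => /forallP empty; move: dense; rewrite big1 => [|x _].
    by rewrite leqn0 muln_eq0 expn_eq0 /= => /eqP V0; rewrite V0 in V_gt0.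
  rewrite big1 // => y _; apply/eqP; rewrite eqb0.
  by apply: contra (empty x) => Gxy; apply/existsP; exists y.
have {}many z : adj G x z -> 2 ^ h <= common x z.
  move=> Gxz; rewrite leqNgt; apply: contra (many x) => few.
  by apply/existsP; exists z; rewrite Gxz.
(* In the subgraph induced on the neighbourhood of [x], the degree of [z] is the number of common
   neighbours of [x] and [z], so the minimum degree is at least [2 ^ h]. *)
pose r (u v : {u | adj G x u}) := adj G (val u) (val v).
have r_sym : symmetric r by move=> u v; exact: adj_sym.
have r_irr : irreflexive r by move=> u; exact: adj_irr.
apply: (@cone_minor h _ (SGraph r_sym r_irr) _ V G x val) => //; last 2 first.
- exact: val_inj.
- by move=> u; exact: (valP u).
apply: IHh; first by rewrite card_sig (cardD1 y) inE Gxy.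
rewrite mulnC -sum_nat_const; apply: leq_sum => u _.
apply: leq_trans (many _ (valP u)) _.
rewrite /common /= /r.
rewrite (bigID (adj G x)) /= [X in _ + X]big1 ?addn0; last by move=> v /negPf->.
rewrite (sum_sig (adj G x) (fun v => adj G (val u) v : nat)).
by apply/eq_leq/eq_bigr => v ->.
Qed.

Lemma minor_of_complete (W V : finType) (H : sgraph W) (G : sgraph V) :
  has_minor (complete #|W|) G -> has_minor H G.
Proof.
elim=> {V G} [V G [f [g fK gK] fE]|V G x _ IH|V G x y _ IH|V G x y Gxy _ IH].
- apply: (@embedding_minor _ _ _ _ (g \o enum_rank)) => [|u v Huv].
    by apply: inj_comp (can_inj gK) _; exact: enum_rank_inj.
  rewrite -fE !gK /= (inj_eq enum_rank_inj).
  by apply: contraTneq Huv => ->; rewrite adj_irr.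
- by apply: minor_del_vertex IH.
- by apply: minor_del_edge IH.
- by apply: minor_contract_edge Gxy IH.
Qed.

(** The sets [{a u, b u}] are branch sets of size at most two; they are contracted one by one. *)
Lemma matching_contraction (W : finType) (H : sgraph W) (V V1 : finType)
    (G : sgraph V) (Q : sgraph V1) (a b : V1 -> V) :
  injective a -> injective b -> (forall u v, u != v -> a u != b v) ->
  (forall u, a u != b u -> adj G (a u) (b u)) ->
  (forall u v, adj Q u v ->
     [|| adj G (a u) (a v), adj G (a u) (b v), adj G (b u) (a v) | adj G (b u) (b v)]) ->
  has_minor H Q -> has_minor H G.
Proof.
have [k] := ubnP #|[set u | a u != b u]|.
elim: k V G a b => // k IHk V G a b; rewrite ltnS => le_k a_inj b_inj ab adj_ab Qab HQ.
have [/existsP[u0 ab0]|] := boolP [exists u, a u != b u]; last first.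
  rewrite negb_exists => /forallP ab_eq.
  apply: (minor_mono HQ a_inj) => u v /Qab.
  have := ab_eq u; have := ab_eq v; rewrite !negbK => /eqP-> /eqP->.
  by rewrite !orbb.
apply: (minor_contract_edge (adj_ab _ ab0)).
have a_ne v : a v != b u0.
  by have [->|/ab//] := eqVneq v u0.
have b_ne v : (if v == u0 then a u0 else b v) != b u0.
  by have [_|] := eqVneq v u0; last by rewrite (inj_eq b_inj).
(* The branch set of [u0] has become a single vertex, which is encoded by [b' u0 = a' u0]. *)
pose a' v : {w | w != b u0} := exist _ (a v) (a_ne v).
pose b' v : {w | w != b u0} := exist _ (if v == u0 then a u0 else b v) (b_ne v).
apply: (IHk _ _ a' b'); last exact: HQ.
- apply: leq_trans le_k; apply: proper_card; apply/properP; split.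
    apply/subsetP => v; rewrite !inE -val_eqE /=.
    by have [->|] := eqVneq v u0; first by rewrite eqxx.
  by exists u0; rewrite !inE // -val_eqE /= eqxx eqxx.
- by move=> u v [/a_inj].
- move=> u v []; have [->|nu] := eqVneq u u0; have [->|nv] := eqVneq v u0 => //.
  + by move=> E; have := ab u0 v; rewrite eq_sym nv E eqxx => /(_ isT).
  + by move=> E; have := ab u0 u; rewrite eq_sym nu -E eqxx => /(_ isT).
  + by move/b_inj.
- move=> u v uv; rewrite -val_eqE /=; have [Ev|_] := eqVneq v u0; last exact: ab.
  by rewrite (inj_eq a_inj) -Ev.
- move=> u; rewrite -val_eqE /= /contract_rel -val_eqE /=.
  have [->|nu] := eqVneq u u0; first by rewrite eqxx.
  by move=> nab; rewrite nab adj_ab.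
move=> u v Quv; have uv : u != v by apply: contraTneq Quv => ->; rewrite adj_irr.
have /or4P adjs := Qab _ _ Quv.
rewrite /= /contract_rel -!val_eqE /= !(inj_eq a_inj).
have [Eu|nu] := eqVneq u u0; have [Ev|nv] := eqVneq v u0.
- by rewrite Eu Ev eqxx in uv.
- subst u; rewrite !(inj_eq a_inj) uv /=. rewrite (ab _ _ uv) /=.
  by case: adjs => ->; rewrite ?orbT.
- subst v; rewrite !(inj_eq a_inj) uv /= ![b u == _]eq_sym (ab u0 u) 1?eq_sym //=.
  by case: adjs => ->; rewrite ?orbT.
rewrite !(inj_eq b_inj) uv /= (ab _ _ uv) [b u == _]eq_sym (ab v u) 1?eq_sym //=.
by case: adjs => ->; rewrite ?orbT.
Qed.

(** Think of [c] as transmitting to [p c] in one round; the vertices counted are those whose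
    transmission cannot share a round with it. If all counts were large, contracting the matching
    would give a graph of average degree at least [2 ^ #|W|], hence a complete minor on [#|W|]
    vertices. *)
Lemma matching_degenerate (W V : finType) (H : sgraph W) (G : sgraph V) (X : {set V}) (p : V -> V) :
  minor_free H G -> X != set0 ->
  {in X &, injective p} -> {in X, forall c, adj G c (p c)} -> {in X &, forall c c', p c != c'} ->
  exists2 c, c \in X &
    #|[set c' in X | (c' != c) && (adj G c' (p c) || adj G c (p c'))]| < 2 ^ #|W|.
Proof.
move=> GH X0 p_inj adj_p pX; apply/exists_inP; apply: contraT.
rewrite negb_exists_in => /forall_inP dense; case: GH.
pose q (u v : {c | c \in X}) := (u != v) && (adj G (val v) (p (val u)) || adj G (val u) (p (val v))).
have q_sym : symmetric q by move=> u v; rewrite /q eq_sym orbC.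
have q_irr : irreflexive q by move=> u; rewrite /q eqxx.
apply: (@matching_contraction _ _ _ _ _ (SGraph q_sym q_irr) val (fun c => p (val c))).
- exact: val_inj.
- by move=> u v /(p_inj _ _ (valP u) (valP v))/val_inj.
- by move=> u v _; rewrite eq_sym; apply: pX; exact: valP.
- by move=> u _; apply: adj_p; exact: valP.
- by move=> u v /andP[_ /orP[|->]]; rewrite ?orbT // adj_sym => ->; rewrite !orbT.
apply: minor_of_complete; apply: dense_minor.
  by rewrite card_sig card_gt0.
rewrite mulnC -sum_nat_const; apply: leq_sum => u _.
have := dense _ (valP u); rewrite -leqNgt => /leq_trans; apply.
pose F v : nat := (v != val u) && (adj G v (p (val u)) || adj G (val u) (p v)).
apply: leq_trans (_ : _ <= \sum_(v | v \in X) F v) _.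
  rewrite -sum1_card big_mkcond [X in _ <= X]big_mkcond; apply: leq_sum => v _.
  by rewrite !inE; case: (v \in X).
rewrite -(sum_sig _ F); apply/eq_leq/eq_bigr => v _.
by rewrite /F /= /q -val_eqE eq_sym.
Qed.

(** * Gather trees of schedules *)

(** The tree is read off backwards in time: the parent of [v] is a vertex
    that [v] informs in the last round in which informing someone is useful to the root,
    and [d v] is the time from that round to the end of the schedule. *)
Lemma gather_tree_of_schedule (V : finType) (G : sgraph V) (R : {set V}) (s : seq {set V}) :
  (forall m, exists2 w, w \in R & m \in knowledge G s w) ->
  exists (d : V -> nat) (par : V -> V),
    [/\ forall v, (d v == 0) = (v \in R),
        forall v, v \notin R -> [/\ adj G v (par v), d (par v) < d v & d v <= size s]
      & forall u v, u \notin R -> v \notin R -> par u = par v -> d u = d v -> u = v].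
Proof.
elim/last_ind: s R => [|s T IHs] R full.
  have RT v : v \in R by have [w Rw] := full v; rewrite inE => /eqP->.
  by exists (fun=> 0), id; split=> [v|v|u v]; rewrite ?RT.
pose hears w u := [set u in T | adj G u w] == [set u].
(* What the members of [R] know together at the end, the members of [R'] know before the last round.
   The new vertices become children of members of [R]; no parent gets two of them, because hearing
   requires a unique sender. *)
pose R' := R :|: [set u | [exists w in R, hears w u]].
have [m|d [par [d0 d_par d_inj]]] := IHs R'.
  have [w Rw] := full m; rewrite /knowledge foldl_rcons inE => /orP[Kw|].
    by exists w; rewrite // inE Rw.
  case: ifP => [/cards1P[u Eu]|_]; last by rewrite inE.
  rewrite Eu big_set1 => Ku; exists u => //.
  by rewrite !inE; apply/orP; right; apply/exists_inP; exists w => //; apply/eqP.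
pose d' v := if v \in R then 0 else if v \in R' then 1 else (d v).+1.
pose par' v := if v \in R' then odflt v [pick w in R | hears w v] else par v.
have par'_late v : v \notin R -> v \in R' -> (par' v \in R) && hears (par' v) v.
  move=> nRv R'v; rewrite /par' R'v; case: pickP => [w //|none].
  by move: R'v; rewrite !inE (negPf nRv) => /exists_inP[w Rw hw]; have := none w; rewrite Rw hw.
have adj_hears w v : hears w v -> adj G v w.
  by move/eqP/setP/(_ v); rewrite !inE eqxx => /andP[].
exists d', par'; split.
- by move=> v; rewrite /d'; case: ifP => // _; case: ifP.
- move=> v nRv; have [R'v|nR'v] := boolP (v \in R').
    have /andP[Rp hp] := par'_late _ nRv R'v.
    by rewrite adj_hears // /d' Rp (negPf nRv) R'v size_rcons.
  have [a1 a2 a3] := d_par _ nR'v.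
  rewrite /par' (negPf nR'v) /d' (negPf nRv) (negPf nR'v) size_rcons; split=> //.
  case: ifP => // _; case: ifP => // R'p.
  by rewrite ltnS lt0n d0.
move=> u v nRu nRv; have [R'u|nR'u] := boolP (u \in R'); have [R'v|nR'v] := boolP (v \in R').
- have /andP[_ /eqP hu] := par'_late _ nRu R'u; have /andP[_ /eqP hv] := par'_late _ nRv R'v.
  by move=> E _; move: hv; rewrite -E hu => /set1_inj.
- rewrite /d' (negPf nRu) (negPf nRv) R'u (negPf nR'v) => _ [/esym/eqP].
  by rewrite d0 (negPf nR'v).
- rewrite /d' (negPf nRu) (negPf nRv) R'v (negPf nR'u) => _ [/eqP].
  by rewrite d0 (negPf nR'u).
by rewrite /d' /par' (negPf nRu) (negPf nRv) (negPf nR'u) (negPf nR'v) => E [] /d_inj; apply.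
Qed.

Lemma card_bigcup_le (I V : finType) (A : {set I}) (F : I -> {set V}) :
  #|\bigcup_(i in A) F i| <= \sum_(i in A) #|F i|.
Proof.
elim/big_rec2: _ => [|i m B _ le_m]; first by rewrite cards0.
by apply: leq_trans (leq_card_setU _ _) _; rewrite leq_add2l.
Qed.

Definition parent_edge (V : finType) (r : V) (par : V -> V) : rel V :=
  [rel u v | (u != r) && (par u == v)].

Definition below (V : finType) (r : V) (par : V -> V) (z : V) : {set V} :=
  [set i | connect (parent_edge r par) i z].

(** * Cheap paths between terminals of a tree *)

Section Pairing.
Variables (V : finType) (G : sgraph V) (r : V) (d : V -> nat) (par : V -> V) (L : nat).
Hypothesis par_adj : forall v, v != r -> adj G v (par v).
Hypothesis par_lt : forall v, v != r -> d (par v) < d v.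
Hypothesis d_le : forall v, d v <= L.

Notation up := (parent_edge r par).
Notation below := (below r par).
Let children z := #|[set v | up v z]|.

Lemma up_path i p : path up i p ->
  [/\ path (adj G) i p, size p + d (last i p) <= d i, uniq (i :: p)
    & {in i :: p, forall v, connect up i v /\ connect up v (last i p)}].
Proof.
move=> up_p; split.
- apply: sub_path up_p => u v /andP[/par_adj adj_u /eqP<-]; exact: adj_u.
- elim: p i up_p => //= v p IHp i /andP[/andP[/par_lt lt_d /eqP par_i] /IHp].
  by rewrite par_i in lt_d; lia.
- have lt_path: path (fun u v => d v < d u) i p.
    by apply: sub_path up_p => u v /andP[/par_lt lt_d /eqP<-].
  apply: (@sorted_uniq _ (fun u v => d v < d u) _ _ (i :: p)) lt_path => [x y z|x].
    by move=> /= yx zy; exact: ltn_trans yx.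
  by rewrite ltnn.
move=> v vp; split; first exact: (path_connect up_p).
by case/splitPl: vp up_p => p1 p2 Ev; rewrite cat_path last_cat Ev => /andP[_ /path_connect]; apply; exact: mem_last.
Qed.

Lemma connect_up_lt v z : connect up v z -> v != z -> d z < d v.
Proof.
move=> /connectP[[|u p] up_p ->] vz; first by rewrite eqxx in vz.
by have [_ le_d _ _] := up_path up_p; apply: leq_trans le_d; rewrite /= addSn ltnS leq_addl.
Qed.

Lemma up_neq v z : up v z -> v != z.
Proof. by case/andP=> /par_lt + /eqP<-; case: eqVneq => // <-; rewrite ltnn. Qed.

Lemma connect_up_root v : connect up v r.
Proof.
have [k] := ubnP (d v); elim: k v => // k IHk v; rewrite ltnS => le_k.
have [->|vr] := eqVneq v r; first exact: connect0.
apply: (connect_trans (y := par v)); first by apply: connect1; rewrite /parent_edge /= vr eqxx.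
by apply: IHk; apply: leq_trans le_k; exact: par_lt.
Qed.

Lemma below_children i z : i \in below z -> i != z -> exists2 v, up v z & i \in below v.
Proof.
rewrite inE => /connectP[p]; case/lastP: p => [|p v] up_p ->; first by rewrite eqxx.
rewrite last_rcons => _; move: up_p; rewrite rcons_path => /andP[up_p up_v].
by exists (last i p) => //; rewrite inE; apply/connectP; exists p.
Qed.

(** Terminals are matched at a deepest vertex [z] with two terminals [i], [j] below it: a vertex
    strictly between [i] and [z] has no other terminal below it, so it is not used by later pairs,
    and at most one terminal comes from each child of [z]. *)
Lemma tree_pairing_potential (w : V -> nat) (B : nat) (U : {set V}) :
  (forall i j p, i \in U -> j \in U -> i != j -> path (adj G) i p -> last i p = j ->
     size p <= 2 * L -> B <= \sum_(v <- i :: p) w v) ->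
  #|U|./2 * B <= \sum_v w v * minn #|U :&: below v| (children v).+1.
Proof.
have [k] := ubnP #|U|; elim: k U => // k IHk U; rewrite ltnS => le_k costly.
have [U_le1|U_gt1] := leqP #|U| 1; first by case: #|U| U_le1 => [|[]].
have below_r : 1 < #|U :&: below r|.
  by rewrite (setIidPl _) //; apply/subsetP => v _; rewrite inE connect_up_root.
case: (@arg_maxnP _ r (fun z => 1 < #|U :&: below z|) d below_r) => z z_gt1 z_max.
have single v : d z < d v -> #|U :&: below v| <= 1.
  by move=> lt_d; rewrite leqNgt; apply: contraL lt_d => /z_max; rewrite -leqNgt.
have z_le : #|U :&: below z| <= (children z).+1.
  have sub : U :&: below z \subset z |: \bigcup_(v in [set v | up v z]) (U :&: below v).
    apply/subsetP => i; rewrite inE => /andP[Ui iz]; rewrite in_setU1.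
    have [//|i_ne] := eqVneq i z; have [v vz iv] := below_children iz i_ne.
    by apply/bigcupP; exists v; rewrite !inE // Ui; rewrite inE in iv.
  apply: leq_trans (subset_leq_card sub) _; apply: leq_trans (leq_card_setU _ _).1 _.
  rewrite cards1 add1n ltnS /children -[X in _ <= X]sum1_card.
  apply: leq_trans (card_bigcup_le _ _) _; apply: leq_sum => v; rewrite inE => vz.
  by apply: single; apply: connect_up_lt (connect1 vz) _; exact: up_neq.
have [i [j [Ui Uj ij iz jz]]] : exists i j, [/\ i \in U, j \in U, i != j, connect up i z & connect up j z].
  by case/card_gt1P: z_gt1 => i [j [/setIP[Ui +] /setIP[Uj +] ij]]; rewrite !inE => iz jz; exists i, j.
have /connectP[p up_p Ep] := iz; have /connectP[q up_q Eq] := jz.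
have [adj_p size_p uniq_p on_p] := up_path up_p.
have [adj_q size_q uniq_q on_q] := up_path up_q.
(* [p] ends in [z] and [belast j q] leaves it out, so the walk visits [z] once. *)
pose walk := p ++ rev (belast j q).
have walk_cost : B <= \sum_(v <- i :: walk) w v.
  apply: costly Ui Uj ij _ _ _.
  - rewrite cat_path adj_p -Ep Eq rev_path.
    by apply: sub_path adj_q => u v; rewrite adj_sym.
  - rewrite last_cat -Ep; case: (q) Eq => [|v q'] Eq /=; first by rewrite Eq.
    by rewrite rev_cons last_rcons.
  - rewrite size_cat size_rev size_belast mul2n -addnn; apply: leq_add.
      by apply: leq_trans (d_le i); apply: leq_trans size_p; apply: leq_addr.
    by apply: leq_trans (d_le j); apply: leq_trans size_q; apply: leq_addr.
have [uniq_bq z_nq] : uniq (belast j q) /\ z \notin belast j q.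
  by move: uniq_q; rewrite lastI rcons_uniq Eq => /andP[-> ->].
have path_sum s : uniq s -> \sum_(v <- s) w v = \sum_v w v * (v \in s).
  move=> us; rewrite (big_uniq _ us) /= big_mkcond /=; apply: eq_bigr => v _.
  by case: (v \in _); rewrite ?muln1 ?muln0.
pose U' := U :\ i :\ j.
have cardU' : #|U| = #|U'|.+2.
  by rewrite (cardsD1 i U) Ui (cardsD1 j (U :\ i)) !inE eq_sym ij Uj.
(* Dropping [i] and [j] lowers the minimum at every vertex of the walk. Away from [z] the number of
   terminals below falls from one to zero; at [z] it is at most one more than the number of
   children, so the minimum equals it and falls by two. *)
have step : \sum_v w v * minn #|U' :&: below v| (children v).+1 + \sum_(v <- i :: walk) w v <=
   \sum_v w v * minn #|U :&: below v| (children v).+1.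
  have -> : \sum_(v <- i :: walk) w v =
    \sum_v w v * ((v \in i :: p) + (v \in belast j q)).
    rewrite -cat_cons big_cat big_rev /= !path_sum //.
    by rewrite -big_split; apply: eq_bigr => v _; rewrite mulnDr.
  rewrite -big_split; apply: leq_sum => v _; rewrite /= -mulnDr leq_mul2l; apply/orP; right.
  have card_v : #|U :&: below v| = (i \in below v) + (j \in below v) + #|U' :&: below v|.
    rewrite (cardsD1 i) (cardsD1 j) !inE Ui Uj /= eq_sym ij /= -addnA; congr (_ + (_ + _)).
    by apply: eq_card => u; rewrite !inE -!andbA.
  have [Ev|vz] := eqVneq v z.
    move: z_le; rewrite -Ev card_v !inE Ev iz jz (negPf z_nq) => z_le.
    move: {z_le}(#|_ :&: _|) (children z) (z \in _) z_le => a c [] le_c; clear -le_c; lia.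
  have p_v : v \in i :: p -> connect up i v /\ #|U :&: below v| <= 1.
    move=> /on_p[iv]; rewrite -Ep => /connect_up_lt/(_ vz)/single.
    by split.
  have q_v : v \in belast j q -> connect up j v /\ #|U :&: below v| <= 1.
    move=> vq; have /on_q[jv] : v \in j :: q by rewrite lastI mem_rcons inE vq orbT.
    by rewrite -Eq => /connect_up_lt/(_ vz)/single; split.
  move: p_v q_v; rewrite card_v !inE.
  move: (_ || _) (v \in belast j q) (connect up i v) (connect up j v) #|U' :&: _| (children v).
  by clear=> [] [] [] [] a c p_v q_v; lia.
rewrite cardU' /= mulSn addnC; apply: leq_trans step; apply: leq_add walk_cost.
apply: IHk => [|a b s]; first by rewrite cardU' in le_k; exact: ltnW.
by rewrite !inE => /and3P[_ _ Ua] /and3P[_ _ Ub]; exact: costly.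
Qed.
End Pairing.

(** Let [L] be the length of the schedule. A path in the gather tree used by the pairing has at most
    [2 * L + 1] vertices, which bounds the share of the constant summand of the price. The rest is
    paid by the pairing, where each vertex counts at most [L + 1] times and [s] cancels against
    [#|U|./2] up to the factor 6. Finally [(2 * L + 1) + 6 * (L + 1) <= 15 * L]. *)
Lemma cheap_connection (V : finType) (G : sgraph V) (sched : seq {set V})
    (w : V -> nat) (s B : nat) (U : {set V}) :
  gossip_schedule G sched -> 0 < size sched -> 1 < #|U| -> s <= 6 * #|U|./2 ->
  (forall i j p, i \in U -> j \in U -> i != j -> path (adj G) i p -> last i p = j ->
     B <= \sum_(v <- i :: p) (s * w v + \sum_u w u)) ->
  B <= 15 * size sched * \sum_u w u.
Proof.
set L := size sched; set W := \sum_u w u => gossip L_gt0 U_gt1 s_le costly.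
have /card_gt0P[r _] : 0 < #|U| by exact: ltnW.
have [m|d [par [d0 d_par d_inj]]] := @gather_tree_of_schedule V G [set r] sched.
  by exists r; rewrite ?set11 // gossip inE.
have {}d_par v : v != r -> [/\ adj G v (par v), d (par v) < d v & d v <= L].
  by move=> vr; apply: d_par; rewrite inE.
have d_le v : d v <= L.
  have [->|/d_par[]//] := eqVneq v r; have := d0 r; rewrite set11 => /eqP->.
  exact: leq0n.
(* Children of one vertex inform it in different rounds, so their values of [d] are different
   numbers between 1 and [L]. *)
have children_le u : #|[set v | (v != r) && (par v == u)]| <= L.
  pose f v : 'I_L.+1 := inord (d v).
  rewrite -(card_in_imset (f := f)) => [|x y]; last first.
    rewrite !inE => /andP[xr /eqP px] /andP[yr /eqP py] /(congr1 val).
    rewrite /= !inordK ?ltnS //; apply: d_inj; rewrite ?inE //.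
    by rewrite px py.
  rewrite -[L]/(L.+1.-1) -[in X in _ <= X](card_ord L.+1) -(cardsC1 ord0).
  apply: subset_leq_card; apply/subsetP => y /imsetP[x]; rewrite !inE => /andP[xr _] ->.
  by rewrite -val_eqE /= inordK ?ltnS // d0 inE.
have B_le : #|U|./2 * (B - W * (2 * L).+1) <= s * (W * L.+1).
  have par_adj v : v != r -> adj G v (par v) by case/d_par.
  have par_lt v : v != r -> d (par v) < d v by case/d_par.
  apply: leq_trans (tree_pairing_potential par_adj par_lt d_le (w := fun v => s * w v) _) _.
    move=> i j p Ui Uj ij adj_p last_p size_p; rewrite leq_subLR.
    apply: leq_trans (costly i j p Ui Uj ij adj_p last_p) _.
    by rewrite big_split big_const_seq count_predT iter_addn_0 /= addnC leq_add2r leq_mul2l ltnS size_p orbT.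
  rewrite [X in _ <= X]mulnA [s * W]big_distrr [X in _ <= X]big_distrl /=; apply: leq_sum => v _.
  rewrite leq_mul2l; apply/orP; right; apply: leq_trans (geq_minr _ _) _; rewrite ltnS; exact: children_le.
have half_gt0 : 0 < #|U|./2 by case: #|U| U_gt1 => [|[]].
have {}B_le : B - W * (2 * L).+1 <= 6 * (W * L.+1).
  rewrite -(leq_pmul2l half_gt0); apply: leq_trans B_le _.
  by rewrite [X in _ <= X]mulnA [_./2 * 6]mulnC leq_mul2r s_le orbT.
rewrite leq_subLR in B_le; apply: leq_trans B_le _.
rewrite [X in _ <= X]mulnC [X in _ + X]mulnCA -mulnDr leq_mul2l; apply/orP; right.
by clear -L_gt0; lia.
Qed.

Lemma below_disjoint (V : finType) (G : sgraph V) (r : V) (d : V -> nat) (par : V -> V) v w :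
  (forall v, v != r -> adj G v (par v)) -> (forall v, v != r -> d (par v) < d v) ->
  v != r -> w != r -> v != w -> par v = par w -> [disjoint below r par v & below r par w].
Proof.
move=> par_adj par_lt.
have not_conn a b : a != r -> b != r -> a != b -> par a = par b -> ~~ connect (parent_edge r par) a b.
  move=> ar br ab Epar; apply/negP => /connectP[[|c p] /= up_p Eb]; first by rewrite Eb eqxx in ab.
  case/andP: up_p => /andP[_ /eqP Ec] up_p.
  have := @connect_up_lt V G r d par par_adj par_lt c b _ _.
  rewrite -Ec Epar; have := par_lt _ br; case: eqVneq => [->|_ lt_d]; first by rewrite ltnn.
  have cb : connect (parent_edge r par) (par b) b by rewrite -Epar Ec; apply/connectP; exists p.
  by move=> /(_ cb isT); rewrite ltnNge ltnW.
move=> vr wr vw Epar; apply/pred0P => i; apply/negP; rewrite /= !inE => /andP[/connectP[p up_p Ev] iw].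
elim: p i up_p Ev iw => [|j p IHp] i /= up_p Ev iw.
  by move: (not_conn v w vr wr vw Epar); rewrite Ev iw.
case/andP: up_p => /andP[ir /eqP Ej] up_p.
case/connectP: iw => [[|k q] /= up_q Ew].
  have: connect (parent_edge r par) w v.
    by rewrite Ew Ev; apply: (connect_trans (y := j)); [apply: connect1; rewrite /parent_edge /= ir Ej eqxx|apply/connectP; exists p].
  by apply/negP; apply: not_conn; rewrite // eq_sym.
case/andP: up_q => /andP[_ /eqP Ek] up_q; apply: (IHp j) => //.
by rewrite -Ej Ek; apply/connectP; exists q.
Qed.

(** * Greedy service in a tree *)

Section Timing.
Variables (V : finType) (G : sgraph V) (r : V) (lev : V -> nat) (par : V -> V).
Variables (tm : V -> nat) (D Delta : nat).
Hypothesis par_adj : forall v, v != r -> adj G v (par v).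
Hypothesis par_lt : forall v, v != r -> lev (par v) < lev v.
Hypothesis lev_le : forall v, lev v <= D.
Hypothesis Delta_gt0 : 0 < Delta.
Hypothesis children_le : forall v, #|[set w | parent_edge r par w v]| <= Delta.
Hypothesis tm_lt : forall v, v != r -> par v != r -> tm v < tm (par v).
Hypothesis tm_busy : forall v t, v != r -> t < tm v ->
  (exists2 w, parent_edge r par w v & t <= tm w) \/ (exists2 w, parent_edge r par w (par v) & tm w = t).

Let ready v := \max_(w | parent_edge r par w v) (tm w).+1.

(** If [ready v] is late, look at the last period in which [v] is served in every round:
    all children served in it got ready no earlier than its beginning. *)
Lemma late_ready_large k v : D - lev v + Delta * k <= ready v -> 2 ^ k <= #|below r par v|.
Proof.
have [m] := ubnP (D - lev v); elim: m k v => // m IHm k v; rewrite ltnS => le_m.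
case: k => [|k] late; first by rewrite card_gt0; apply/set0Pn; exists v; rewrite inE connect0.
pose served t := [exists w, parent_edge r par w v && (tm w == t)].
pose busy t := (t < ready v) && [forall x : 'I_(ready v), (t <= x) ==> served x].
have ready_gt0 : 0 < ready v by apply: leq_trans late; rewrite mulnS; lia.
have tm_ready w u : parent_edge r par w u -> tm w < ready u.
  by move=> wu; exact: (leq_bigmax_cond (F := fun w => (tm w).+1)).
have busy_last : busy (ready v).-1.
  rewrite /busy prednK // leqnn; apply/forallP => x; apply/implyP => le_x.
  have [none|w_ex] := posnP #|parent_edge r par^~ v|.
    by exfalso; move: ready_gt0; rewrite /ready big_pred0 // => w; apply: (card0_eq none).
  have [w wv Ew] := eq_bigmax_cond (fun w => (tm w).+1) w_ex.
  have {}Ew : ready v = (tm w).+1 := Ew.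
  apply/existsP; exists w; rewrite [parent_edge _ _ _ _]wv /=.
  by apply/eqP; have := ltn_ord x; lia.
have [t /andP[t_lt /forallP t_busy] t_min] := ex_minnP (ex_intro busy _ busy_last).
(* If [w] were ready before round [t], only a sibling served in round [t - 1] could have held it
   back, and the busy period would begin earlier. *)
have child_ready w : parent_edge r par w v -> t <= tm w -> t <= ready w.
  move=> wv wt; rewrite leqNgt; apply/negP => lt_t.
  have /andP[wr /eqP Ep] := wv; case: t t_lt t_busy t_min wt lt_t => [|t] // t_lt t_busy t_min wt lt_t.
  case: (tm_busy wr wt) => [[u uw tu]|[u uv Eu]].
    by have := tm_ready _ _ uw; move: tu lt_t; lia.
  have: busy t; last by move/t_min; rewrite ltnn.
  rewrite /busy (ltnW t_lt); apply/forallP => x; apply/implyP.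
  rewrite leq_eqVlt => /predU1P[Et|tx]; last by have := t_busy x; rewrite tx.
  by apply/existsP; exists u; rewrite -Et Eu eqxx andbT -Ep.
have child_lev w : parent_edge r par w v -> D - lev w < D - lev v.
  by case/andP=> /[dup] wr /par_lt + /eqP <-; have := lev_le w; lia.
have below_child w : parent_edge r par w v -> below r par w \subset below r par v.
  move=> wv; apply/subsetP => i; rewrite !inE => iw.
  by apply: connect_trans iw (connect1 wv).
(* A period of one round passes the lateness on to a child, at the price of one level. A longer one
   has two served children, each late by all but [Delta] rounds, since the period serves a different
   child in each round; their disjoint subtrees double the bound. *)
have [short|long] := leqP (ready v) t.+1.
  have /existsP[w /andP[wv /eqP/= Ew]] := implyP (t_busy (Ordinal t_lt)) (leqnn _).
  apply: leq_trans (subset_leq_card (below_child w wv)).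
  have wt : t <= tm w by rewrite Ew.
  apply: (IHm k.+1 w); first by apply: leq_trans le_m; exact: child_lev.
  have := child_ready w wv wt; have := child_lev w wv; lia.
have /existsP[w1 /andP[wv1 /eqP/= Ew1]] := implyP (t_busy (Ordinal t_lt)) (leqnn _).
have /existsP[w2 /andP[wv2 /eqP/= Ew2]] := implyP (t_busy (Ordinal long)) (leqnSn _).
have t_ge : ready v - t <= Delta.
  apply: leq_trans (children_le v).
  rewrite -(size_iota t (ready v - t)) -(size_image tm).
  apply: uniq_leq_size (iota_uniq _ _) _ => x; rewrite mem_iota subnKC ?(ltnW t_lt) // => /andP[tx xr].
  have /existsP[w /andP[wv /eqP/= <-]] := implyP (t_busy (Ordinal xr)) tx.
  by apply: image_f; rewrite inE.
have large w : parent_edge r par w v -> t <= tm w -> 2 ^ k <= #|below r par w|.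
  move=> wv wt; apply: IHm; first by apply: leq_trans le_m; exact: child_lev.
  have := child_ready w wv wt; have := child_lev w wv; rewrite mulnS in late; lia.
have w12 : [disjoint below r par w1 & below r par w2].
  have /andP[w1r /eqP p1] := wv1; have /andP[w2r /eqP p2] := wv2.
  apply: (below_disjoint par_adj par_lt) => //; last by rewrite p1 p2.
  by apply/eqP => E; move: (ltnSn t); rewrite -{2}Ew2 -E Ew1 ltnn.
rewrite expnS mul2n -addnn.
apply: leq_trans (leq_add (large w1 wv1 _) (large w2 wv2 _)) _; rewrite ?Ew1 ?Ew2 //=.
have /eqP <- : #|below r par w1 :|: below r par w2| == #|below r par w1| + #|below r par w2|.
  by rewrite (leq_card_setU _ _).2.
apply: subset_leq_card.
by rewrite subUset !below_child.
Qed.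

(** A root ready that late would have more descendants than there are vertices, and times increase
    towards the root. *)
Lemma gather_time k : #|V| < 2 ^ k -> forall v, v != r -> tm v < D + Delta * k.
Proof.
move=> lt_k.
have root_early : ready r < D + Delta * k.
  rewrite ltnNge; apply: contraL lt_k => le_r; rewrite -leqNgt.
  apply: leq_trans (max_card (mem (below r par r))).
  by apply: late_ready_large; apply: leq_trans le_r; rewrite leq_add2r leq_subr.
move=> v vr; apply: leq_trans (ltnW root_early).
have [m] := ubnP (lev v); elim: m v vr => // m IHm v vr; rewrite ltnS => le_m.
have vp : parent_edge r par v (par v) by rewrite /parent_edge /= vr eqxx.
have [Ep|pr] := eqVneq (par v) r.
  rewrite -Ep; exact: (leq_bigmax_cond (F := fun w => (tm w).+1)).
apply: ltn_trans (tm_lt vr pr) _; apply: IHm => //.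
by apply: leq_trans le_m; exact: par_lt.
Qed.
End Timing.

(** * Consecutive vertices of a path *)

Section Consecutive.
Variable V : eqType.
Implicit Types (s : seq V) (x y : V).

Definition consec s : rel V := fun a b => (a, b) \in zip s (behead s).

Lemma consec_cons2 x y s a b :
  consec [:: x, y & s] a b = ((a == x) && (b == y)) || consec (y :: s) a b.
Proof. by rewrite /consec /= inE -pair_eqE. Qed.

Lemma consec_mem s a b : consec s a b -> (a \in s) && (b \in behead s).
Proof.
case: s => // x s; elim: s x => // y s IHs x; rewrite consec_cons2 => /orP[/andP[/eqP-> /eqP->]|/IHs/andP[ay bs]].
  by rewrite !inE !eqxx.
by rewrite inE ay orbT inE /= bs orbT.
Qed.

Lemma consec_path (e : rel V) x s a b : path e x s -> consec (x :: s) a b -> e a b.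
Proof.
elim: s x => // y s IHs x /= /andP[exy path_s]; rewrite consec_cons2.
by case/orP=> [/andP[/eqP-> /eqP->]//|]; exact: IHs.
Qed.

Lemma path_consec x s : path (consec (x :: s)) x s.
Proof.
elim: s x => // y s IHs x /=; rewrite consec_cons2 !eqxx /=.
by apply: sub_path (IHs y) => a b ab; rewrite consec_cons2 ab orbT.
Qed.

Lemma consec_injr s a b b' : uniq s -> consec s a b -> consec s a b' -> b = b'.
Proof.
case: s => // x s; elim: s x => // y s IHs x /andP[xs uniq_s]; rewrite !consec_cons2.
case/orP=> [/andP[/eqP-> /eqP->]|ab] /orP[/andP[/eqP Ea /eqP->]|ab'] //; last exact: IHs ab ab'.
  by have /andP[xs' _] := consec_mem ab'; rewrite xs' in xs.
by have /andP[xs' _] := consec_mem ab; rewrite -Ea xs' in xs.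
Qed.

Lemma consec_injl s a a' b : uniq s -> consec s a b -> consec s a' b -> a = a'.
Proof.
case: s => // x s; elim: s x => // y s IHs x /andP[xs uniq_s]; rewrite !consec_cons2.
have ys : y \notin s by case/andP: uniq_s.
case/orP=> [/andP[/eqP-> /eqP->]|ab] /orP[/andP[/eqP-> /eqP Eb]|ab'] //; last exact: IHs ab ab'.
  by have /andP[_ /= ys'] := consec_mem ab'; rewrite ys' in ys.
by have /andP[_ /= ys'] := consec_mem ab; rewrite -Eb ys' in ys.
Qed.
End Consecutive.

(** Bernoulli's inequality [(1 + 1/s)^k >= 1 + k/s], multiplied by [s^(k+1)]. *)
Lemma bernoulli s k : s * s ^ k + k * s ^ k <= s * s.+1 ^ k.
Proof.
elim: k => [|k IHk]; first by rewrite !expn0; lia.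
have : s ^ k <= s.+1 ^ k by case: k {IHk} => // k; rewrite leq_exp2r.
by rewrite !expnS; move: IHk; move: (s ^ k) (s.+1 ^ k) => P Q; nia.
Qed.

(** * Merging along cheapest paths *)

Section Merge.
Variables (V : finType) (G : sgraph V).
Implicit Types (A U : {set V}) (w : V -> nat) (E : rel V).

Definition price A w z := #|A| * w z + \sum_u w u.

Definition refill A U := if #|U| + #|U| <= #|A| then A else U.

(** Both ends leave the unmatched set, but [u] stays active and represents [v] from now on. The path
    is simple, so it adds at most two edges at a vertex whose weight it doubles. *)
Definition merged A U w E A' U' w' E' : Prop :=
  exists u v p,
    [/\ u \in refill A U, v \in refill A U & u != v] /\
    [/\ path (adj G) u p, last u p = v & uniq (u :: p)] /\
    (forall i j q, i \in refill A U -> j \in refill A U -> i != j -> path (adj G) i q -> last i q = j ->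
       \sum_(z <- u :: p) price A w z <= \sum_(z <- i :: q) price A w z) /\
    [/\ A' = A :\ v, U' = refill A U :\ u :\ v,
        forall z, w' z = if z \in u :: p then w z + w z else w z
      & forall a b, E' a b = [|| E a b, consec (u :: p) a b | consec (u :: p) b a]].

Lemma refill_large A U : 1 < #|A| -> 1 < #|refill A U| /\ #|A| <= 6 * #|refill A U|./2.
Proof. by rewrite /refill => A_gt1; case: ifP => [_|/negbT]; rewrite -?ltnNge; lia. Qed.

Variable sched : seq {set V}.
Hypothesis gossip : gossip_schedule G sched.
Hypothesis sched_gt0 : 0 < size sched.
Let m := 15 * size sched.

(** [R] is the number of completed phases and [a] the number of active vertices at the start of the
    current one; a step takes two vertices from [U] and one from [A], hence the last equation. A
    representative that has already merged in this phase, one outside [U], may be farther away by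
    one more path. Each use of a vertex doubles its weight and adds at most two to its degree, hence
    the square. The power of [#|A|.+1] shrinks as the weights grow. *)
Definition merge_inv A U w E R a : Prop :=
  [/\ U \subset A, A != set0, forall z, 0 < w z, symmetric E & forall y z, E y z -> adj G y z] /\
  [/\ (\sum_z w z) * #|A|.+1 ^ m <= #|V| * #|V|.+1 ^ m,
      forall z, 2 ^ #|[set y | E z y]| <= w z ^ 2,
      forall z, exists a q, [/\ a \in A, path E z q, last z q = a & size q <= m * (R + (a \notin U))],
      3 ^ R * a <= 2 ^ R * #|V| & #|U| + a = 2 * #|A|].

Lemma merge_inv_refill A U w E R a : merge_inv A U w E R a ->
  exists R' a', merge_inv A (refill A U) w E R' a'.
Proof.
rewrite /refill; case: ifP => [half|_ inv]; last by exists R, a.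
case=> [[UA A0 w_gt0 E_sym E_adj] [W_le deg_le near R_le a_le]].
exists R.+1, #|A|; split; first by split.
split=> //.
- move=> z; have [b [q [bA path_q last_q size_q]]] := near z; exists b, q; split=> //.
  by apply: leq_trans size_q _; rewrite leq_mul2l bA; case: (b \notin U); rewrite orbC /=; lia.
(* From [#|U| + a = 2 * #|A|] and [2 * #|U| <= #|A|] follows [3 * #|A| <= 2 * a]. *)
- rewrite !expnS; move: R_le half a_le; move: (3 ^ R) (2 ^ R) #|V| #|U| #|A| => x y N k l R_le half a_le.
  by clear -R_le half a_le; nia.
by rewrite mul2n addnn.
Qed.

Lemma merged_inv A U w E A' U' w' E' R a :
  merge_inv A U w E R a -> 1 < #|A| -> merged A U w E A' U' w' E' ->
  #|A| = #|A'|.+1 /\ exists R' a', merge_inv A' U' w' E' R' a'.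
Proof.
move=> /merge_inv_refill[R' [a' inv]] A_gt1 [u [v [p [[]]]]].
have [] := refill_large U A_gt1.
move: {U R a}(refill A U) R' a' inv => U R a inv U_gt1 A_le uU vU uv.
have {inv} [[UA A0 w_gt0 E_sym E_adj] [W_le deg_le near R_le a_le]] := inv.
move=> [[adj_p last_p uniq_p] [cheapest [-> -> w'E E'E]]].
have uA := subsetP UA _ uU; have vA := subsetP UA _ vU.
have cardA : #|A| = #|A :\ v|.+1 by rewrite (cardsD1 v A) vA.
have cardU : #|U| = #|U :\ u :\ v|.+2.
  by rewrite (cardsD1 u U) uU (cardsD1 v (U :\ u)) !inE eq_sym uv vU.
set W := \sum_z w z in W_le.
have W_gt0 : 0 < W by rewrite /W (bigD1 u) //= addn_gt0 w_gt0.
have cost_le : \sum_(z <- u :: p) price A w z <= m * W.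
  exact: (cheap_connection gossip sched_gt0 U_gt1 A_le cheapest).
have cost_eq : \sum_(z <- u :: p) price A w z = #|A| * \sum_(z <- u :: p) w z + (size p).+1 * W.
  by rewrite big_split big_const_seq count_predT iter_addn_0 big_distrr mulnC.
have size_le : size p < m.
  rewrite -(leq_pmul2r W_gt0); apply: leq_trans cost_le; rewrite cost_eq leq_addl //.
have w_path_le : #|A| * \sum_(z <- u :: p) w z <= m * W.
  by apply: leq_trans cost_le; rewrite cost_eq leq_addr.
have W' : \sum_z w' z = W + \sum_(z <- u :: p) w z.
  rewrite (big_uniq _ uniq_p) /= [X in _ + X]big_mkcond -big_split; apply: eq_bigr => z _ /=.
  by rewrite w'E; case: ifP; rewrite ?addn0.
have E'_sym : symmetric E' by move=> x y; rewrite !E'E E_sym; congr (_ || _); rewrite orbC.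
have E_sub : subrel E E' by move=> x y xy; rewrite E'E xy.
split=> //; exists R, a; split; split=> //.
- by apply/subsetP => z; rewrite !inE => /and3P[-> _]; exact: (subsetP UA).
- by apply/set0Pn; exists u; rewrite !inE uv.
- by move=> z; rewrite w'E; case: ifP => _; rewrite ?addn_gt0 w_gt0.
- move=> y z; rewrite E'E => /or3P[/E_adj//|/(consec_path adj_p)//|/(consec_path adj_p)].
  by rewrite adj_sym.
(* The path has weight at most [m * W / #|A|], so the total grows by a factor of at most
   [1 + m / #|A|], which [bernoulli] absorbs in the drop from [#|A|.+1] to [#|A|]. *)
- rewrite W' -cardA; apply: leq_trans W_le.
  rewrite -(leq_pmul2l (ltnW A_gt1)) mulnA mulnDr.
  apply: leq_trans (_ : (#|A| * W + m * W) * #|A| ^ m <= _).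
    by rewrite leq_mul2r leq_add2l w_path_le orbT.
  by rewrite -mulnDl mulnAC mulnDl mulnCA [X in _ <= X]mulnC leq_mul2r bernoulli orbT.
- move=> z; have card_le1 (B : {set V}) : (forall x y, x \in B -> y \in B -> x = y) -> #|B| <= 1.
    by move=> B_eq; apply/card_le1P => x xB y; rewrite inE; apply/idP/eqP => [yB|->//]; exact: B_eq.
  have sub : [set y | E' z y] \subset [set y | E z y] :|: ([set y | consec (u :: p) z y] :|: [set y | consec (u :: p) y z]).
    by apply/subsetP => y; rewrite !inE E'E.
  rewrite w'E; case: ifPn => [zp|zNp]; last first.
    apply: leq_trans (deg_le z); rewrite leq_exp2l //; apply: subset_leq_card.
    apply/subsetP => y; rewrite !inE E'E => /or3P[//|/consec_mem/andP[zp _]|/consec_mem/andP[_ zp]].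
      by rewrite zp in zNp.
    by rewrite inE zp orbT in zNp.
  apply: leq_trans (_ : 2 ^ (#|[set y | E z y]| + 2) <= _); last first.
    by rewrite expnD addnn -mul2n expnMn mulnC leq_mul2l deg_le orbT.
  rewrite leq_exp2l //; apply: leq_trans (subset_leq_card sub) _.
  apply: leq_trans (leq_card_setU _ _).1 _; rewrite leq_add2l.
  apply: leq_trans (leq_card_setU _ _).1 _; rewrite -[2]/(1 + 1); apply: leq_add; apply: card_le1 => x y; rewrite !inE.
    exact: consec_injr.
  exact: consec_injl.
- move=> z; have [b [q [bA path_q last_q size_q]]] := near z.
  have path'_q : path E' z q by exact: sub_path path_q.
  (* What [v] represented is now represented by [u], reached by walking back along the path. [v] was
     unmatched and [u] is matched now, so the bound has room for one more path. *)
  have [bv|bv] := eqVneq b v.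
    have path'_p : path E' v (rev (belast u p)).
      rewrite -last_p rev_path; apply: sub_path (path_consec u p) => x y xy.
      by rewrite E'E xy !orbT.
    exists u, (q ++ rev (belast u p)); rewrite !inE uA uv cat_path path'_q last_q bv path'_p last_cat last_q bv.
    rewrite eqxx /= size_cat size_rev size_belast; split=> //.
      by rewrite -last_p; case: (p) => //= y p'; rewrite rev_cons last_rcons.
    rewrite bv vU addn0 in size_q; rewrite mulnDr muln1.
    by rewrite leq_add // ltnW.
  exists b, q; rewrite !inE bv bA; split=> //; apply: leq_trans size_q _.
  by rewrite leq_mul2l leq_add2l; case: (b \in U); rewrite ?orbT //= !andbF orbT.
- by rewrite cardA cardU in a_le; clear -a_le; lia.
Qed.

Lemma merge_inv_init : 0 < #|V| -> merge_inv setT setT (fun=> 1) (fun _ _ => false) 0 #|V|.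
Proof.
move=> V_gt0; split; split=> //.
- by rewrite -card_gt0 cardsT.
- by rewrite sum1_card cardsT.
- by move=> z; rewrite (_ : [set y | false] = set0) ?cards0 //; apply/setP => y; rewrite !inE.
- by move=> z; exists z, [::]; rewrite inE.
by rewrite cardsT mul2n addnn.
Qed.

(** With one active vertex left, a weight is at most [2^((l+1)(m+1))], so a degree is at most twice
    that exponent; [l + 1 <= 2 * l] and [m + 1 <= 16 * size sched] give 64. Every vertex is within
    [m * (R + 1)] of the active one, where [R <= 2 * l + 1] because [(3/2)^R <= #|V|] and [9/4 > 2].
    This is at most [60 * size sched * l], and a path between two vertices needs it twice. *)
Lemma merge_inv_single A U w E R a :
  let l := trunc_log 2 #|V| in
  0 < l -> merge_inv A U w E R a -> #|A| <= 1 ->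
  (forall z, #|[set y | E z y]| <= 64 * (size sched * l)) /\
  (forall x y, exists q, [/\ path E x q, last x q = y & size q <= 120 * (size sched * l)]).
Proof.
move=> l l_gt0 [[UA A0 w_gt0 E_sym E_adj] [W_le deg_le near R_le a_le]] A_le1.
have A1 : #|A| = 1 by apply/eqP; rewrite eqn_leq A_le1 card_gt0.
have V_gt0 : 0 < #|V| by apply: leq_trans (max_card (mem A)); rewrite A1.
have V_lt : #|V|.+1 <= 2 ^ l.+1 by rewrite trunc_log_ltn.
split=> [z|x y].
  have w_le : w z <= 2 ^ (l.+1 * m.+1).
    apply: leq_trans (_ : w z * #|A|.+1 ^ m <= _); first by rewrite leq_pmulr // expn_gt0.
    apply: leq_trans (_ : #|V| * #|V|.+1 ^ m <= _).
      by apply: leq_trans W_le; rewrite leq_mul2r (bigD1 z) //= leq_addr orbT.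
    apply: leq_trans (_ : #|V|.+1 ^ m.+1 <= _); first by rewrite expnS leq_mul2r leqnSn orbT.
    by rewrite expnM leq_exp2r.
  have : 2 ^ #|[set y | E z y]| <= 2 ^ (l.+1 * m.+1 * 2).
    by apply: leq_trans (deg_le z) _; rewrite expnM leq_exp2r.
  have arith L k : 0 < L -> 0 < k -> k.+1 * (15 * L).+1 * 2 <= 64 * (L * k) by clear; nia.
  by rewrite leq_exp2l // => /leq_trans; apply; exact: arith.
have R_small : R <= 2 * l + 1.
  have a_gt0 : 0 < a by have := subset_leq_card UA; clear -a_le A1; lia.
  rewrite leqNgt; apply/negP => R_large.
  have R_eq : R = 2 * l.+1 + (R - 2 * l.+1) by rewrite subnKC //; clear -R_large; lia.
  move: R_le; rewrite R_eq !expnD !expnM => R_le.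
  have : 2 ^ l.+1 * (2 ^ 2) ^ l.+1 <= (2 ^ 2) ^ l.+1 * #|V|.
    rewrite -(leq_pmul2r (_ : 0 < 2 ^ (R - 2 * l.+1))) ?expn_gt0 //.
    rewrite [X in _ <= X]mulnAC; apply: leq_trans R_le; rewrite -expnMn.
    apply: leq_trans (_ : (3 ^ 2) ^ l.+1 * 3 ^ (R - 2 * l.+1) <= _); last by rewrite leq_pmulr.
    apply: leq_mul; first by rewrite leq_exp2r.
    by case: (R - _) => // k; rewrite leq_exp2r.
  by rewrite mulnC leq_pmul2l ?expn_gt0 // leqNgt V_lt.
have [b [q [bA path_q last_q size_q]]] := near x.
have [b' [q' [b'A path_q' last_q' size_q']]] := near y.
have Eb : b' = b by move/eqP/cards1P: A1 bA b'A => [c ->]; rewrite !inE => /eqP-> /eqP->.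
exists (q ++ rev (belast y q')); split.
- rewrite cat_path path_q last_q -Eb -last_q' rev_path.
  by apply: sub_path path_q' => c d; rewrite E_sym.
- rewrite last_cat last_q -Eb -last_q'; case: (q') => //= c q''.
  by rewrite rev_cons last_rcons.
rewrite size_cat size_rev size_belast.
have hop_le (c : V) : m * (R + (c \notin U)) <= 60 * (size sched * l).
  have arith L k (b0 : bool) : 0 < L -> 0 < k -> R <= 2 * k + 1 -> 15 * L * (R + b0) <= 60 * (L * k).
    by clear; case: b0 => /= L_gt0 k_gt0 R_le; nia.
  exact: arith.
by apply: leq_trans (leq_add (leq_trans size_q (hop_le b)) (leq_trans size_q' (hop_le b'))) _; rewrite -mulnDl.
Qed.
End Merge.

(** * Radio schedules from trees *)

Section TreeGossip.
Variables (V : finType) (G : sgraph V) (r : V) (par : V -> V) (tm : V -> nat).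
Hypothesis par_adj : forall v, v != r -> adj G v (par v).
Hypothesis tree : forall v, connect (parent_edge r par) v r.
Hypothesis tm_lt : forall v, v != r -> par v != r -> tm v < tm (par v).

Definition parents (S : {set V}) : {set V} := par @: S.

Lemma knowledge_rcons s T v :
  knowledge G (rcons s T) v = radio_round G (knowledge G s) T v.
Proof. by rewrite /knowledge foldl_rcons. Qed.

Lemma knowledge_sub s s' v : knowledge G s v \subset knowledge G (s ++ s') v.
Proof.
elim/last_ind: s' => [|s' T IHs]; first by rewrite cats0.
by rewrite -rcons_cat knowledge_rcons; apply: subset_trans IHs _; exact: subsetUl.
Qed.

Lemma knowledge_self s v : v \in knowledge G s v.
Proof. by apply: (subsetP (knowledge_sub [::] s v)); rewrite inE. Qed.

Lemma knowledge_hear s (T : {set V}) u v :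
  [set u in T | adj G u v] = [set u] -> knowledge G s u \subset knowledge G (rcons s T) v.
Proof.
move=> Eu; rewrite knowledge_rcons /radio_round Eu cards1 eqxx big_set1.
exact: subsetUr.
Qed.

(** As it stands, [par c] hears nobody but [c] when [S] transmits. With [c] and [c'] exchanged, [c]
    hears nobody but [par c] when the parents transmit. So the same rounds serve gathering and
    broadcasting. *)
Definition independent (S : {set V}) :=
  forall c c', c \in S -> c' \in S -> c != c' -> ~~ adj G c' (par c).

Variable s : seq {set V}.
Hypothesis s_cover : forall v, v != r -> exists2 S, S \in s & v \in S.
Hypothesis s_root : forall S, S \in s -> r \notin S.
Hypothesis s_indep : forall S, S \in s -> independent S.
Hypothesis s_order : forall s1 S s2 S' c c', s = s1 ++ S :: s2 -> S' \in S :: s2 ->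
  c \in S -> c' \in S' -> tm c <= tm c'.

(** The subtree of [c] consists of [c] and the subtrees of its children, and these have smaller
    times, so [s_order] places their rounds before the round of [c]. *)
Lemma gather_knowledge s1 s2 : s = s1 ++ s2 ->
  forall S c, S \in s1 -> c \in S -> below r par c \subset knowledge G s1 (par c).
Proof.
elim/last_ind: s1 s2 => // s1 S IHs s2 Es S' c.
rewrite -cats1 -catA /= in Es; rewrite mem_rcons inE => /predU1P[->|S's1] cS'; last first.
  by apply: subset_trans (IHs _ Es _ _ S's1 cS') _; rewrite -cats1; exact: knowledge_sub.
have Ss : S \in s by rewrite Es mem_cat mem_head orbT.
have cr : c != r by apply: contraTneq cS' => ->; exact: s_root.
have hear : [set u in S | adj G u (par c)] = [set c].
  apply/setP => u; rewrite !inE; have [->|uc] := eqVneq u c; first by rewrite cS' par_adj.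
  by apply/negP => /andP[uS]; apply/negP; apply: (s_indep Ss) => //; rewrite eq_sym.
apply: subset_trans _ (knowledge_hear s1 hear); apply/subsetP => i ic.
have [->|i_ne] := eqVneq i c; first exact: knowledge_self.
have [v /andP[vr /eqP Ev] iv] := below_children ic i_ne.
have [S'' S''s vS''] := s_cover vr.
have lt_v : tm v < tm c by rewrite -Ev; apply: tm_lt; rewrite ?Ev.
move: S''s; rewrite Es mem_cat => /orP[S''s1|S''s2].
  by rewrite -Ev; apply: (subsetP (IHs _ Es _ _ S''s1 vS'')).
by have := s_order Es S''s2 cS' vS''; rewrite leqNgt lt_v.
Qed.

Lemma gather_complete : knowledge G s r = setT.
Proof.
apply/setP => i; rewrite [RHS]inE; have [->|ir] := eqVneq i r; first exact: knowledge_self.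
have : i \in below r par r by rewrite inE.
case/below_children => [//|v /andP[vr /eqP Ev] iv].
have [S Ss vS] := s_cover vr.
by rewrite -Ev; apply: (subsetP (gather_knowledge (esym (cats0 s)) Ss vS)).
Qed.

(** [par c] has a larger time than [c], so its round comes later in [s] and earlier in the reversal.
    The start is the root, complete after the gathering. *)
Lemma broadcast_knowledge s1 s2 : s = s1 ++ s2 ->
  forall S c, S \in s2 -> c \in S ->
  knowledge G (s ++ rev (map parents s2)) c = setT.
Proof.
elim: s2 s1 => // S s2 IHs s1 Es S' c; rewrite inE => S'S cS'.
rewrite /= rev_cons -rcons_cat; set K := s ++ _ in IHs *.
have Es' : s = rcons s1 S ++ s2 by rewrite cat_rcons.
have [S's2|S'_n] := boolP (S' \in s2).
  apply/eqP; rewrite eqEsubset subsetT -(IHs _ Es' S' c) // -cats1.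
  exact: knowledge_sub.
have {}S'S : S' = S by move: S'S; rewrite (negPf S'_n) orbF => /eqP.
rewrite {S'_n}S'S {S' S'S} in cS' *.
have Ss : S \in s by rewrite Es mem_cat mem_head orbT.
have cr : c != r by apply: contraTneq cS' => ->; exact: s_root.
have hear : [set u in parents S | adj G u c] = [set par c].
  apply/setP => u; rewrite !inE; have [->|uc] := eqVneq u (par c).
    by rewrite imset_f // adj_sym par_adj.
  apply/negP => /andP[/imsetP[c' c'S Eu]]; apply/negP; rewrite Eu adj_sym.
  by apply: (s_indep Ss) => //; apply: contraNneq uc => <-; rewrite Eu.
apply/eqP; rewrite eqEsubset subsetT /=; apply: subset_trans _ (knowledge_hear _ hear).
have [->|pr] := eqVneq (par c) r.
  by rewrite -gather_complete; exact: knowledge_sub.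
have [S'' S''s pS''] := s_cover pr; rewrite (IHs _ Es' S'') //.
move: S''s; rewrite Es' mem_cat mem_rcons inE => /orP[|//] /orP[/eqP ES|S''s1].
  rewrite ES in pS''.
  by have := s_order Es (mem_head _ _) pS'' cS'; rewrite leqNgt tm_lt.
case/splitPr: S''s1 Es => s3 s4; rewrite -catA /= => Es.
have S_late : S \in S'' :: s4 ++ S :: s2 by rewrite inE mem_cat mem_head !orbT.
by have := s_order Es S_late pS'' cS'; rewrite leqNgt tm_lt.
Qed.

Lemma tree_gossip : gossip_schedule G (s ++ rev (map parents s)).
Proof.
move=> v; have [->|vr] := eqVneq v r.
  apply/eqP; rewrite eqEsubset subsetT -gather_complete; exact: knowledge_sub.
have [S Ss vS] := s_cover vr.
exact: (broadcast_knowledge (s1 := [::]) erefl Ss vS).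
Qed.
End TreeGossip.

(** * A loop language and its compilation *)

(** Loop bounds are always [n], so that programs are polynomial by construction.
    Bound variables are named and must not be shadowed. *)
Inductive term :=
| Num of nat
| Var of nat
| Get of nat & term
| Plus of term & term
| Minus of term & term
| Scale of nat & term
| Cond of test & term & term
| Sum of nat & term
with test :=
| Eq of term & term
| Leq of term & term
| And of test & test
| Or of test & test
| Neg of test
| Ex of nat & test.

Scheme term_mut := Induction for term Sort Prop
with test_mut := Induction for test Sort Prop.
Combined Scheme term_test_ind from term_mut, test_mut.

Inductive prog :=
| Assign of nat & term & term
| Then of prog & prog
| When of test & prog
| Each of nat & prog.

Definition upd (env : nat -> nat) (x i : nat) : nat -> nat :=
  fun y => if y == x then i else env y.

Section Semantics.
Variable n : nat.

(** [Scale x e] is [n * e]; the name [x] is that of the loop variable of its implementation. *)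
Fixpoint value (m : memory) (env : nat -> nat) (e : term) : nat :=
  match e with
  | Num k => k
  | Var x => env x
  | Get a e1 => m a (value m env e1)
  | Plus e1 e2 => value m env e1 + value m env e2
  | Minus e1 e2 => value m env e1 - value m env e2
  | Scale _ e1 => n * value m env e1
  | Cond t e1 e2 => if holds m env t then value m env e1 else value m env e2
  | Sum x e1 => \sum_(i < n) value m (upd env x i) e1
  end
with holds (m : memory) (env : nat -> nat) (t : test) : bool :=
  match t with
  | Eq e1 e2 => value m env e1 == value m env e2
  | Leq e1 e2 => value m env e1 <= value m env e2
  | And t1 t2 => holds m env t1 && holds m env t2
  | Or t1 t2 => holds m env t1 || holds m env t2
  | Neg t1 => ~~ holds m env t1
  | Ex x t1 => [exists i : 'I_n, holds m (upd env x i) t1]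
  end.

Fixpoint run (env : nat -> nat) (p : prog) (m : memory) : memory :=
  match p with
  | Assign a e1 e2 => update m a (value m env e1) (value m env e2)
  | Then p1 p2 => run env p2 (run env p1 m)
  | When t p1 => if holds m env t then run env p1 m else m
  | Each x p1 => foldl (fun m' (i : 'I_n) => run (upd env x i) p1 m') m (enum 'I_n)
  end.
End Semantics.

(** Arrays below 20 belong to the program, array 20 holds the loop variables by name, and array 21
    is the evaluation stack. *)
Definition vars := 20.
Definition regs := 21.

Fixpoint wf_term (bound : seq nat) (e : term) : bool :=
  match e with
  | Num _ => true
  | Var x => x \in bound
  | Get a e1 => (a < vars) && wf_term bound e1
  | Plus e1 e2 | Minus e1 e2 => wf_term bound e1 && wf_term bound e2
  | Scale x e1 => (x \notin bound) && wf_term bound e1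
  | Cond t e1 e2 => [&& wf_test bound t, wf_term bound e1 & wf_term bound e2]
  | Sum x e1 => (x \notin bound) && wf_term (x :: bound) e1
  end
with wf_test (bound : seq nat) (t : test) : bool :=
  match t with
  | Eq e1 e2 | Leq e1 e2 => wf_term bound e1 && wf_term bound e2
  | And t1 t2 | Or t1 t2 => wf_test bound t1 && wf_test bound t2
  | Neg t1 => wf_test bound t1
  | Ex x t1 => (x \notin bound) && wf_test (x :: bound) t1
  end.

(** Array 0 must not be written, since the loops read their bound [n] from it. *)
Fixpoint wf (bound : seq nat) (p : prog) : bool :=
  match p with
  | Assign a e1 e2 => [&& 0 < a < vars, wf_term bound e1 & wf_term bound e2]
  | Then p1 p2 => wf bound p1 && wf bound p2
  | When t p1 => wf_test bound t && wf bound p1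
  | Each x p1 => (x \notin bound) && wf (x :: bound) p1
  end.

Definition reg d := Read regs (Const d).
Definition set_reg d e := Write regs (Const d) e.
Definition loop x body :=
  Seq (Write vars (Const x) (Const 0))
    (While (Defs.Sub (Read 0 (Const 0)) (Read vars (Const x)))
       (Seq body (Write vars (Const x) (Add (Read vars (Const x)) (Const 1))))).

(** The code of the operands, followed by [e], which finds their values in the registers
    [d] and [d.+1] and leaves the result in register [d]. *)
Definition binary (c1 c2 : nat -> cmd) (e : nat -> expr) (d : nat) : cmd :=
  Seq (c1 d) (Seq (c2 d.+1) (set_reg d (e d))).
Definition sum_loop x (c : nat -> cmd) (d : nat) : cmd :=
  Seq (set_reg d (Const 0)) (loop x (Seq (c d.+1) (set_reg d (Add (reg d) (reg d.+1))))).

Definition scale x (c : nat -> cmd) (d : nat) : cmd :=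
  Seq (c d) (Seq (set_reg d.+1 (Const 0))
    (Seq (loop x (set_reg d.+1 (Add (reg d.+1) (reg d)))) (set_reg d (reg d.+1)))).

Fixpoint compile_term (e : term) (d : nat) : cmd :=
  match e with
  | Num k => set_reg d (Const k)
  | Var x => set_reg d (Read vars (Const x))
  | Get a e1 => Seq (compile_term e1 d) (set_reg d (Read a (reg d)))
  | Plus e1 e2 => binary (compile_term e1) (compile_term e2) (fun d => Add (reg d) (reg d.+1)) d
  | Minus e1 e2 => binary (compile_term e1) (compile_term e2) (fun d => Defs.Sub (reg d) (reg d.+1)) d
  | Scale x e1 => scale x (compile_term e1) d
  | Cond t e1 e2 => Seq (compile_test t d) (If (reg d) (compile_term e1 d) (compile_term e2 d))
  | Sum x e1 => sum_loop x (compile_term e1) d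
  end
with compile_test (t : test) (d : nat) : cmd :=
  match t with
  | Eq e1 e2 => binary (compile_term e1) (compile_term e2)
      (fun d => Defs.Sub (Const 1) (Add (Defs.Sub (reg d) (reg d.+1)) (Defs.Sub (reg d.+1) (reg d)))) d
  | Leq e1 e2 => binary (compile_term e1) (compile_term e2)
      (fun d => Defs.Sub (Const 1) (Defs.Sub (reg d) (reg d.+1))) d
  | And t1 t2 => binary (compile_test t1) (compile_test t2)
      (fun d => Defs.Sub (Add (reg d) (reg d.+1)) (Const 1)) d
  | Or t1 t2 => binary (compile_test t1) (compile_test t2)
      (fun d => Defs.Sub (Const 1) (Defs.Sub (Const 1) (Add (reg d) (reg d.+1)))) d
  | Neg t1 => Seq (compile_test t1 d) (set_reg d (Defs.Sub (Const 1) (reg d)))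
  | Ex x t1 => Seq (sum_loop x (compile_test t1) d)
      (set_reg d (Defs.Sub (Const 1) (Defs.Sub (Const 1) (reg d))))
  end.

Fixpoint compile (p : prog) : cmd :=
  match p with
  | Assign a e1 e2 => Seq (compile_term e1 0) (Seq (compile_term e2 1) (Write a (reg 0) (reg 1)))
  | Then p1 p2 => Seq (compile p1) (compile p2)
  | When t p1 => Seq (compile_test t 0) (If (reg 0) (compile p1) Skip)
  | Each x p1 => loop x (compile p1)
  end.

Definition sum_loop_cost (c n : nat) := 1 + (1 + (n * (c + 1 + 2) + 1)).

Fixpoint term_cost (e : term) (n : nat) : nat :=
  match e with
  | Num _ | Var _ => 1
  | Get _ e1 => term_cost e1 n + 1
  | Plus e1 e2 | Minus e1 e2 => term_cost e1 n + (term_cost e2 n + 1)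
  | Scale _ e1 => term_cost e1 n + (1 + (1 + (n * 3 + 1) + 1))
  | Cond t e1 e2 => test_cost t n + (term_cost e1 n + term_cost e2 n + 1)
  | Sum _ e1 => sum_loop_cost (term_cost e1 n) n
  end
with test_cost (t : test) (n : nat) : nat :=
  match t with
  | Eq e1 e2 | Leq e1 e2 => term_cost e1 n + (term_cost e2 n + 1)
  | And t1 t2 | Or t1 t2 => test_cost t1 n + (test_cost t2 n + 1)
  | Neg t1 => test_cost t1 n + 1
  | Ex _ t1 => sum_loop_cost (test_cost t1 n) n + 1
  end.

Fixpoint cost (p : prog) (n : nat) : nat :=
  match p with
  | Assign _ e1 e2 => term_cost e1 n + (term_cost e2 n + 1)
  | Then p1 p2 => cost p1 n + cost p2 n
  | When t p1 => test_cost t n + (cost p1 n + 2)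
  | Each _ p1 => 1 + (n * (cost p1 n + 2) + 1)
  end.

Definition simulates (bound : seq nat) (env : nat -> nat) (m M : memory) : Prop :=
  (forall a i, a < vars -> M a i = m a i) /\ {in bound, forall x, M vars x = env x}.

Lemma updE m a i x b j : update m a i x b j = if (b == a) && (j == i) then x else m b j.
Proof. by []. Qed.

Lemma simulates_reg bound env m M d v :
  simulates bound env m M -> simulates bound env m (update M regs d v).
Proof.
case=> agree bound_ok; split=> [a i a_lt|x xb]; rewrite updE /=; last exact: bound_ok.
by rewrite ltn_eqF ?agree // (ltn_trans a_lt).
Qed.

Lemma simulates_upd bound env m M x i : x \notin bound ->
  simulates (x :: bound) (upd env x i) m M -> simulates bound env m M.
Proof.
move=> xb [agree bound_ok]; split=> // y yb.
rewrite bound_ok ?inE ?yb ?orbT // /upd; case: eqP => // Ey.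
by rewrite -Ey yb in xb.
Qed.

Lemma simulates_var bound env m M x i :
  simulates bound env m M -> simulates (x :: bound) (upd env x i) m (update M vars x i).
Proof.
move=> [agree bound_ok]; split=> [a k a_lt|y]; rewrite updE /=.
  by rewrite ltn_eqF ?agree.
by rewrite inE /upd; have [->|yx] //= := eqVneq y x; exact: bound_ok.
Qed.

Lemma exec_loop (n x T : nat) (body : cmd) (M : memory) (inv : nat -> memory -> Prop) :
  (forall i M, inv i M -> M 0 0 = n /\ M vars x = i) -> inv 0 (update M vars x 0) ->
  (forall i M, i < n -> inv i M -> exists t M',
    [/\ exec body M t M', t <= T & inv i.+1 (update M' vars x (M' vars x + 1))]) ->
  exists t M', [/\ exec (loop x body) M t M', t <= 1 + (n * (T + 2) + 1) & inv n M'].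
Proof.
move=> inv_x inv0 step.
suff while_exec k i M1 : i + k = n -> inv i M1 -> exists t M', [/\ exec (While (Defs.Sub (Read 0 (Const 0)) (Read vars (Const x)))
       (Seq body (Write vars (Const x) (Add (Read vars (Const x)) (Const 1))))) M1 t M',
       t <= k * (T + 2) + 1 & inv n M'].
  have [t [M' [ex t_le invn]]] := while_exec n 0 _ (add0n n) inv0.
  exists (1 + t), M'; split=> //.
  by apply: exec_seq ex; exact: exec_write.
elim: k i M1 => [|k IHk] i M1 Ei invi; have [M0 Mx] := inv_x _ _ invi.
  exists 1, M1; rewrite -Ei addn0; split=> //; apply: exec_while_done.
  by rewrite /= M0 Mx -Ei addn0 subnn.
have lt_i : i < n by rewrite -Ei addnS ltnS leq_addr.
have [t1 [M2 [ex1 t1_le inv2]]] := step _ _ lt_i invi.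
have [|t2 [M3 [ex2 t2_le inv3]]] := IHk i.+1 _ _ inv2; first by rewrite addSnnS.
exists ((t1 + 1) + t2).+1, M3; split=> //; last by rewrite mulSn; lia.
apply: exec_while_loop ex2; first by rewrite /= M0 Mx -lt0n subn_gt0.
by apply: exec_seq ex1 _; exact: exec_write.
Qed.

Section Correctness.
Variable n : nat.

(** The last clause makes the registers a stack: the code of a second operand, run at [d.+1],
    preserves the first operand in register [d]. *)
Definition computes bound env m (c : nat -> cmd) (T v : nat) : Prop :=
  forall d M, simulates bound env m M -> exists t M',
    [/\ exec (c d) M t M', t <= T, simulates bound env m M', M' regs d = v
      & forall j, j < d -> M' regs j = M regs j].

Lemma computes_set bound env m (e : nat -> expr) v :
  (forall d M, simulates bound env m M -> eval M (e d) = v) ->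
  computes bound env m (fun d => set_reg d (e d)) 1 v.
Proof.
move=> eval_e d M sim; exists 1, (update M regs d v); split=> //.
- by rewrite -(eval_e d M sim); exact: exec_write.
- exact: simulates_reg.
- by rewrite updE !eqxx.
by move=> j lt_j; rewrite updE (ltn_eqF lt_j) andbF.
Qed.

Lemma computes_unary bound env m c T v (e : nat -> expr) v' :
  computes bound env m c T v ->
  (forall d M, simulates bound env m M -> M regs d = v -> eval M (e d) = v') ->
  computes bound env m (fun d => Seq (c d) (set_reg d (e d))) (T + 1) v'.
Proof.
move=> comp eval_e d M sim; have [t [M1 [ex1 t_le sim1 v1 keep1]]] := comp d M sim.
exists (t + 1), (update M1 regs d v'); split.
- by apply: exec_seq ex1 _; rewrite -(eval_e d M1 sim1 v1); exact: exec_write.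
- by rewrite leq_add2r.
- exact: simulates_reg.
- by rewrite updE !eqxx.
by move=> j lt_j; rewrite updE (ltn_eqF lt_j) andbF keep1.
Qed.

Lemma computes_binary bound env m c1 c2 T1 T2 v1 v2 (e : nat -> expr) v :
  computes bound env m c1 T1 v1 -> computes bound env m c2 T2 v2 ->
  (forall d M, M regs d = v1 -> M regs d.+1 = v2 -> eval M (e d) = v) ->
  computes bound env m (binary c1 c2 e) (T1 + (T2 + 1)) v.
Proof.
move=> comp1 comp2 eval_e d M sim; have [t1 [M1 [ex1 t1_le sim1 Ev1 keep1]]] := comp1 d M sim.
have [t2 [M2 [ex2 t2_le sim2 Ev2 keep2]]] := comp2 d.+1 M1 sim1.
exists (t1 + (t2 + 1)), (update M2 regs d v); split.
- apply: exec_seq ex1 _; apply: exec_seq ex2 _.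
  by rewrite -(eval_e d M2 _ Ev2); [exact: exec_write|rewrite keep2].
- by rewrite leq_add ?leq_add2r.
- exact: simulates_reg.
- by rewrite updE !eqxx.
by move=> j lt_j; rewrite updE (ltn_eqF lt_j) andbF keep2 ?keep1 // ltnS ltnW.
Qed.

Lemma computes_sum_loop bound env m x c T F : x \notin bound -> m 0 0 = n ->
  (forall i, computes (x :: bound) (upd env x i) m c T (F i)) ->
  computes bound env m (sum_loop x c) (sum_loop_cost T n) (\sum_(i < n) F i).
Proof.
move=> xb m0 comp d M sim.
pose inv i (M' : memory) := [/\ simulates (x :: bound) (upd env x i) m M',
  M' regs d = \sum_(j < i) F j & forall j, j < d -> M' regs j = M regs j].
have [||i M1 lt_i [sim1 acc1 keep1]|t [M' [ex t_le [sim' acc' keep']]]] :=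
  @exec_loop n x (T + 1) (Seq (c d.+1) (set_reg d (Add (reg d) (reg d.+1)))) (update M regs d 0) inv.
- by move=> i M1 [[agree bound_ok] _ _]; rewrite agree // bound_ok ?mem_head // /upd eqxx.
- split; first by apply: simulates_var; exact: simulates_reg.
    by rewrite big_ord0 !updE !eqxx.
  by move=> j lt_j; rewrite !updE /= (ltn_eqF lt_j).
- have [t2 [M2 [ex2 t2_le sim2 v2 keep2]]] := comp i d.+1 M1 sim1.
  set M3 := update M2 regs d (M2 regs d + M2 regs d.+1).
  exists (t2 + 1), M3; split.
  + by apply: exec_seq ex2 _; exact: exec_write.
  + by rewrite leq_add2r.
  have sim3 := simulates_reg d (M2 regs d + M2 regs d.+1) sim2.
  have Mx : M3 vars x + 1 = i.+1.
    have -> : M3 vars x = upd env x i x by apply: (proj2 sim3); exact: mem_head.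
    by rewrite /upd eqxx addn1.
  split.
  + by rewrite Mx; apply: simulates_var (simulates_upd xb sim3).
  + by rewrite big_ord_recr /M3 /= !updE /= eqxx v2 keep2 // acc1.
  by move=> j lt_j; rewrite /M3 !updE /= (ltn_eqF lt_j) keep2 ?keep1 // ltnS ltnW.
exists (1 + t), M'; split=> //; first by apply: exec_seq ex; exact: exec_write.
exact: simulates_upd sim'.
Qed.

Lemma computes_scale bound env m x c T v : x \notin bound -> m 0 0 = n ->
  computes bound env m c T v ->
  computes bound env m (scale x c) (T + (1 + (1 + (n * 3 + 1) + 1))) (n * v).
Proof.
move=> xb m0 comp d M sim; have [t1 [M1 [ex1 t1_le sim1 v1 keep1]]] := comp d M sim.
pose inv i (M' : memory) := [/\ simulates (x :: bound) (upd env x i) m M',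
  M' regs d = v, M' regs d.+1 = i * v & forall j, j < d -> M' regs j = M regs j].
have [||i M2 lt_i [sim2 v2 acc2 keep2]|t [M' [ex t_le [sim' v' acc' keep']]]] :=
  @exec_loop n x 1 (set_reg d.+1 (Add (reg d.+1) (reg d))) (update M1 regs d.+1 0) inv.
- by move=> i M2 [[agree bound_ok] _ _ _]; rewrite agree // bound_ok ?mem_head // /upd eqxx.
- split; first by apply: simulates_var; exact: simulates_reg.
  + by rewrite !updE /= ltn_eqF.
  + by rewrite !updE /= eqxx.
  by move=> j lt_j; rewrite !updE /= ltn_eqF ?keep1 // ltnW.
- set M3 := update M2 regs d.+1 (M2 regs d.+1 + M2 regs d).
  exists 1, M3; split; [exact: exec_write|by []|].
  have sim3 := simulates_reg d.+1 (M2 regs d.+1 + M2 regs d) sim2.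
  have Mx : M3 vars x + 1 = i.+1.
    have -> : M3 vars x = upd env x i x by apply: (proj2 sim3); exact: mem_head.
    by rewrite /upd eqxx addn1.
  split.
  + by rewrite Mx; apply: simulates_var (simulates_upd xb sim3).
  + by rewrite /M3 !updE /= ltn_eqF.
  + by rewrite /M3 !updE /= eqxx v2 acc2 mulSn addnC.
  by move=> j lt_j; rewrite /M3 !updE /= ltn_eqF ?keep2 // ltnW.
exists (t1 + (1 + (t + 1))), (update M' regs d (M' regs d.+1)); split.
- apply: exec_seq ex1 _; apply: exec_seq; first exact: exec_write.
  by apply: exec_seq ex _; exact: exec_write.
- by rewrite leq_add // leq_add2l leq_add2r.
- by apply: simulates_reg; exact: simulates_upd sim'.
- by rewrite updE !eqxx acc'.
by move=> j lt_j; rewrite updE (ltn_eqF lt_j) andbF keep'.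
Qed.

Lemma computes_cond bound env m c c1 c2 (b : bool) T T1 T2 v1 v2 :
  computes bound env m c T b -> computes bound env m c1 T1 v1 -> computes bound env m c2 T2 v2 ->
  computes bound env m (fun d => Seq (c d) (If (reg d) (c1 d) (c2 d)))
    (T + (T1 + T2 + 1)) (if b then v1 else v2).
Proof.
move=> comp comp1 comp2 d M sim; have [t [M1 [ex t_le sim1 vb keep]]] := comp d M sim.
case: b {comp} vb => vb.
  have [t1 [M2 [ex1 t1_le sim2 Ev1 keep1]]] := comp1 d M1 sim1.
  exists (t + t1.+1), M2; split=> //.
  - by apply: exec_seq ex _; apply: exec_if; rewrite /= vb.
  - by rewrite leq_add // -addn1 leq_add2r (leq_trans t1_le) ?leq_addr.
  by move=> j lt_j; rewrite keep1 ?keep.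
have [t2 [M2 [ex2 t2_le sim2 Ev2 keep2]]] := comp2 d M1 sim1.
exists (t + t2.+1), M2; split=> //.
- by apply: exec_seq ex _; apply: exec_if; rewrite /= vb.
- by rewrite leq_add // -addn1 leq_add2r (leq_trans t2_le) ?leq_addl.
by move=> j lt_j; rewrite keep2 ?keep.
Qed.

Lemma compile_term_test m : m 0 0 = n ->
  (forall e bound env, wf_term bound e ->
     computes bound env m (compile_term e) (term_cost e n) (value n m env e)) /\
  (forall t bound env, wf_test bound t ->
     computes bound env m (compile_test t) (test_cost t n) (holds n m env t)).
Proof.
move=> m0; apply: term_test_ind => /=.
- by move=> k bound env _; exact: computes_set.
- by move=> x bound env xb; apply: computes_set => d M [_]; apply.
- move=> a e1 IH1 bound env /andP[a_lt wf1]; apply: computes_unary (IH1 _ env wf1) _.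
  by move=> d M [agree _] /= ->; exact: agree.
- move=> e1 IH1 e2 IH2 bound env /andP[wf1 wf2].
  by apply: (computes_binary (IH1 _ env wf1) (IH2 _ env wf2)) => d M /= -> ->.
- move=> e1 IH1 e2 IH2 bound env /andP[wf1 wf2].
  by apply: (computes_binary (IH1 _ env wf1) (IH2 _ env wf2)) => d M /= -> ->.
- by move=> x e1 IH1 bound env /andP[xb wf1]; apply: computes_scale => //; exact: IH1.
- by move=> t IH e1 IH1 e2 IH2 bound env /and3P[wft wf1 wf2]; apply: computes_cond; auto.
- by move=> x e1 IH1 bound env /andP[xb wf1]; apply: (computes_sum_loop xb m0 (fun i => IH1 _ (upd env x i) wf1)).
- move=> e1 IH1 e2 IH2 bound env /andP[wf1 wf2].
  apply: (computes_binary (IH1 _ env wf1) (IH2 _ env wf2)) => d M /= -> ->.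
  by case: eqVneq; lia.
- move=> e1 IH1 e2 IH2 bound env /andP[wf1 wf2].
  apply: (computes_binary (IH1 _ env wf1) (IH2 _ env wf2)) => d M /= -> ->.
  by case: leqP; lia.
- move=> t1 IH1 t2 IH2 bound env /andP[wf1 wf2].
  apply: (computes_binary (IH1 _ env wf1) (IH2 _ env wf2)) => d M /= -> ->.
  by do 2![case: holds].
- move=> t1 IH1 t2 IH2 bound env /andP[wf1 wf2].
  apply: (computes_binary (IH1 _ env wf1) (IH2 _ env wf2)) => d M /= -> ->.
  by do 2![case: holds].
- move=> t1 IH1 bound env wf1; apply: (computes_unary (IH1 _ env wf1)) => d M _ /= ->.
  by case: holds.
move=> x t1 IH1 bound env /andP[xb wf1].
apply: computes_unary (computes_sum_loop xb m0 (fun i => IH1 _ (upd env x i) wf1)) _.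
move=> d M _ /= ->; case: existsP => [[i ti]|none].
  by rewrite (bigD1 i) //= ti.
by rewrite big1 // => i _; apply/eqP; rewrite eqb0; apply/negP => Ei; case: none; exists i.
Qed.

Lemma foldl_take_enum (T : Type) (f : T -> 'I_n -> T) (z : T) (i : 'I_n) :
  foldl f z (take i.+1 (enum 'I_n)) = f (foldl f z (take i (enum 'I_n))) i.
Proof.
by rewrite (take_nth i) ?size_enum_ord // foldl_rcons nth_ord_enum.
Qed.

Lemma foldl_enum_ind (T : Type) (P : nat -> T -> Prop) (f : T -> 'I_n -> T) (z : T) :
  P 0 z -> (forall (i : 'I_n) z, P i z -> P i.+1 (f z i)) -> P n (foldl f z (enum 'I_n)).
Proof.
move=> P0 Pstep; rewrite -[enum 'I_n]take_size size_enum_ord.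
suff: forall k, k <= n -> P k (foldl f z (take k (enum 'I_n))) by apply.
elim=> [|k IHk] lt_k; first by rewrite take0.
by rewrite (foldl_take_enum f z (Ordinal lt_k)); apply: (Pstep (Ordinal lt_k)); apply: IHk; exact: ltnW.
Qed.

Lemma run_frame p env bound m : wf bound p -> run n env p m 0 0 = m 0 0.
Proof.
elim: p env bound m => [a e1 e2|p1 IH1 p2 IH2|e p1 IH1|x p1 IH1] env bound m /=.
- by case/and3P=> /andP[a_gt0 _] _ _; rewrite updE ltn_eqF.
- by case/andP=> wf1 wf2; rewrite (IH2 _ _ _ wf2) (IH1 _ _ _ wf1).
- by case/andP=> _ wf1; case: ifP => // _; exact: IH1 wf1.
case/andP=> _ wf1; apply: (foldl_enum_ind (P := fun _ m' => m' 0 0 = m 0 0)) => // i m' <-.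
exact: IH1 wf1.
Qed.

Lemma compileP p bound env m M : wf bound p -> m 0 0 = n -> simulates bound env m M ->
  exists t M', [/\ exec (compile p) M t M', t <= cost p n & simulates bound env (run n env p m) M'].
Proof.
elim: p bound env m M => [a e1 e2|p1 IH1 p2 IH2|e p1 IH1|x p1 IH1] bound env m M /= wf_p m0 sim.
- case/and3P: wf_p => /andP[a_gt0 a_lt] wf1 wf2.
  have [t1 [M1 [ex1 t1_le sim1 v1 _]]] := (compile_term_test m0).1 _ _ env wf1 0 _ sim.
  have [t2 [M2 [ex2 t2_le [agree bound_ok] v2 keep2]]] := (compile_term_test m0).1 _ _ env wf2 1 _ sim1.
  exists (t1 + (t2 + 1)), (update M2 a (M2 regs 0) (M2 regs 1)); split.
  + by apply: exec_seq ex1 _; apply: exec_seq ex2 _; exact: exec_write.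
  + by rewrite leq_add ?leq_add2r.
  split=> [b i b_lt|x xb]; rewrite !updE; first by rewrite keep2 // v1 v2 agree.
  by rewrite eq_sym ltn_eqF //= bound_ok.
- case/andP: wf_p => wf1 wf2; have [t1 [M1 [ex1 t1_le sim1]]] := IH1 _ _ _ _ wf1 m0 sim.
  have [|t2 [M2 [ex2 t2_le sim2]]] := IH2 _ _ _ _ wf2 _ sim1; first by rewrite (run_frame _ _ wf1).
  by exists (t1 + t2), M2; split=> //; [exact: exec_seq ex2|rewrite leq_add].
- case/andP: wf_p => wfe wf1; have [t1 [M1 [ex1 t1_le sim1 v1 _]]] := (compile_term_test m0).2 _ _ env wfe 0 _ sim.
  have [t2 [M2 [ex2 t2_le sim2]]] := IH1 _ _ _ _ wf1 m0 sim1.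
  case: ifP v1 => _ v1; last first.
    exists (t1 + 2), M1; split=> //; last by rewrite leq_add // leq_addl.
    by apply: exec_seq ex1 _; apply: exec_if; rewrite /= v1; exact: exec_skip.
  exists (t1 + t2.+1), M2; split=> //; last by rewrite leq_add // -addn1 leq_add.
  by apply: exec_seq ex1 _; apply: exec_if; rewrite /= v1.
case/andP: wf_p => xb wf1; pose f m' (i : 'I_n) := run n (upd env x i) p1 m'.
pose inv i (M' : memory) :=
  simulates (x :: bound) (upd env x i) (foldl f m (take i (enum 'I_n))) M'.
have f0 k : foldl f m (take k (enum 'I_n)) 0 0 = n.
  elim/last_ind: (take k _) => [|s i IHs] //.
  by rewrite foldl_rcons /f (run_frame _ _ wf1).
have [i M' [agree bound_ok]||i M1 lt_i sim1|t [M' [ex t_le sim']]] :=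
  @exec_loop n x (cost p1 n) (compile p1) M inv.
- by rewrite agree // f0 bound_ok ?mem_head // /upd eqxx.
- by rewrite /inv take0; exact: simulates_var.
- have [t2 [M2 [ex2 t2_le sim2]]] := IH1 _ _ _ _ wf1 (f0 i) sim1.
  exists t2, M2; split=> //; rewrite /inv (proj2 sim2) ?mem_head // {2}/upd eqxx addn1.
  rewrite (foldl_take_enum f m (Ordinal lt_i)).
  exact: simulates_var (simulates_upd xb sim2).
exists t, M'; split=> //; move: sim'; rewrite /inv take_oversize ?size_enum_ord //.
exact: simulates_upd.
Qed.
End Correctness.

(** * Polynomial running time *)

Definition poly_bounded (f : nat -> nat) := exists c k, forall n, f n <= c * n.+1 ^ k.

Lemma poly_const a : poly_bounded (fun=> a).
Proof. by exists a, 0 => n; rewrite muln1. Qed.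

Lemma poly_add f g : poly_bounded f -> poly_bounded g -> poly_bounded (fun n => f n + g n).
Proof.
move=> [c [k f_le]] [c' [k' g_le]]; exists (c + c'), (k + k') => n; rewrite mulnDl leq_add //.
  by apply: leq_trans (f_le n) _; rewrite leq_mul2l leq_pexp2l ?orbT // leq_addr.
by apply: leq_trans (g_le n) _; rewrite leq_mul2l leq_pexp2l ?orbT // leq_addl.
Qed.

Lemma poly_mul f : poly_bounded f -> poly_bounded (fun n => n * f n).
Proof.
move=> [c [k f_le]]; exists c, k.+1 => n; rewrite expnS mulnCA leq_mul //.
Qed.

Lemma term_test_cost_poly :
  (forall e, poly_bounded (term_cost e)) /\ (forall t, poly_bounded (test_cost t)).
Proof.
apply: term_test_ind => /= *; rewrite /sum_loop_cost;
  repeat (assumption || apply: poly_const || apply: poly_add || apply: poly_mul).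
Qed.

Lemma cost_poly p : poly_bounded (cost p).
Proof.
by elim: p => /= *; repeat (apply: poly_const || apply: term_test_cost_poly.1 || apply: term_test_cost_poly.2 || assumption || apply: poly_add || apply: poly_mul).
Qed.

Theorem compile_correct p : wf [::] p -> exists c k, forall n (m : memory), m 0 0 = n ->
  exists t M, [/\ exec (compile p) m t M, t <= c * n ^ k + c &
    forall a i, a < vars -> M a i = run n (fun=> 0) p m a i].
Proof.
(* [(n + 1)^k <= 2^k * n^k] for positive [n]; the additive constant of the bound takes care of
   [n = 0]. *)
move=> wf_p; have [c [k cost_le]] := cost_poly p; exists (c * 2 ^ k), k => n m m0.
have [|t [M [ex t_le [agree _]]]] := compileP (bound := [::]) (env := fun=> 0) (M := m) wf_p m0.
  by split.
exists t, M; split=> //; apply: leq_trans t_le _; apply: leq_trans (cost_le n) _.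
case: n {m0 ex agree} => [|n].
  by rewrite exp1n muln1 (leq_trans _ (leq_addl _ _)) // leq_pmulr ?expn_gt0.
rewrite -mulnA -expnMn; apply: leq_trans (leq_addr _ _); rewrite leq_mul2l; apply/orP; right.
by case: {cost_le} k => // k; rewrite leq_exp2r //; lia.
Qed.

(** * The program *)

Notation active := 4 (only parsing).
Notation unmatched := 5 (only parsing).
Notation weight := 6 (only parsing).
Notation cost_of := 7 (only parsing).
Notation dist := 8 (only parsing).
Notation edge := 9 (only parsing).
Notation cell := 10 (only parsing).
Notation level := 11 (only parsing).
Notation parent := 12 (only parsing).
Notation time := 13 (only parsing).
Notation rank := 14 (only parsing).
Notation color := 15 (only parsing).

Infix ";;" := Then (at level 60, right associativity).

(** Matrices are stored row by row. The names 18 and 19 are kept for [Sum] and [Scale]; the loops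
    use smaller ones, so nothing is shadowed. *)
Definition entry a i j := Get a (Plus (Scale 19 i) j).
Definition set_entry a i j e := Assign a (Plus (Scale 19 i) j) e.
Definition flag e := Leq (Num 1) e.
Definition Less e1 e2 := Leq (Plus e1 (Num 1)) e2.
Definition number t := Sum 18 (Cond t (Num 1) (Num 0)).
(** There is no early exit: the last hit is kept, and any hit is good enough. *)
Definition search x t a e := Each x (When t (Assign a e (Var x))).

Notation "` x" := (Var x) (at level 1, format "` x").
Definition best := Get cell (Num 0).
Definition source := Get cell (Num 1).
Definition target := Get cell (Num 2).
Definition here := Get cell (Num 3).
Definition before := Get cell (Num 4).

Definition refill_prog :=
  When (Leq (Plus (number (flag (Get unmatched `18))) (number (flag (Get unmatched `18))))
            (number (flag (Get active `18))))
    (Each 1 (Assign unmatched `1 (Get active `1))).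

(** A product of two values is not a term, so the weight is added up once for each active vertex. *)
Definition price_prog :=
  Each 1 (Assign cost_of `1
    (Sum 18 (Plus (Cond (flag (Get active `18)) (Get weight `1) (Num 0)) (Get weight `18)))).

(** In [dist], 0 stands for infinity: all prices are positive. *)
Definition relax_prog :=
  When (And (flag (entry 1 `4 `2)) (And (flag (entry dist `1 `4))
       (Or (Eq (entry dist `1 `2) (Num 0))
           (Less (Plus (entry dist `1 `4) (Get cost_of `2)) (entry dist `1 `2)))))
    (set_entry dist `1 `2 (Plus (entry dist `1 `4) (Get cost_of `2))).

(** Bellman-Ford from all sources; [n] rounds suffice because shortening a path to a simple one does
    not raise its cost. Prices sit on vertices, and both ends of a path are charged. *)
Definition distance_prog :=
  Each 1 (Each 2 (set_entry dist `1 `2 (Cond (Eq `1 `2) (Get cost_of `1) (Num 0)))) ;;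
  Each 3 (Each 1 (Each 2 (Each 4 relax_prog))).

Definition pair_prog :=
  Assign cell (Num 0) (Num 0) ;;
  Each 1 (Each 2 (When
    (And (And (flag (Get unmatched `1)) (flag (Get unmatched `2)))
    (And (Neg (Eq `1 `2)) (And (flag (entry dist `1 `2))
         (Or (Eq best (Num 0)) (Less (entry dist `1 `2) best)))))
    (Assign cell (Num 0) (entry dist `1 `2) ;;
     Assign cell (Num 1) `1 ;; Assign cell (Num 2) `2))).

Definition double e := Assign weight e (Plus (Get weight e) (Get weight e)).

(** The path is followed backwards from [target]. Once [source] is reached the remaining iterations
    do nothing, and the weight of [source], which is never stepped over, is doubled at the end. *)
Definition trace_prog :=
  Assign cell (Num 3) target ;;
  Each 1 (When (Neg (Eq here source))
    (search 2 (And (flag (entry 1 `2 here)) (And (flag (entry dist source `2))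
       (Leq (Plus (entry dist source `2) (Get cost_of here)) (entry dist source here))))
       cell (Num 4) ;;
     set_entry edge here before (Num 1) ;; set_entry edge before here (Num 1) ;;
     double here ;; Assign cell (Num 3) before)) ;;
  double source.

Definition merge_prog :=
  When (Leq (Num 2) (number (flag (Get active `18))))
    (refill_prog ;; price_prog ;; distance_prog ;; pair_prog ;; trace_prog ;;
     Assign active target (Num 0) ;;
     Assign unmatched source (Num 0) ;; Assign unmatched target (Num 0)).

(** Each merge deactivates one vertex, so [n] steps leave a single one; the guard of [merge_prog]
    disables the surplus steps. *)
Definition build_prog :=
  Each 0 (Assign active `0 (Num 1) ;; Assign unmatched `0 (Num 1) ;; Assign weight `0 (Num 1)) ;;
  Each 0 merge_prog.

(** The root is vertex 0. Levels are shifted by one, 0 meaning not reached. Round [i] looks for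
    level [i + 1] and assigns level [i + 2], so nothing is propagated twice in a round. *)
Definition bfs_prog :=
  Assign level (Num 0) (Num 1) ;;
  Each 0 (Each 1 (When
    (And (Eq (Get level `1) (Num 0))
         (Ex 2 (And (flag (entry edge `2 `1)) (Eq (Get level `2) (Plus `0 (Num 1))))))
    (Assign level `1 (Plus `0 (Num 2))))) ;;
  Each 1 (search 2 (And (flag (entry edge `2 `1)) (Eq (Plus (Get level `2) (Num 1)) (Get level `1)))
    parent `1).

(** [time] holds the round number plus one, 0 meaning that no round is chosen yet; likewise for
    [rank] and [color]. *)
Definition time_body :=
  When
    (And (And (flag (Var 1)) (Eq (Get time (Var 1)) (Num 0)))
    (And (Neg (Ex 2 (And (And (flag (Var 2)) (Eq (Get parent (Var 2)) (Var 1)))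
                         (Or (Eq (Get time (Var 2)) (Num 0)) (Less (Var 0) (Get time (Var 2)))))))
         (Neg (Ex 2 (And (And (flag (Var 2)) (Eq (Get parent (Var 2)) (Get parent (Var 1))))
                         (Eq (Get time (Var 2)) (Plus (Var 0) (Num 1))))))))
    (Assign time (Var 1) (Plus (Var 0) (Num 1))).

Definition time_prog := Each 0 (Each 1 time_body).

Definition conflict i j :=
  And (And (Neg (Eq i j)) (And (Eq (Get time i) (Get time j)) (flag (Get time i))))
      (Or (flag (entry 1 j (Get parent i))) (flag (entry 1 i (Get parent j)))).

(** A degeneracy order: each round ranks one vertex, the first with fewer than [D] conflicts among
    the unranked ones. *)
Definition rank_body D :=
  When
    (And (Eq (Get rank (Var 1)) (Num 0))
    (And (Less (number (And (Eq (Get rank (Var 18)) (Num 0)) (conflict (Var 1) (Var 18)))) (Num D))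
         (Neg (Ex 2 (Eq (Get rank (Var 2)) (Plus (Var 0) (Num 1)))))))
    (Assign rank (Var 1) (Plus (Var 0) (Num 1))).

Definition rank_prog D := Each 0 (Each 1 (rank_body D)).

Definition color_body :=
  When
    (And (Eq (Get color (Var 1)) (Num 0))
         (Neg (Ex 3 (And (conflict (Var 1) (Var 3)) (And (Less (Get rank (Var 1)) (Get rank (Var 3)))
                         (Eq (Get color (Var 3)) (Plus (Var 2) (Num 1))))))))
    (Assign color (Var 1) (Plus (Var 2) (Num 1))).

(** Vertices are coloured in the order of decreasing rank, so that a vertex finds fewer than [D]
    conflicting vertices coloured before it. *)
Definition color_prog :=
  Each 0 (Each 1 (When (Eq (Plus (Get rank (Var 1)) (Var 0)) (Get 0 (Num 0))) (Each 2 color_body))).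

Definition emit_prog t :=
  Each 2 (set_entry 3 (Get 2 (Num 0)) `2 (Cond t (Num 1) (Num 0))) ;;
  Assign 2 (Num 0) (Plus (Get 2 (Num 0)) (Num 1)).

Definition gather_test c :=
  And (Eq (Get time c) (Plus `0 (Num 1))) (Eq (Get color c) (Plus `1 (Num 1))).

(** Times and colours are stored plus one, so comparing sums with [n] makes the two loops count down
    from [n - 1]. *)
Definition reverse_test c :=
  And (Eq (Plus (Get time c) `0) (Get 0 (Num 0))) (Eq (Plus (Get color c) `1) (Get 0 (Num 0))).

(** Empty rounds are skipped; otherwise there would be [2 * n ^ 2] of them. *)
Definition output_prog :=
  Each 0 (Each 1 (When (Ex 2 (gather_test `2)) (emit_prog (gather_test `2)))) ;;
  Each 0 (Each 1 (When (Ex 2 (reverse_test `2))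
    (emit_prog (Ex 3 (And (reverse_test `3) (Eq (Get parent `3) `2)))))).

Definition gossip_prog D :=
  build_prog ;; bfs_prog ;; time_prog ;; rank_prog D ;; color_prog ;; output_prog.

Lemma wf_gossip_prog D : wf [::] (gossip_prog D).
Proof. by []. Qed.

Fixpoint written (p : prog) : seq nat :=
  match p with
  | Assign a _ _ => [:: a]
  | Then p1 p2 => written p1 ++ written p2
  | When _ p1 | Each _ p1 => written p1
  end.

(** * Invariants of loops *)

Section Loops.
Variable n : nat.

Lemma run_when env t p m : run n env (When t p) m = if holds n m env t then run n env p m else m.
Proof. by []. Qed.

Lemma run_then env p q m : run n env (p ;; q) m = run n env q (run n env p m).
Proof. by []. Qed.

Lemma holds_and m env t1 t2 : holds n m env (And t1 t2) = holds n m env t1 && holds n m env t2.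
Proof. by []. Qed.

Lemma holds_ex m env x t : holds n m env (Ex x t) = [exists i : 'I_n, holds n m (upd env x i) t].
Proof. by []. Qed.

Lemma run_other env p m a i : a \notin written p -> run n env p m a i = m a i.
Proof.
elim: p env m => [b e1 e2|p1 IH1 p2 IH2|t p1 IH1|x p1 IH1] env m /=.
- by rewrite inE updE => /negPf->.
- by rewrite mem_cat negb_or => /andP[a1 a2]; rewrite IH2 ?IH1.
- by case: ifP => // _; exact: IH1.
move=> a1; apply: (foldl_enum_ind (P := fun _ m' => m' a i = m a i)) => // j m' <-.
exact: IH1.
Qed.

(** Read [le z' z] as: [z'] is at least as advanced as [z]. What iteration [i] achieves, [Q i],
    survives the later iterations. *)
Lemma foldl_enum_all (T : Type) (le : T -> T -> Prop) (Inv : T -> Prop) (Q : 'I_n -> T -> Prop) f z :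
  (forall z, le z z) -> (forall z1 z2 z3, le z1 z2 -> le z2 z3 -> le z1 z3) ->
  (forall i z z', Q i z -> le z' z -> Q i z') -> Inv z ->
  (forall i z, Inv z -> [/\ Inv (f z i), le (f z i) z & Q i (f z i)]) ->
  let z' := foldl f z (enum 'I_n) in [/\ Inv z', le z' z & forall i, Q i z'].
Proof.
move=> le_refl le_trans Q_le inv0 step z'.
suff [inv' le' Q'] : [/\ Inv z', le z' z & forall i : 'I_n, i < n -> Q i z'].
  by split=> // i; exact: Q'.
apply: (foldl_enum_ind (P := fun k z' => [/\ Inv z', le z' z & forall i : 'I_n, i < k -> Q i z'])) => // i z1.
case=> inv1 le1 Q1; have [inv2 le2 Q2] := step i z1 inv1; split=> //.
  exact: le_trans le1.
move=> j; rewrite ltnS leq_eqVlt => /predU1P[Ej|lt_j]; last exact: Q_le (Q1 j lt_j) le2.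
by rewrite (val_inj Ej).
Qed.

Definition same_but (a : nat) (m m' : memory) := forall b j, b != a -> m' b j = m b j.

Lemma run_same_but env p m a : written p = [:: a] -> same_but a m (run n env p m).
Proof. by move=> Ep b j ba; rewrite run_other // Ep inE. Qed.

Lemma run_fill env m a x e (F : 'I_n -> nat) :
  (forall (i : 'I_n) m', same_but a m m' -> (forall j, m' a j = m a j \/ j < i) -> value n m' (upd env x i) e = F i) ->
  let m' := run n env (Each x (Assign a (Var x) e)) m in
  same_but a m m' /\ forall i : 'I_n, m' a i = F i.
Proof.
move=> eF m'; split; first exact: run_same_but.
suff [_ [_ res]] : same_but a m m' /\ (forall j, m' a j = m a j \/ j < n) /\ (forall i : 'I_n, i < n -> m' a i = F i).
  by move=> i; exact: res.
apply: (foldl_enum_ind (P := fun k m' => same_but a m m' /\ (forall j, m' a j = m a j \/ j < k) /\ (forall i : 'I_n, i < k -> m' a i = F i))).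
  by split=> //; split=> // j; left.
move=> i m1 [same1 [old1 new1]]; split; [|split].
- by move=> b j ba; rewrite /= updE (negPf ba) same1.
- move=> j; rewrite /= updE eqxx /upd eqxx /=; case: eqP => [->|_]; first by right.
  by case: (old1 j) => [->|lt_j]; [left|right; exact: ltnW].
move=> j; rewrite ltnS leq_eqVlt /= updE eqxx {1}/upd eqxx /= (eF i m1 same1 old1).
rewrite val_eqE; have [->//|_ /=] := eqVneq j i.
exact: new1.
Qed.

Lemma idx_inj (u v u' v' : 'I_n) : n * u + v = n * u' + v' -> u = u' /\ v = v'.
Proof.
move=> E; have n_gt0 : 0 < n by apply: leq_ltn_trans (ltn_ord u).
have Eu : u = u' :> nat.
  have := congr1 (divn^~ n) E.
  by rewrite /= !(mulnC n) !divnMDl // !divn_small // !addn0.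
by split; apply: val_inj => //; move: E; rewrite Eu => /addnI.
Qed.

Lemma idx_eq (u v u' v' : 'I_n) : (n * u + v == n * u' + v') = (u == u') && (v == v').
Proof. by apply/eqP/andP => [/idx_inj[-> ->]|[/eqP-> /eqP->]]. Qed.

Lemma run_fill2 env m a x y e (F : 'I_n -> 'I_n -> nat) : x != y -> y != 19 -> x != 19 ->
  (forall (i j : 'I_n) m', same_but a m m' -> value n m' (upd (upd env x i) y j) e = F i j) ->
  let m' := run n env (Each x (Each y (set_entry a (Var x) (Var y) e))) m in
  same_but a m m' /\ forall i j : 'I_n, m' a (n * i + j) = F i j.
Proof.
move=> xy y19 x19 eF m'; split; first exact: run_same_but.
pose Inv m' := same_but a m m'.
pose le (m2 m1 : memory) := forall i j : 'I_n, m1 a (n * i + j) = F i j -> m2 a (n * i + j) = F i j.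
have [||i m1 m2|||_ _ res //] := @foldl_enum_all _ le Inv (fun i m' => forall j : 'I_n, m' a (n * i + j) = F i j)
  (fun m (i : 'I_n) => run n (upd env x i) (Each y (set_entry a (Var x) (Var y) e)) m) m.
- by move=> z i j.
- by move=> z1 z2 z3 le12 le23 i j /le23/le12.
- by move=> Q le12 j; exact: le12.
- by [].
move=> i m1 inv1; apply: (@foldl_enum_all _ le Inv (fun j m' => m' a (n * i + j) = F i j)) => //.
- by move=> z i' j.
- by move=> z1 z2 z3 le12 le23 i' j /le23/le12.
- by move=> j z z' Q le_z; exact: le_z.
move=> j m2 inv2 /=; rewrite eF //.
have Ei : upd (upd env x i) y j x = i by rewrite /upd eqxx (negPf xy).
have Ej : upd (upd env x i) y j y = j by rewrite /upd eqxx.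
rewrite Ei Ej; split.
- by move=> b k ba; rewrite updE (negPf ba) inv2.
- by move=> i' j' E; rewrite updE eqxx idx_eq /=; case: ifP => // /andP[/eqP-> /eqP->].
by rewrite updE !eqxx.
Qed.

Lemma run_search env (m : memory) (a c x : nat) t e (P : 'I_n -> bool) :
  let same (m' : memory) := forall b j, (b != a) || (j != c) -> m' b j = m b j in
  (forall (i : 'I_n) m', same m' -> holds n m' (upd env x i) t = P i) ->
  (forall (i : 'I_n) m', same m' -> value n m' (upd env x i) e = c) ->
  let m' := run n env (search x t a e) m in
  same m' /\ ((exists i, P i) -> exists2 i : 'I_n, m' a c = i & P i).
Proof.
move=> same tP ec m'.
pose found (i : 'I_n) (m' : memory) := P i -> exists2 i : 'I_n, m' a c = i & P i.
pose le (m2 m1 : memory) := (exists2 i : 'I_n, m1 a c = i & P i) -> exists2 i : 'I_n, m2 a c = i & P i.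
have [||i m1 m2|||same' _ res] := @foldl_enum_all _ le same found
  (fun m (i : 'I_n) => run n (upd env x i) (When t (Assign a e (Var x))) m) m.
- by move=> z.
- by move=> z1 z2 z3 le12 le23 /le23/le12.
- by move=> found1 le2 Pi; apply: le2; exact: found1.
- by [].
- move=> i m1 same1 /=; rewrite tP //; case: ifPn => [Pi|nPi].
    rewrite ec // /upd eqxx; split; last by exists i; rewrite // updE !eqxx.
      by move=> b j bj; rewrite updE -negb_and in bj *; rewrite (negPf bj) same1 // -negb_and.
    by move=> _; exists i; rewrite // updE !eqxx.
  by split=> // Pi; rewrite Pi in nPi.
by split=> // -[i Pi]; exact: res i Pi.
Qed.
End Loops.

Lemma leq_sum_uniq_sub (T : eqType) (s s' : seq T) (F : T -> nat) :
  uniq s -> {subset s <= s'} -> \sum_(z <- s) F z <= \sum_(z <- s') F z.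
Proof.
move=> uniq_s sub.
apply: (@sub_le_big_seq _ addn leq leqnn (fun a b => leq_addr b a)) => z.
by rewrite count_uniq_mem //; case: (boolP (z \in s)) => // /sub; rewrite -has_pred1 has_count.
Qed.

(** * Correctness of the program *)

Section MergeSpecs.
Variables (n : nat) (G : sgraph 'I_n).
Implicit Types (m : memory) (A U : {set 'I_n}) (w x : 'I_n -> nat) (E : rel 'I_n).

Definition state m A U w E : Prop :=
  [/\ forall v : 'I_n, m active v = (v \in A), forall v : 'I_n, m unmatched v = (v \in U),
      forall v : 'I_n, m weight v = w v, forall u v : 'I_n, m edge (n * u + v) = E u v
    & forall u v : 'I_n, m 1 (n * u + v) = adj G u v].

Lemma value_number m env t (B : {set 'I_n}) :
  (forall i : 'I_n, holds n m (upd env 18 i) t = (i \in B)) -> value n m env (number t) = #|B|.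
Proof.
move=> tB; rewrite /= -sum1_card [RHS]big_mkcond; apply: eq_bigr => i _.
by rewrite tB.
Qed.

Lemma refill_spec env m A U w E :
  state m A U w E -> state (run n env refill_prog m) A (refill A U) w E.
Proof.
case=> mA mU mw mE madj.
have numA env' : value n m env' (number (flag (Get active (Var 18)))) = #|A|.
  by apply: value_number => i; rewrite /= mA; case: (_ \in _).
have numU env' : value n m env' (number (flag (Get unmatched (Var 18)))) = #|U|.
  by apply: value_number => i; rewrite /= mU; case: (_ \in _).
rewrite /refill_prog /refill run_when.
have -> : holds n m env (Leq (Plus (number (flag (Get unmatched (Var 18)))) (number (flag (Get unmatched (Var 18)))))
    (number (flag (Get active (Var 18))))) = (#|U| + #|U| <= #|A|).
  by rewrite -(numA env) -(numU env).
case: ifP => _; last by split.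
have [|same filled] := @run_fill n env m unmatched 1 (Get active (Var 1)) (fun v => v \in A).
  by move=> i m' same' _; rewrite /= same' // mA.
by split=> [v|v|v|u v|u v]; rewrite ?filled // same.
Qed.

Lemma price_spec env m A U w E : state m A U w E ->
  let m' := run n env price_prog m in
  same_but cost_of m m' /\ forall v : 'I_n, m' cost_of v = price A w v.
Proof.
case=> mA mU mw mE madj; apply: run_fill => v m' same _ /=.
rewrite big_split /= /price; congr (_ + _); last by apply: eq_bigr => u _; rewrite same // mw.
rewrite -sum_nat_const [RHS]big_mkcond; apply: eq_bigr => u _.
by rewrite !same // mA mw; case: (u \in A).
Qed.

Section Distances.
Variables (m0 : memory) (x : 'I_n -> nat).
Hypothesis x_gt0 : forall v, 0 < x v.
Hypothesis m0_adj : forall u v : 'I_n, m0 1 (n * u + v) = adj G u v.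
Hypothesis m0_cost : forall v : 'I_n, m0 cost_of v = x v.

Let d m (u v : 'I_n) := m dist (n * u + v).

(** No entry is claimed to be the cost of a path. Upper bounds come from [relax_round]; for the
    trace it is enough that a neighbour justifies each finite entry, by an inequality because the
    entry of that neighbour may still improve. *)
Definition dist_inv m : Prop :=
  [/\ same_but dist m0 m, forall u, d m u u = x u
    & forall u v, u != v -> d m u v != 0 ->
        exists y, [/\ adj G y v, d m u y != 0 & d m u y + x v <= d m u v]].

Let closer m' m := forall u v, d m u v != 0 -> 0 < d m' u v <= d m u v.

Let closer_refl m : closer m m.
Proof. by move=> u v; rewrite -lt0n leqnn andbT. Qed.

Let closer_trans m1 m2 m3 : closer m1 m2 -> closer m2 m3 -> closer m1 m3.
Proof.
move=> c12 c23 u v /c23/andP[gt0 le23]; have := c12 u v.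
by rewrite -lt0n gt0 => /(_ isT)/andP[-> le12] /=; exact: leq_trans le23.
Qed.

Lemma relax_round env m : dist_inv m ->
  let m' := run n env (Each 1 (Each 2 (Each 4 relax_prog))) m in
  [/\ dist_inv m', closer m' m
    & forall u v y, adj G y v -> d m u y != 0 -> 0 < d m' u v <= d m u y + x v].
Proof.
move=> inv m'.
pose Inv m1 := dist_inv m1 /\ closer m1 m.
pose Q u v y m1 := adj G y v -> d m u y != 0 -> 0 < d m1 u v <= d m u y + x v.
have Q_le u v y m1 m2 : Q u v y m1 -> closer m2 m1 -> Q u v y m2.
  move=> Q1 c yv uy; have /andP[gt0 le1] := Q1 yv uy; have := c u v.
  by rewrite -lt0n gt0 => /(_ isT)/andP[-> le2]; exact: leq_trans le1.
suff [[inv' _] c' Q'] : [/\ Inv m', closer m' m & forall u v y, Q u v y m'] by split=> // u v y; exact: Q'.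
apply: (@foldl_enum_all n _ closer Inv (fun u m1 => forall v y, Q u v y m1)) => //.
  by move=> u m1 m2 Q1 c v y; exact: Q_le c.
move=> u m1 inv1; apply: (@foldl_enum_all n _ closer Inv (fun v m1 => forall y, Q u v y m1)) => //.
  by move=> v m2 m3 Q1 c y; exact: Q_le c.
move=> v {m1 inv1} m1 inv1; apply: (@foldl_enum_all n _ closer Inv (fun y m1 => Q u v y m1)) => //.
  by move=> y m2 m3 Q1 c; exact: Q_le c.
move=> y {m1 inv1} m1 [[same1 diag1 step1] c1] /=.
rewrite (same1 1) // (same1 cost_of) // m0_adj m0_cost lt0b -/(d m1 u v) -/(d m1 u y).
have [yv|nyv] /= := boolP (adj G y v); last first.
  by split=> //; rewrite /Q (negPf nyv).
have [uy|uy] /= := ltnP 0 (d m1 u y); last first.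
  split=> // _ uy'; have := c1 u y uy'; by rewrite ltnNge uy.
case: ifPn => [better|]; last first.
  rewrite negb_or -lt0n addn1 -leqNgt => /andP[uv_gt0 uv_le]; split=> // _ uy'.
  rewrite uv_gt0 (leq_trans uv_le) // leq_add2r.
  by have /andP[] := c1 u y uy'.
set m2 := update _ _ _ _.
have d2 u' v' : d m2 u' v' = if (u' == u) && (v' == v) then d m1 u y + x v else d m1 u' v'.
  by rewrite /d /m2 updE eqxx idx_eq.
have c2 : closer m2 m1.
  move=> u' v' d1; rewrite d2; case: ifP => [/andP[/eqP Eu /eqP Ev]|_]; last by rewrite lt0n d1 leqnn.
  rewrite addn_gt0 uy /=; move: better d1; rewrite Eu Ev => /orP[/eqP->|]; first by rewrite eqxx.
  by rewrite addn1 => /ltnW.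
have y_ne : y != v by apply: contraTneq yv => ->; rewrite adj_irr.
have uv : u != v.
  apply/eqP => Euv; move: better; rewrite -Euv diag1 => /orP[/eqP x0|].
    by have := x_gt0 u; rewrite x0.
  by rewrite Euv addn1 leqNgt ltnS leq_addl.
split; first split=> //.
- split.
  + by move=> b j bd; rewrite /m2 updE (negPf bd) same1.
  + move=> u'; rewrite d2; case: ifP => // /andP[/eqP Eu /eqP Ev].
    by rewrite -Eu Ev eqxx in uv.
  move=> u' v' u'v'; rewrite d2; case: ifP => [/andP[/eqP-> /eqP->] _|_ d1].
    exists y; rewrite yv d2 (negPf y_ne) andbF -lt0n uy; split=> //.
  have [z [zv' uz le_z]] := step1 u' v' u'v' d1.
  have := c2 u' z uz => /andP[gt0 le2].
  by exists z; rewrite zv' -lt0n gt0; split=> //; rewrite (leq_trans _ le_z) // leq_add2r.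
- exact: closer_trans c1.
- exact: c2.
move=> _ uy'; rewrite d2 !eqxx /= addn_gt0 uy leq_add2r.
by have /andP[] := c1 u y uy'.
Qed.

Lemma distance_spec env :
  let m := run n env distance_prog m0 in
  dist_inv m /\ forall u p, path (adj G) u p -> 0 < d m u (last u p) <= \sum_(z <- u :: p) x z.
Proof.
pose init := Each 1 (Each 2 (set_entry dist (Var 1) (Var 2) (Cond (Eq (Var 1) (Var 2)) (Get cost_of (Var 1)) (Num 0)))).
rewrite /distance_prog -/init run_then; set m1 := run n env init m0.
have [|same1 d1] := @run_fill2 n env m0 dist 1 2 (Cond (Eq (Var 1) (Var 2)) (Get cost_of (Var 1)) (Num 0))
  (fun u v => if u == v then x u else 0) isT isT isT.
  by move=> u v m' same' /=; rewrite same' // m0_cost.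
have {}d1 u v : d m1 u v = if u == v then x u else 0 by exact: d1.
have inv1 : dist_inv m1.
  split=> // [u|u v uv]; rewrite d1 ?eqxx //.
  by rewrite (negPf uv) eqxx.
set m := run _ _ _ m1.
suff [inv short] : dist_inv m /\ (forall u p, size p <= n -> path (adj G) u p ->
    0 < d m u (last u p) <= \sum_(z <- u :: p) x z).
  split=> // u p path_p; case/shortenP: path_p => p' path_p' uniq_p' sub.
  have size_p' : size p' <= n.
    by have := max_card (mem (u :: p')); rewrite (card_uniqP uniq_p') card_ord => /ltnW.
  have /andP[-> le_p'] := short u p' size_p' path_p'; apply: leq_trans le_p' _.
  apply: leq_sum_uniq_sub => // z; rewrite !inE => /orP[->//|/sub->].
  by rewrite orbT.
apply: (foldl_enum_ind (P := fun k m => dist_inv m /\ (forall u p, size p <= k -> path (adj G) u p ->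
    0 < d m u (last u p) <= \sum_(z <- u :: p) x z))).
  split=> // u [|//] _ _; by rewrite /= d1 eqxx big_seq1 x_gt0 leqnn.
move=> k m2 [inv2 short2]; have [inv3 c3 relaxed] := relax_round (upd env 3 k) inv2.
split=> // u p; case/lastP: p => [|p v].
  by move=> _ _; case: inv3 => _ diag _; rewrite /= diag big_seq1 x_gt0 leqnn.
rewrite size_rcons ltnS rcons_path last_rcons => size_p /andP[path_p yv].
have /andP[gt0 le2] := short2 u p size_p path_p.
have := relaxed u v _ yv; rewrite -lt0n gt0 => /(_ isT)/andP[-> le3]; apply: leq_trans le3 _.
by rewrite -rcons_cons -cats1 big_cat big_seq1 leq_add2r.
Qed.
End Distances.

Lemma pair_spec env m U :
  (forall v : 'I_n, m unmatched v = (v \in U)) ->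
  let d u v := m dist (n * u + v) in
  (exists u v : 'I_n, [/\ u \in U, v \in U, u != v & 0 < d u v]) ->
  let m' := run n env pair_prog m in
  exists u v : 'I_n, [/\ m' cell 1 = u, m' cell 2 = v & [/\ u \in U, v \in U, u != v & 0 < d u v]] /\
    forall i j : 'I_n, i \in U -> j \in U -> i != j -> 0 < d i j -> d u v <= d i j.
Proof.
move=> mU d [i0 [j0 [i0U j0U ij0 d0]]]; rewrite /pair_prog run_then.
set m1 := run n env (Assign _ _ _) m; set m' := run _ _ _ m1.
pose Inv m2 := same_but cell m m2 /\ (m2 cell 0 != 0 -> exists u v : 'I_n, [/\ m2 cell 1 = u, m2 cell 2 = v, m2 cell 0 = d u v
  & [/\ u \in U, v \in U, u != v & 0 < d u v]]).
pose better (m3 m2 : memory) := m2 cell 0 != 0 -> 0 < m3 cell 0 <= m2 cell 0.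
pose Q i j (m2 : memory) := i \in U -> j \in U -> i != j -> 0 < d i j -> 0 < m2 cell 0 <= d i j.
have better_refl m2 : better m2 m2 by rewrite /better -lt0n leqnn andbT.
have better_trans m2 m3 m4 : better m2 m3 -> better m3 m4 -> better m2 m4.
  move=> b23 b34 /b34/andP[gt0 le34]; move: b23; rewrite /better -lt0n gt0.
  by move=> /(_ isT)/andP[-> le23]; exact: leq_trans le34.
have Q_le i j m2 m3 : Q i j m2 -> better m3 m2 -> Q i j m3.
  move=> Q2 b iU jU ij dij; have /andP[gt0 le2] := Q2 iU jU ij dij; move: b; rewrite /better -lt0n gt0.
  by move=> /(_ isT)/andP[-> le3]; exact: leq_trans le2.
suff [[same' found'] _ Q'] : [/\ Inv m', better m' m1 & forall i j, Q i j m'].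
  have /andP[gt0 _] := Q' _ _ i0U j0U ij0 d0; rewrite lt0n in gt0.
  have [u [v [Eu Ev Ed uv]]] := found' gt0; exists u, v; split=> // i j iU jU ij dij.
  by have /andP[_] := Q' _ _ iU jU ij dij; rewrite Ed.
apply: (@foldl_enum_all n _ better Inv (fun i m2 => forall j, Q i j m2)) => //.
- by move=> i m2 m3 Q2 b j; exact: Q_le b.
- split=> [b j bc|]; first by rewrite /m1 /= updE (negPf bc).
  by rewrite /m1 /= updE eqxx.
move=> i m2 inv2; apply: (@foldl_enum_all n _ better Inv (fun j m2 => Q i j m2)) => //.
  by move=> j m3 m4 Q3 b; exact: Q_le b.
move=> j {m2 inv2} m2 [same2 found2] /=.
rewrite (same2 unmatched) // (same2 unmatched) // (same2 dist) // -/(d i j) !mU !lt0b.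
have [iU|niU] /= := boolP (i \in U); last by split=> //; rewrite /Q (negPf niU).
have [jU|njU] /= := boolP (j \in U); last by split=> //; rewrite /Q (negPf njU) => _.
rewrite (inj_eq val_inj); have [ij|ij] /= := eqVneq i j; first by split=> //; rewrite /Q ij eqxx.
have [dij|dij] /= := ltnP 0 (d i j); last by split=> // _ _ _; rewrite ltnNge dij.
case: ifPn => [closer|]; last first.
  by rewrite negb_or -lt0n addn1 -leqNgt => /andP[gt0 le2]; split=> // _ _ _ _; rewrite gt0.
split.
- split=> [b k bc|_]; first by rewrite !updE (negPf bc) same2.
  by exists i, j; rewrite !updE /=.
- rewrite /better !updE /= dij /= => m20; move: closer; rewrite (negPf m20) addn1 /=; exact: ltnW.
by move=> _ _ _ _; rewrite !updE /= dij leqnn.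
Qed.
End MergeSpecs.

Section TraceSpec.
Variables (n : nat) (G : sgraph 'I_n).

Lemma trace_spec env (m : memory) (u v : 'I_n) (x w : 'I_n -> nat) (E : rel 'I_n) :
  m cell 1 = u -> m cell 2 = v -> (forall z, 0 < x z) ->
  (forall z : 'I_n, m cost_of z = x z) -> (forall a b : 'I_n, m 1 (n * a + b) = adj G a b) ->
  (forall z : 'I_n, m weight z = w z) -> (forall a b : 'I_n, m edge (n * a + b) = E a b) ->
  let d (z : 'I_n) := m dist (n * u + z) in
  0 < d v -> d u = x u ->
  (forall z, z != u -> d z != 0 -> exists y, [/\ adj G y z, d y != 0 & d y + x z <= d z]) ->
  let m' := run n env trace_prog m in
  exists p, [/\ path (adj G) u p, last u p = v & uniq (u :: p)] /\
    [/\ \sum_(z <- u :: p) x z <= d v,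
        forall z : 'I_n, m' weight z = if z \in u :: p then w z + w z else w z,
        forall a b : 'I_n, m' edge (n * a + b) = [|| E a b, consec (u :: p) a b | consec (u :: p) b a],
        forall b j, b \notin [:: weight; edge; cell] -> m' b j = m b j
      & m' cell 1 = u /\ m' cell 2 = v].
Proof.
move=> mu mv x_gt0 mx madj mw mE d dv du d_step; rewrite /trace_prog !run_then.
set m0 := run n env _ m.
(* [c :: s] is the part of the path traced so far. Distances decrease strictly towards [u], which
   makes the path simple; the weight of [c] is not doubled yet. Each iteration prepends a vertex
   until [u] is reached. *)
pose Inv (k : nat) (m1 : memory) := exists (c : 'I_n) (s : seq 'I_n),
  [/\ m1 cell 3 = c, m1 cell 1 = u, m1 cell 2 = v & forall b j, b \notin [:: weight; edge; cell] -> m1 b j = m b j] /\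
  [/\ path (adj G) c s, last c s = v, 0 < d c, uniq (c :: s) & {in s, forall z, d c < d z}] /\
  [/\ d c + \sum_(z <- s) x z <= d v,
      forall z : 'I_n, m1 weight z = if z \in s then w z + w z else w z,
      forall a b : 'I_n, m1 edge (n * a + b) = [|| E a b, consec (c :: s) a b | consec (c :: s) b a]
    & c = u \/ size s = k].
have inv0 : Inv 0 m0.
  exists v, [::]; split; [split|split; [by split|split]] => //.
  - by move=> b j; rewrite /m0 /= ?updE !inE !negb_or => /and3P[_ _ /negPf->].
  - by rewrite big_nil addn0.
  - by move=> a b; rewrite /m0 /= ?updE /= mE orbF.
  by right.
have step (k : 'I_n) m1 : Inv k m1 -> Inv k.+1 (run n (upd env 1 k) (When (Neg (Eq here source))
    (search 2 (And (flag (entry 1 (Var 2) here)) (And (flag (entry dist source (Var 2)))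
       (Leq (Plus (entry dist source (Var 2)) (Get cost_of here)) (entry dist source here))))
       cell (Num 4) ;;
     set_entry edge here before (Num 1) ;; set_entry edge before here (Num 1) ;;
     double here ;; Assign cell (Num 3) before)) m1).
  move=> [c [s [[m1c m1u m1v m1_same] [[path_s last_s dc uniq_s lt_s] [sum_s m1w m1E progress]]]]].
  rewrite run_when.
  have -> : holds n m1 (upd env 1 k) (Neg (Eq here source)) = (c != u) by rewrite /= m1c m1u.
  case: eqVneq => [Ec|cu].
    by exists c, s; split=> //; split=> //; split=> //; left.
  rewrite [~~ false]/= run_then.
  have [i m3 same3|i m3 same3|] := @run_search n (upd env 1 k) m1 cell 4 2
    (And (flag (entry 1 (Var 2) here)) (And (flag (entry dist source (Var 2)))
       (Leq (Plus (entry dist source (Var 2)) (Get cost_of here)) (entry dist source here)))) (Num 4)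
    (fun y => [&& adj G y c, 0 < d y & d y + x c <= d c]).
  - rewrite /= !(same3 cell) // m1c m1u !same3 // !m1_same // madj mx lt0b.
    by [].
  - by [].
  set m2 := run _ _ _ m1 => same2 found.
  have [y my /and3P[yc dy le_y]] : exists2 y : 'I_n, m2 cell 4 = y & [&& adj G y c, 0 < d y & d y + x c <= d c].
    by apply: found; have [|y [yc dy le_y]] := d_step c cu; [rewrite -lt0n|exists y; rewrite yc lt0n dy].
  have m2c : m2 cell 3 = c by rewrite same2.
  have lt_yc : d y < d c by apply: leq_trans le_y; rewrite -addn1 leq_add2l x_gt0.
  set m3 := run _ _ _ m2.
  have m3E b j : m3 b j = if (b == cell) && (j == 3) then y : nat else
     if (b == weight) && (j == c) then m2 weight c + m2 weight c else
     if (b == edge) && ((j == n * y + c) || (j == n * c + y)) then 1 else m2 b j.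
    rewrite /m3 /= !updE /= m2c my.
    case: (b =P cell) => [->//|_] /=; case: (b =P weight) => [->//|_] /=.
    by case: (b =P edge) => [->|_] //=; case: (j == _).
  have y_s : y \notin c :: s.
    rewrite inE negb_or; apply/andP; split; first by apply: contraTneq lt_yc => ->; rewrite ltnn.
    by apply: contraTN lt_yc => /lt_s; rewrite -leqNgt => /ltnW.
  exists y, (c :: s); split; [split|split; [split|split]].
  - by rewrite m3E.
  - by rewrite m3E /= same2.
  - by rewrite m3E /= same2.
  - move=> b j; rewrite m3E => bN; have := bN; rewrite !inE !negb_or => /and3P[/negPf-> /negPf-> bc].
    by rewrite (negPf bc) /= same2 ?bc // m1_same.
  - by rewrite /= yc.
  - by [].
  - by [].
  - by rewrite /= y_s.
  - by move=> z; rewrite inE => /predU1P[->//|/lt_s]; exact: ltn_trans.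
  - by rewrite big_cons addnA; apply: leq_trans sum_s; rewrite leq_add2r.
  - move=> z; rewrite m3E /= inE val_eqE !same2 // !m1w.
    by case: eqVneq => [->|_] //=; case/andP: uniq_s => /negPf->.
  - move=> a b; rewrite m3E /= same2 // !idx_eq m1E !(consec_cons2 y c).
    rewrite [(b == y) && _]andbC.
    by case: (_ && _); case: (_ && _); case: (E a b); rewrite ?orbT //.
  by right; case: progress => [Ec|<-//]; rewrite Ec eqxx in cu.
have [c [s [[m1c m1u m1v m1_same] [[path_s last_s dc uniq_s lt_s] [sum_s m1w m1E progress]]]]] :
    Inv n (run n env (Each 1 (When (Neg (Eq here source))
    (search 2 (And (flag (entry 1 (Var 2) here)) (And (flag (entry dist source (Var 2)))
       (Leq (Plus (entry dist source (Var 2)) (Get cost_of here)) (entry dist source here))))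
       cell (Num 4) ;;
     set_entry edge here before (Num 1) ;; set_entry edge before here (Num 1) ;;
     double here ;; Assign cell (Num 3) before))) m0).
  by apply: foldl_enum_ind => // k m1; exact: step.
set m1 := run n env _ m0 in m1c m1u m1v m1_same m1w m1E *.
(* Otherwise the path would have [n] edges and thus [n + 1] different vertices. *)
have {progress}Ec : c = u.
  case: progress => // size_s; have := max_card (mem (c :: s)).
  by rewrite (card_uniqP uniq_s) card_ord /= size_s ltnn.
subst c; exists s; split; [split|split] => //.
- by rewrite big_cons -du.
- move=> z; rewrite /= updE /= m1u inE val_eqE; case: eqVneq => [->|_] //=.
  by rewrite m1w; case/andP: uniq_s => /negPf->.
- by move=> b j bN; rewrite /= updE; case: eqP => [Eb|_]; [rewrite Eb in bN|exact: m1_same].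
Qed.
End TraceSpec.

(** In the gather tree rooted at [v], the parents lead from [u] to [v]. *)
Lemma gossip_connected (V : finType) (G : sgraph V) s u v : gossip_schedule G s -> connect (adj G) u v.
Proof.
move=> gossip; have [m|d [par [_ d_par _]]] := @gather_tree_of_schedule V G [set v] s.
  by exists v; rewrite ?set11 // gossip inE.
have [k] := ubnP (d u); elim: k u => // k IHk u; rewrite ltnS => le_k.
have [->|uv] := eqVneq u v; first exact: connect0.
have [|adj_u lt_d _] := d_par u; first by rewrite inE.
by apply: connect_trans (connect1 adj_u) (IHk _ _); exact: leq_trans le_k.
Qed.

Section BuildSpec.
Variables (n : nat) (G : sgraph 'I_n).
Hypothesis connected : forall u v, connect (adj G) u v.

Lemma merge_spec env (m : memory) A U w E :
  state G m A U w E -> (forall z, 0 < w z) ->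
  if 1 < #|A| then exists A' U' w' E',
    merged G A U w E A' U' w' E' /\ state G (run n env merge_prog m) A' U' w' E'
  else run n env merge_prog m = m.
Proof.
move=> st w_gt0; rewrite /merge_prog run_when.
have -> : holds n m env (Leq (Num 2) (number (flag (Get active (Var 18))))) = (1 < #|A|).
  rewrite -(@value_number n m env (flag (Get active (Var 18))) A) // => i.
  by have [mA _ _ _ _] := st; rewrite /= mA; case: (_ \in _).
have [A_gt1|//] := ltnP 1 #|A|; rewrite run_then.
have st1 := refill_spec env st; set m1 := run n env refill_prog m in st1 *.
have [U1_gt1 _] := refill_large U A_gt1.
have [U1 EU1] : exists U1, U1 = refill A U by exists (refill A U).
rewrite -EU1 in st1 U1_gt1.
rewrite run_then; have [same2 price2] := price_spec env st1; set m2 := run n env _ m1 in same2 price2 *.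
have [mA mU mw mE madj] := st1.
have x_gt0 z : 0 < price A w z by rewrite addn_gt0 muln_gt0 w_gt0 (ltnW A_gt1).
have adj2 (u v : 'I_n) : m2 1 (n * u + v) = adj G u v by rewrite same2.
rewrite run_then; have [] := distance_spec x_gt0 adj2 price2 env; set m3 := run n env _ m2.
case=> same3 diag3 step3 short3.
have conn3 (u v : 'I_n) : 0 < m3 dist (n * u + v).
  by have /connectP[p path_p ->] := connected u v; have /andP[] := short3 u p path_p.
have mU3 (v : 'I_n) : m3 unmatched v = (v \in U1) by rewrite same3 // same2.
rewrite run_then; have [|u [v [[m4u m4v [uU vU uv d_uv]] best]]] := pair_spec env mU3.
  by case/card_gt1P: U1_gt1 => u [v [uU vU uv]]; exists u, v; split.
set m4 := run n env _ m3 in m4u m4v *.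
have same4 : same_but cell m3 m4 by move=> b j bc; rewrite /m4 run_other //= !inE (negPf bc).
rewrite run_then.
have [z|a b|z|a b|||z zu dz|p [[path_p last_p uniq_p] [cost_p m5w m5E m5same [m5u m5v]]]] :=
  @trace_spec n G env m4 u v (price A w) w E m4u m4v x_gt0.
- by rewrite same4 // same3 // price2.
- by rewrite same4 // same3 // adj2.
- by rewrite same4 // same3 // same2.
- by rewrite same4 // same3 // same2.
- by rewrite same4.
- by rewrite same4 // diag3.
- rewrite same4 // in dz; rewrite eq_sym in zu; have [y [yz dy le_y]] := step3 _ _ zu dz.
  by exists y; rewrite !same4.
set m5 := run n env _ m4 in m5w m5E m5same m5u m5v *.
exists (A :\ v), (U1 :\ u :\ v), (fun z => if z \in u :: p then w z + w z else w z),
  (fun a b => [|| E a b, consec (u :: p) a b | consec (u :: p) b a]); split.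
  exists u, v, p; rewrite -EU1; split=> //; split=> //; split=> // i j q iU jU ij path_q last_q.
  apply: leq_trans cost_p _; rewrite same4 //; apply: leq_trans (best i j iU jU ij (conn3 i j)) _.
  by rewrite -last_q; have /andP[] := short3 i q path_q.
split=> [z|z|z|a b|a b].
- rewrite /= !updE /= m5v val_eqE !inE; case: eqVneq => //= _.
  by rewrite m5same // same4 // same3 // same2.
- rewrite /= !updE /= m5u m5v !val_eqE !inE; case: eqVneq => //= _; case: eqVneq => //= _.
  by rewrite m5same // same4 // mU3.
- by rewrite /= !updE /= m5w.
- by rewrite /= !updE /= m5E.
by rewrite /= !updE /= m5same // same4 // same3 // adj2.
Qed.

Variable sched : seq {set 'I_n}.
Hypothesis gossip : gossip_schedule G sched.
Hypothesis sched_gt0 : 0 < size sched.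

Lemma build_spec env (m : memory) :
  (forall u v : 'I_n, m 1 (n * u + v) = adj G u v) -> (forall j, m edge j = 0) -> 1 < n ->
  let m' := run n env build_prog m in let l := trunc_log 2 n in
  exists E : rel 'I_n, [/\ forall u v : 'I_n, m' edge (n * u + v) = E u v,
    forall u v, E u v -> adj G u v, symmetric E,
    forall z, #|[set y | E z y]| <= 64 * (size sched * l)
  & forall x y, exists q, [/\ path E x q, last x q = y & size q <= 120 * (size sched * l)]].
Proof.
move=> madj mE n_gt1 m' l; rewrite {}/m' /build_prog run_then.
set m1 := run n env _ m; set m' := run n env _ m1.
have st1 : state G m1 setT setT (fun=> 1) (fun _ _ => false).
  pose Q (i : 'I_n) (m2 : memory) := [/\ m2 active i = 1, m2 unmatched i = 1 & m2 weight i = 1].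
  have [||i m2 m3 Q2 le23|//|i m2 _|_ _ Q1] := @foldl_enum_all n _ (fun m3 m2 => forall i, Q i m2 -> Q i m3)
    (fun=> True) Q (fun m' (i : 'I_n) => run n (upd env 0 i) (Assign active (Var 0) (Num 1) ;;
      Assign unmatched (Var 0) (Num 1) ;; Assign weight (Var 0) (Num 1)) m') m.
  - by [].
  - by move=> m2 m3 m4 le23 le34 i /le34/le23.
  - exact: le23.
  - split=> // [j [Qa Qu Qw]|]; rewrite /Q /= !updE /= ?eqxx // Qa Qu Qw.
    by case: eqP.
  split=> [i|i|i|u v|u v]; try by rewrite ?inE; case: (Q1 i).
  - by rewrite /m1 run_other.
  by rewrite /m1 run_other.
pose Inv (k : nat) (m2 : memory) := exists (A U : {set 'I_n}) (w : 'I_n -> nat) (E : rel 'I_n) (R a : nat), [/\ state G m2 A U w E, merge_inv G sched A U w E R a & #|A| <= maxn 1 (n - k)].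
have [A [U [w [E [R [a [st inv]]]]]]] : Inv n m'.
  apply: (@foldl_enum_ind n _ Inv (fun m2 (i : 'I_n) => run n (upd env 0 i) merge_prog m2)) => [|k m2 [A [U [w [E [R [a [st inv A_le]]]]]]]].
    exists setT, setT, (fun=> 1), (fun _ _ => false), 0, n; rewrite subn0 cardsT card_ord leq_maxr; split=> //.
    by have := @merge_inv_init _ G sched; rewrite card_ord; apply; exact: ltnW.
  have [[_ _ w_gt0 _ _] _] := inv.
  have := merge_spec (upd env 0 k) st w_gt0; case: ifP => [A_gt1|A_le1].
    case=> A' [U' [w' [E' [step st']]]].
    have [cardA [R' [a' inv']]] := merged_inv gossip sched_gt0 inv A_gt1 step.
    exists A', U', w', E', R', a'; split=> //.
    by move: A_le; rewrite cardA; clear; lia.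
  move=> ->; exists A, U, w, E, R, a; split=> //.
  by rewrite leq_max leqNgt A_le1.
rewrite subnn maxn0 => A_le1.
have l_gt0 : 0 < trunc_log 2 #|'I_n| by rewrite card_ord trunc_log_gt0.
have := merge_inv_single sched_gt0 l_gt0 inv A_le1.
rewrite card_ord -/l => -[deg_le near]; have [_ _ _ mE' _] := st.
by have [[_ _ _ E_sym E_adj] _] := inv; exists E; split.
Qed.
End BuildSpec.

(** * The breadth-first tree *)

Section BfsSpec.
Variables (n : nat) (r : 'I_n).
Hypothesis r0 : r = 0 :> nat.

Lemma bfs_spec env (m : memory) (E : rel 'I_n) (B : nat) :
  (forall u v : 'I_n, m edge (n * u + v) = E u v) -> (forall j, m level j = 0) ->
  (forall v, exists q, [/\ path E r q, last r q = v & size q <= B]) ->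
  exists (lev : 'I_n -> nat) (par : 'I_n -> 'I_n),
    [/\ forall v : 'I_n, v != r -> run n env bfs_prog m parent v = par v,
        forall v : 'I_n, v != r -> E (par v) v, forall v : 'I_n, v != r -> lev (par v) < lev v
      & forall v : 'I_n, lev v <= B].
Proof.
move=> mE m0 near; rewrite /bfs_prog 2!run_then.
set m1 := run n env _ m; set m2 := run n env _ m1; set m3 := run n env _ m2.
(* The last clause bounds the depth: along a path from [r] the level rises by at most one per edge,
   as long as it does not exceed the number of rounds. *)
pose Inv (k : nat) (m' : memory) := [/\ same_but level m m', m' level r = 1,
  forall v : 'I_n, m' level v <= k.+1,
  forall v : 'I_n, v != r -> m' level v != 0 -> exists u : 'I_n, [/\ E u v, m' level u != 0 & (m' level u).+1 = m' level v]
  & forall u v : 'I_n, E u v -> 0 < m' level u <= k -> 0 < m' level v <= (m' level u).+1].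
have [same2 lev_r _ step2 short2] : Inv n m2.
  apply: (@foldl_enum_ind n _ Inv (fun m' (k : 'I_n) => run n (upd env 0 k) (Each 1 (When
    (And (Eq (Get level (Var 1)) (Num 0))
         (Ex 2 (And (flag (entry edge (Var 2) (Var 1))) (Eq (Get level (Var 2)) (Plus (Var 0) (Num 1))))))
    (Assign level (Var 1) (Plus (Var 0) (Num 2))))) m')) => [|k ms [same lev_r le_k step short]].
    have m1E j : m1 level j = (j == 0) by rewrite /m1 /= updE /= m0; case: (j == 0).
    split.
    - by move=> b j bl; rewrite /m1 /= updE (negPf bl).
    - by rewrite m1E r0.
    - by move=> v; rewrite m1E; case: (_ == _).
    - by move=> v vr; rewrite m1E (_ : (v == 0 :> nat) = false) // -r0; exact/negbTE.
    by move=> u v _; rewrite m1E; case: (_ == _).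
  pose IInv (m' : memory) := [/\ same_but level ms m',
    forall v : 'I_n, m' level v = if ms level v != 0 then ms level v else m' level v,
    forall v : 'I_n, ms level v = 0 -> m' level v = 0 \/ m' level v = k.+2
    & forall v : 'I_n, ms level v = 0 -> m' level v != 0 -> exists2 u : 'I_n, E u v & ms level u = k.+1].
  pose le (m'' m' : memory) := forall v : 'I_n, m' level v != 0 -> m'' level v = m' level v.
  pose Q (v : 'I_n) (m' : memory) := (exists2 u : 'I_n, E u v & ms level u = k.+1) -> m' level v != 0.
  set m' := run n _ _ ms.
  have [[isame old new newE] _ isQ] : [/\ IInv m', le m' ms & forall v, Q v m'].
    apply: (@foldl_enum_all n _ le IInv Q (fun m' (i : 'I_n) => run n (upd (upd env 0 k) 1 i) (When
    (And (Eq (Get level (Var 1)) (Num 0))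
         (Ex 2 (And (flag (entry edge (Var 2) (Var 1))) (Eq (Get level (Var 2)) (Plus (Var 0) (Num 1))))))
    (Assign level (Var 1) (Plus (Var 0) (Num 2)))) m') ms).
    - by [].
    - by move=> a b c ab bc v cv; rewrite ab ?bc.
    - by move=> v a b Qa ab Ev; rewrite ab Qa.
    - split=> // v; last by move=> ->.
        by case: ifP.
      by left.
    - move=> v m4 [isame old new newE] /=.
      case: ifPn => [/andP[/eqP lev0 /existsP[u]]|none]; last first.
        split=> // -[u Euv lev_u]; apply: contra none => ->; apply/existsP; exists u.
        by rewrite isame // same // mE Euv /= old lev_u addn1.
      rewrite isame // same // mE lt0b addn1 => /andP[Euv /eqP lev_u].
      have ms_v : ms level v = 0 by move: (old v); rewrite lev0; case: eqP.
      have ms_u : ms level u = k.+1.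
        move: (old u); rewrite lev_u; case: eqVneq => [ms_u _|_ ->//].
        by case: (new u ms_u); rewrite lev_u // => /eqP; rewrite eqSS ltn_eqF.
      split.
      + split.
        * by move=> b j bl; rewrite updE (negPf bl) isame.
        * by move=> v'; rewrite updE /= val_eqE; case: (eqVneq v' v) => [->|_]; [rewrite ms_v|exact: old].
        * by move=> v' v'0; rewrite updE /= val_eqE; case: (eqVneq v' v) => [_|_]; [right; rewrite /= addn2|exact: new].
        by move=> v' v'0; rewrite updE /= val_eqE; case: (eqVneq v' v) => [-> _|_]; [exists u|exact: newE].
      + by move=> v' lev'; rewrite updE /= val_eqE; case: (eqVneq v' v) => // Ev; rewrite Ev lev0 in lev'.
      by move=> _; rewrite updE /= eqxx /= addn2.
  have keep (v : 'I_n) : ms level v != 0 -> m' level v = ms level v by move=> nz; rewrite old nz.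
  split.
  - by move=> b j bl; rewrite isame // same.
  - by rewrite keep lev_r.
  - move=> v; have [ms_v|ms_v] := eqVneq (ms level v) 0; last by rewrite keep // leqW.
    by case: (new v ms_v) => ->.
  - move=> v vr lev_v; have [ms_v|ms_v] := eqVneq (ms level v) 0.
      have [u Euv lev_u] := newE v ms_v lev_v; exists u; rewrite keep lev_u //; split=> //.
      by case: (new v ms_v) lev_v => ->.
    have [u [Euv lev_u E_lev]] := step v vr ms_v.
    by exists u; rewrite !keep.
  move=> u v Euv; have [ms_u|ms_u] := eqVneq (ms level u) 0.
    by case: (new u ms_u) => -> //; rewrite ltnn.
  rewrite keep //; case/andP=> lev_u; rewrite leq_eqVlt ltnS => /predU1P[lev_k|le_u].
    have lev_v : m' level v != 0 by apply: isQ; exists u.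
    rewrite lt0n lev_v lev_k; have [ms_v|ms_v] := eqVneq (ms level v) 0.
      by case: (new v ms_v) => -> /=.
    by rewrite keep //= leqW.
  have := short u v Euv; rewrite lev_u le_u => /(_ isT)/andP[lev_v le_v].
  by rewrite keep -?lt0n // lev_v.
have reach q : path E r q -> size q <= n -> 0 < m2 level (last r q) <= (size q).+1.
  elim/last_ind: q => [|q v IHq]; first by rewrite /= lev_r.
  rewrite rcons_path last_rcons size_rcons => /andP[path_q Euv] lt_q.
  have /andP[gt0 le_q] := IHq path_q (ltnW lt_q).
  have := short2 _ _ Euv; rewrite gt0 (leq_trans le_q) // => /(_ isT)/andP[-> le_v].
  exact: leq_trans le_v _.
have lev_le (v : 'I_n) : 0 < m2 level v <= B.+1.
  have [q [path_q <- size_q]] := near v; case/shortenP: path_q => q' path_q' uniq_q' sub.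
  have size_q' : size q' <= n.
    by have := max_card (mem (r :: q')); rewrite (card_uniqP uniq_q') card_ord => /ltnW.
  have /andP[-> le_q'] := reach q' path_q' size_q'; apply: leq_trans le_q' _.
  by rewrite ltnS; apply: leq_trans size_q; apply: uniq_leq_size sub; case/andP: uniq_q'.
pose good (v : 'I_n) (m' : memory) := v != r -> exists u : 'I_n, [/\ m' parent v = u, E u v & (m2 level u).+1 = m2 level v].
have [|||||_ _ par_ok] := @foldl_enum_all n _ (fun m'' m' => forall v, good v m' -> good v m'')
  (same_but parent m2) good (fun m' (i : 'I_n) => run n (upd env 1 i) (search 2 (And (flag (entry edge (Var 2) (Var 1))) (Eq (Plus (Get level (Var 2)) (Num 1)) (Get level (Var 1))))
    parent (Var 1)) m') m2.
- by [].
- by move=> a b c ab bc v /bc/ab.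
- by move=> v a b ga ab; exact: ab.
- by [].
- move=> v m' same'.
  have [u m4 same4|u m4 same4|same4 found] := @run_search n (upd env 1 v) m' parent v 2
    (And (flag (entry edge (Var 2) (Var 1))) (Eq (Plus (Get level (Var 2)) (Num 1)) (Get level (Var 1)))) (Var 1)
    (fun u => E u v && ((m2 level u).+1 == m2 level v)).
  + by rewrite /= !same4 // !same' // same2 // mE lt0b addn1.
  + by [].
  have good_v : good v (run n (upd env 1 v) (search 2 (And (flag (entry edge (Var 2) (Var 1))) (Eq (Plus (Get level (Var 2)) (Num 1)) (Get level (Var 1))))
    parent (Var 1)) m').
    move=> vr; have [|u Eu /andP[Euv /eqP Elev]] := found; last by exists u.
    have [|u [Euv _ Elev]] := step2 v vr; first by rewrite -lt0n; have /andP[] := lev_le v.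
    by exists u; rewrite Euv Elev eqxx.
  split=> //.
  + by move=> b j bp; rewrite same4 ?bp // same'.
  move=> w; have [->//|wv] := eqVneq w v; move=> gw wr; have [u [Eu Euw Elev]] := gw wr.
  by exists u; rewrite same4 // (inj_eq val_inj) wv orbT.
have {}par_ok (v : 'I_n) : exists u : 'I_n, v != r -> [/\ m3 parent v = u, E u v & (m2 level u).+1 = m2 level v].
  have [->|vr] := eqVneq v r; first by exists r.
  by have [u ?] := par_ok v vr; exists u.
have [par parP] := @fin_all_exists _ (fun=> 'I_n) (fun v u => v != r -> [/\ m3 parent v = u, E u v & (m2 level u).+1 = m2 level v]) par_ok.
exists (fun v => (m2 level v).-1), par; split=> v; try by move=> /parP[].
  move=> /parP[_ _ <-] /=; rewrite prednK //; by have /andP[] := lev_le (par v).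
by have /andP[gt0] := lev_le v; rewrite -{1}(prednK gt0).
Qed.
End BfsSpec.

(** * Service times *)

Section TimeSpec.
Variables (n : nat) (r : 'I_n) (par : 'I_n -> 'I_n) (lev : 'I_n -> nat).
Hypothesis r0 : r = 0 :> nat.
Hypothesis par_lt : forall v, v != r -> lev (par v) < lev v.
Local Notation up := (parent_edge r par).

Lemma pos_root (v : 'I_n) : (0 < v) = (v != r).
Proof. by rewrite lt0n -(inj_eq val_inj) /= r0. Qed.

Lemma up_test (m : memory) (w c : 'I_n) : (forall v : 'I_n, v != r -> m parent v = par v) ->
  (0 < w) && (m parent w == c) = up w c.
Proof. by move=> mpar; rewrite pos_root /parent_edge /=; case: eqVneq => // wr; rewrite mpar. Qed.

Lemma run_time_body env (m : memory) (t : nat) (c : 'I_n) : (forall v : 'I_n, v != r -> m parent v = par v) ->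
  run n (upd (upd env 0 t) 1 c) time_body m =
  if [&& c != r, m time c == 0, ~~ [exists w : 'I_n, up w c && ((m time w == 0) || (t < m time w))]
       & ~~ [exists w : 'I_n, up w (par c) && (m time w == t.+1)]]
  then update m time c t.+1 else m.
Proof.
move=> mpar; rewrite /time_body run_when /= addn1 pos_root.
rewrite -andbA; case: eqVneq => //= cr; congr (if [&& _, ~~ _ & ~~ _] then _ else _).
  by apply: eq_existsb => w; rewrite up_test // addn1.
by apply: eq_existsb => w; rewrite (mpar c cr) up_test // addn1.
Qed.

(** The second alternative covers a child served in round [t] itself, stored as [t.+1]. So a vertex
    passed over for this reason still satisfies it at the end of the round. *)
Definition waiting (m : memory) (t : nat) (c : 'I_n) := exists2 w : 'I_n, up w c & m time w = 0 \/ t < m time w.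
Definition blocked (m : memory) (t : nat) (c : 'I_n) := exists2 w : 'I_n, up w (par c) & m time w = t.+1.

Lemma time_round env (ms : memory) (t : nat) :
  (forall v : 'I_n, v != r -> ms parent v = par v) ->
  (forall v : 'I_n, ms time v <= t) -> ms time r = 0 ->
  (forall c w : 'I_n, ms time c != 0 -> up w c -> 0 < ms time w < ms time c) ->
  (forall c w : 'I_n, c != r -> w != r -> par c = par w -> ms time c != 0 -> ms time c = ms time w -> c = w) ->
  let m' := run n (upd env 0 t) (Each 1 time_body) ms in
  [/\ same_but time ms m',
      forall v : 'I_n, m' time v = ms time v \/ ms time v = 0 /\ m' time v = t.+1, m' time r = 0,
      forall c w : 'I_n, m' time c != 0 -> up w c -> 0 < m' time w < m' time c
    & (forall c w : 'I_n, c != r -> w != r -> par c = par w -> m' time c != 0 -> m' time c = m' time w -> c = w) /\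
      forall c, c != r -> [\/ m' time c != 0, waiting m' t c | blocked m' t c]].
Proof.
move=> mpar ms_le ms_r ms_child ms_sib.
pose Inv (m' : memory) := [/\ same_but time ms m',
      forall v : 'I_n, m' time v = ms time v \/ ms time v = 0 /\ m' time v = t.+1, m' time r = 0,
      forall c w : 'I_n, m' time c != 0 -> up w c -> 0 < m' time w < m' time c
    & (forall c w : 'I_n, c != r -> w != r -> par c = par w -> m' time c != 0 -> m' time c = m' time w -> c = w)].
pose le (m'' m' : memory) := forall v : 'I_n, m'' time v = m' time v \/ m' time v = 0 /\ m'' time v = t.+1.
pose Q (c : 'I_n) (m' : memory) := c != r -> [\/ m' time c != 0, waiting m' t c | blocked m' t c].
move=> m'; suff [[H1 H2 H3 H4 H5] _ H6] : [/\ Inv m', le m' ms & forall c, Q c m'] by split.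
apply: (@foldl_enum_all n _ le Inv Q (fun m (c : 'I_n) => run n (upd (upd env 0 t) 1 c) time_body m)).
- by move=> m v; left.
- move=> m1 m2 m3 l12 l23 v; case: (l23 v) => [<-|[m3v m2v]]; first exact: l12.
  by right; case: (l12 v); rewrite m2v // => -[].
- move=> c m1 m2 Q1 l21 cr; case: (Q1 cr) => [m1c|[w wc m1w]|[w wc m1w]].
  + apply: Or31; case: (l21 c) => [->//|[m1c' _]]; by rewrite m1c' in m1c.
  + apply: Or32; exists w => //; case: (l21 w) => [->//|[_ ->]]; by right.
  + apply: Or33; exists w => //; case: (l21 w) => [->//|[m1w' _]]; by rewrite m1w' in m1w.
- by split=> // v; left.
move=> c m1 [same1 new1 m1_r child1 sib1]; rewrite run_time_body; last first.
  by move=> v vr; rewrite same1 // mpar.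
case: ifPn => [/and4P[cr /eqP m1c nowait noblock]|blk]; last first.
  split=> // [v|cr]; first by left.
  move: blk; rewrite cr /=; have [m1c|m1c _] /= := eqVneq (m1 time c) 0; last exact: Or31.
  rewrite negb_and !negbK => /orP[] /existsP[w /andP[wc]].
    by move=> /orP[/eqP m1w|m1w]; apply: Or32; exists w => //; [left|right].
  by move=> /eqP m1w; apply: Or33; exists w.
have upd_time (v : 'I_n) : update m1 time c t.+1 time v = if v == c then t.+1 else m1 time v by rewrite updE.
have m1_le (v : 'I_n) : m1 time v <= t.+1 by case: (new1 v) => [->|[_ ->]] //; apply: leqW.
split; first split.
- by move=> b j bt; rewrite updE (negPf bt) same1.
- move=> v; rewrite upd_time; case: eqVneq => // ->; right; split=> //.
  by case: (new1 c) => [<-//|[->]].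
- by rewrite upd_time eq_sym (negPf cr).
- move=> d w; rewrite !upd_time; have [Ed _ wd|dc m1d wd] := eqVneq d c.
    have wc : w != c.
      by apply: contraTneq wd => ->; rewrite Ed /parent_edge /= cr /=; apply: contraTneq (par_lt cr) => ->; rewrite ltnn.
    rewrite (negPf wc); rewrite Ed in wd.
    have : ~~ ((m1 time w == 0) || (t < m1 time w)).
      by apply: contra nowait => bad; apply/existsP; exists w; rewrite wd.
    by rewrite negb_or -lt0n -leqNgt ltnS.
  have := child1 d w m1d wd; case: eqVneq => [->|//]; by rewrite m1c.
- move=> d w dr wr Epar; rewrite !upd_time.
  have contra_block v : v != r -> par v = par c -> m1 time v <> t.+1.
    by move=> vr Ev m1v; case/negP: noblock; apply/existsP; exists v; rewrite /parent_edge /= vr Ev m1v !eqxx.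
  have [Ed _|dc] := eqVneq d c; have [Ew|wc] := eqVneq w c; rewrite ?Ed ?Ew //.
  + by move=> /esym/(contra_block w wr (esym _)); rewrite -Epar Ed => /(_ erefl).
  + by move=> _ /(contra_block d dr _); rewrite Epar Ew => /(_ erefl).
  exact: sib1.
- by move=> v; rewrite upd_time; case: eqVneq => [->|_]; [right|left].
by move=> _; apply: Or31; rewrite upd_time eqxx.
Qed.

Lemma time_spec env (m : memory) :
  (forall v : 'I_n, v != r -> m parent v = par v) -> (forall j, m time j = 0) ->
  let m' := run n env time_prog m in
  exists tm : 'I_n -> nat,
    [/\ forall v : 'I_n, v != r -> m' time v = (tm v).+1, m' time r = 0 & forall v : 'I_n, v != r -> tm v < n] /\
    [/\ forall v, v != r -> par v != r -> tm v < tm (par v),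
        forall v w, v != r -> w != r -> par v = par w -> tm v = tm w -> v = w
      & forall v t, v != r -> t < tm v ->
          (exists2 w, up w v & t <= tm w) \/ (exists2 w, up w (par v) & tm w = t)].
Proof.
move=> mpar m0 m'.
pose Inv (t : nat) (m1 : memory) :=
  [/\ same_but time m m1, forall v : 'I_n, m1 time v <= t, m1 time r = 0,
      forall c w : 'I_n, m1 time c != 0 -> up w c -> 0 < m1 time w < m1 time c
    & (forall c w : 'I_n, c != r -> w != r -> par c = par w -> m1 time c != 0 -> m1 time c = m1 time w -> c = w) /\
      (forall (c : 'I_n) u, c != r -> u < t -> m1 time c = 0 \/ u.+1 < m1 time c -> waiting m1 u c \/ blocked m1 u c) /\
      ((forall v : 'I_n, v != r -> m1 time v != 0) \/ t <= #|[set v : 'I_n | m1 time v != 0]|)].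
have [same T_le T_r child [sib [busy progress]]] : Inv n m'.
  apply: (@foldl_enum_ind n _ Inv (fun m1 (t : 'I_n) => run n (upd env 0 t) (Each 1 time_body) m1)).
    split=> //; first by move=> v; rewrite m0.
      by move=> c w; rewrite m0.
    by split=> [c w|]; rewrite ?m0 //; split=> //; right.
  move=> t m1 [same T_le T_r child [sib [busy progress]]].
  have mpar1 (v : 'I_n) : v != r -> m1 parent v = par v by move=> vr; rewrite same // mpar.
  have := time_round env mpar1 T_le T_r child sib; set m2 := run _ _ _ m1 => -[same2 new2 T_r2 child2 [sib2 last2]].
  have keep (v : 'I_n) : m1 time v != 0 -> m2 time v = m1 time v.
    by case: (new2 v) => [//|[-> _]].
  split=> //.
  - by move=> b j bt; rewrite same2 // same.
  - by move=> v; case: (new2 v) => [->|[_ ->//]]; apply: leqW.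
  split=> //; split.
    move=> c u cr; rewrite ltnS leq_eqVlt => /predU1P[->|lt_u] late.
      case: (last2 c cr) => [m2c|wait|block]; [|by left|by right].
      case: late => [late|]; first by rewrite late in m2c.
      by case: (new2 c) => [->|[_ ->]]; rewrite ?ltnn // ltnNge leqW.
    have late1 : m1 time c = 0 \/ u.+1 < m1 time c.
      by case: (new2 c) => [<-//|[-> _]]; left.
    case: (busy c u cr lt_u late1) => [[w wc w_late]|[w wc w_u]].
      left; exists w => //; case: (new2 w) => [->//|[_ ->]]; right; exact: ltnW.
    by right; exists w => //; rewrite keep w_u.
  have [all_set|] := boolP [forall v : 'I_n, (v != r) ==> (m1 time v != 0)].
    left=> v vr; rewrite keep; exact: (implyP (forallP all_set v) vr).
  rewrite negb_forall => /existsP[v0]; rewrite negb_imply negbK => unset0; right.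
  have t_le : t <= #|[set v : 'I_n | m1 time v != 0]|.
    case: progress => // all_set; case/andP: unset0 => v0r; by rewrite (negPf (all_set v0 v0r)).
  (* Progress in every round: a deepest vertex without a time has no child without one, so either it
     is served now or a sibling served in this round blocks it. Hence [n] rounds suffice. *)
  case: (@arg_maxnP _ v0 (fun v => (v != r) && (m1 time v == 0)) lev unset0) => c /andP[cr /eqP c_unset] c_max.
  have [w w_old w_new] : exists2 w : 'I_n, m1 time w = 0 & m2 time w != 0.
    case: (last2 c cr) => [m2c|[w wc w_late]|[w wc w_t]]; first by exists c.
      have /andP[wr /eqP Ew] := wc; exists w.
        apply/eqP; apply: contraT => w_set.
        by case: w_late; rewrite keep // => E; [rewrite E in w_set|rewrite ltnNge T_le in E].
      case: w_late => [w_unset|]; last by case: (m2 _ _).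
      have := c_max w; rewrite wr; case: (new2 w) => [<-|[_ E]]; last by rewrite w_unset in E.
      by rewrite w_unset eqxx => /(_ isT) /=; rewrite leqNgt -Ew par_lt.
    exists w; last by rewrite w_t.
    by case: (new2 w) => [E|[->//]]; have := T_le w; rewrite -E w_t ltnn.
  apply: leq_ltn_trans t_le _; apply: proper_card; apply/properP; split.
    by apply/subsetP => v; rewrite !inE => v_set; rewrite keep.
  by exists w; rewrite !inE // w_old.
have all_set (v : 'I_n) : v != r -> m' time v != 0.
  case: progress => [all_set|n_le]; first exact: all_set.
  have : [set v : 'I_n | m' time v != 0] \subset [set~ r].
    by apply/subsetP => w; rewrite !inE; apply: contraNneq => ->; rewrite T_r.
  move/subset_leq_card/(leq_trans n_le); rewrite cardsC1 card_ord.
  by rewrite -ltnS prednK ?ltnn //; exact: leq_ltn_trans (ltn_ord r).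
have succ (v : 'I_n) : v != r -> m' time v = (m' time v).-1.+1 by move=> /all_set; rewrite -lt0n => /prednK.
exists (fun v => (m' time v).-1); split; split=> //.
- by move=> v vr; rewrite -succ.
- move=> v vr pr; rewrite -ltnS -!succ //.
  have vp : up v (par v) by rewrite /parent_edge /= vr eqxx.
  by have /andP[_] := child (par v) v (all_set _ pr) vp.
- move=> v w vr wr Epar Etm; apply: sib => //; first exact: all_set.
  by rewrite (succ v) // (succ w) // Etm.
move=> v t vr lt_t; have [||[w wv w_late]|[w wv w_t]] := busy v t vr.
- apply: leq_trans (T_le v); apply: leq_trans lt_t _; exact: leq_pred.
- by right; rewrite (succ v).
- left; exists w => //; have /andP[wr _] := wv; case: w_late => [w0|]; first by have := all_set w wr; rewrite w0.
  by rewrite (succ w).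
by right; exists w; rewrite // w_t.
Qed.
End TimeSpec.

(** * Colouring the conflicts of a round *)

Section ColorSpec.
Variables (n : nat) (G : sgraph 'I_n) (r : 'I_n) (par : 'I_n -> 'I_n) (tm : 'I_n -> nat).

Definition clash : rel 'I_n := fun c c' =>
  [&& c != c', tm c == tm c', c != r, c' != r & adj G c' (par c) || adj G c (par c')].

Lemma clash_sym : symmetric clash.
Proof.
by move=> c c'; rewrite /clash eq_sym (eq_sym (tm c)) orbC; case: (c != r); case: (c' != r); rewrite ?andbF.
Qed.

Definition timed (m : memory) : Prop :=
  [/\ forall v : 'I_n, v != r -> m parent v = par v,
      forall v : 'I_n, m time v = if v == r then 0 else (tm v).+1
    & forall u v : 'I_n, m 1 (n * u + v) = adj G u v].

Lemma timed_same (m m' : memory) a : a \notin [:: 1; parent; time] -> same_but a m m' -> timed m -> timed m'.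
Proof.
rewrite !inE !negb_or => /and3P[a1 ap at_] same [mp mt madj].
by split=> [v vr|v|u v]; (rewrite same; last by rewrite eq_sym); [exact: mp|exact: mt|exact: madj].
Qed.

Lemma holds_conflict (m : memory) env i j (c c' : 'I_n) : timed m ->
  value n m env i = c -> value n m env j = c' -> holds n m env (conflict i j) = clash c c'.
Proof.
case=> mp mt madj vi vj; rewrite /= vi vj !mt val_eqE /clash.
case: eqVneq => //= cc'.
have [Ec|cr] := eqVneq c r; have [Ec'|c'r] := eqVneq c' r; rewrite /= ?andbF //.
by rewrite !mp // !madj !lt0b andbT eqSS.
Qed.

Lemma run_rank_body D env (m : memory) (i : nat) (c : 'I_n) : timed m ->
  run n (upd (upd env 0 i) 1 c) (rank_body D) m =
  if [&& m rank c == 0, #|[set w : 'I_n | (m rank w == 0) && clash c w]| < D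
       & ~~ [exists w : 'I_n, m rank w == i.+1]]
  then update m rank c i.+1 else m.
Proof.
move=> mt; rewrite /rank_body run_when !holds_and.
set e := number _; have num : value n m (upd (upd env 0 i) 1 c) e = #|[set w : 'I_n | (m rank w == 0) && clash c w]|.
  apply: value_number => w; rewrite holds_and inE (holds_conflict (c := c) (c' := w) mt) //.
have -> : holds n m (upd (upd env 0 i) 1 c) (Less e (Num D)) = (#|[set w : 'I_n | (m rank w == 0) && clash c w]| < D).
  by rewrite -(addn1 #|_|) -num.
rewrite /= addn1; congr (if [&& _, _ & ~~ _] then _ else _).
Qed.

Lemma rank_spec D env (m : memory) : timed m -> (forall j, m rank j = 0) ->
  (forall X : {set 'I_n}, X != set0 -> exists2 c, c \in X & #|[set w in X | clash c w]| < D) ->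
  let m' := run n env (rank_prog D) m in
  [/\ same_but rank m m', forall v : 'I_n, 0 < m' rank v <= n,
      forall v w : 'I_n, m' rank v = m' rank w -> v = w
    & forall v : 'I_n, #|[set w : 'I_n | (m' rank v < m' rank w) && clash v w]| < D].
Proof.
move=> mt m0 degenerate m'.
pose later (m1 : memory) (v : 'I_n) := [set w : 'I_n | ((m1 rank w == 0) || (m1 rank v < m1 rank w)) && clash v w].
pose Inv (i : nat) (m1 : memory) :=
  [/\ same_but rank m m1, forall v : 'I_n, m1 rank v <= i,
      forall v w : 'I_n, m1 rank v != 0 -> m1 rank v = m1 rank w -> v = w,
      forall v : 'I_n, m1 rank v != 0 -> #|later m1 v| < D
    & (forall v : 'I_n, m1 rank v != 0) \/ i <= #|[set v : 'I_n | m1 rank v != 0]|].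
have [same r_le r_inj r_later progress] : Inv n m'.
  apply: (@foldl_enum_ind n _ Inv (fun m1 (i : 'I_n) => run n (upd env 0 i) (Each 1 (rank_body D)) m1)).
    by split=> //; [move=> v|move=> v w|move=> v|right]; rewrite ?m0.
  move=> i m1 [same r_le r_inj r_later progress].
  have mt1 : timed m1 by exact: timed_same same mt.
  set m2 := run _ _ _ m1.
  pose free (v : 'I_n) := (m1 rank v == 0) && (#|[set w : 'I_n | (m1 rank w == 0) && clash v w]| < D).
  pose IInv (m3 : memory) := same_but rank m1 m3 /\ ((forall v : 'I_n, m3 rank v = m1 rank v) \/
    exists2 v, free v & forall w : 'I_n, m3 rank w = if w == v then i.+1 else m1 rank w).
  pose done (m3 : memory) := exists w : 'I_n, m3 rank w = i.+1.
  pose le (m4 m3 : memory) := done m3 -> done m4.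
  pose Q (v : 'I_n) (m3 : memory) := ~~ free v \/ done m3.
  have none_old (w : 'I_n) : m1 rank w != i.+1.
    by apply: contraTneq (r_le w) => ->; rewrite ltnn.
  have [[same2 unchanged] _ isQ] : [/\ IInv m2, le m2 m1 & forall v, Q v m2].
    apply: (@foldl_enum_all n _ le IInv Q (fun m3 (c : 'I_n) => run n (upd (upd env 0 i) 1 c) (rank_body D) m3)).
    - by move=> m3.
    - by move=> a b c ab bc /bc/ab.
    - by move=> v a b [Q1|Q1] ab; [left|right; exact: ab].
    - by split=> //; left.
    move=> c m3 [same3 alt]; have mt3 : timed m3 by exact: timed_same same3 mt1.
    rewrite run_rank_body //; case: alt => [m3E|[v v_free m3E]]; last first.
      have -> : [exists w : 'I_n, m3 rank w == i.+1].
        by apply/existsP; exists v; rewrite m3E eqxx.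
      rewrite !andbF; split=> //; last by right; exists v; rewrite m3E eqxx.
      by split=> //; right; exists v.
    have -> : [exists w : 'I_n, m3 rank w == i.+1] = false.
      by apply/existsP => -[w]; rewrite m3E (negPf (none_old w)).
    have -> : [set w : 'I_n | (m3 rank w == 0) && clash c w] = [set w : 'I_n | (m1 rank w == 0) && clash c w].
      by apply/setP => w; rewrite !inE m3E.
    rewrite m3E andbT -/(free c); case: ifPn => [c_free|c_nfree]; last first.
      by split=> //; [split=> //; left|left].
    have d3 : done (update m3 rank c i.+1) by exists c; rewrite updE !eqxx.
    split=> //; last by right.
    split; first by move=> b j br; rewrite updE (negPf br) same3.
    by right; exists c => // w; rewrite updE /= val_eqE m3E.
  case: unchanged => [m2E|[v v_free m2E]].
    (* No vertex was ranked in this round, so none was free; by [degenerate] the set of unranked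
       vertices is then empty. *)
    have all_set (v : 'I_n) : m1 rank v != 0.
      have [E|] := eqVneq [set v : 'I_n | m1 rank v == 0] set0.
        by have := in_set0 v; rewrite -E inE => ->.
      case/degenerate=> c; rewrite inE => c_unset c_small; case: (isQ c) => [|[w]].
        case/negP; rewrite /free c_unset /=; apply: leq_ltn_trans c_small.
        by apply: subset_leq_card; apply/subsetP => w; rewrite !inE.
      by rewrite m2E => E; have := none_old w; rewrite E eqxx.
    split.
    - by move=> b j br; rewrite same2 // same.
    - by move=> w; rewrite m2E leqW.
    - by move=> w z; rewrite !m2E; exact: r_inj.
    - move=> w; rewrite m2E => w_set; rewrite (_ : later m2 w = later m1 w); first exact: r_later.
      by apply/setP => z; rewrite !inE !m2E.
    by left=> w; rewrite m2E.
  have /andP[/eqP v_unset v_small] := v_free.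
  split.
  - by move=> b j br; rewrite same2 // same.
  - by move=> w; rewrite m2E; case: ifP => // _; apply: leqW.
  - move=> w z; rewrite !m2E; have [->|wv] := eqVneq w v; have [->|zv] := eqVneq z v => //.
    + by move=> _ E; have := none_old z; rewrite -E eqxx.
    + by move=> _ E; have := none_old w; rewrite E eqxx.
    exact: r_inj.
  - move=> w; rewrite m2E; have [-> _|wv w_set] := eqVneq w v.
      apply: leq_ltn_trans v_small; apply: subset_leq_card; apply/subsetP => z.
      rewrite !inE !m2E eqxx; case: (z == v) => /=; first by rewrite ltnn.
      by case/andP=> /orP[->//|]; rewrite ltnNge leqW.
    apply: leq_ltn_trans (r_later w w_set); apply: subset_leq_card; apply/subsetP => z.
    rewrite !inE !m2E (negPf wv); case: (eqVneq z v) => [->|//] /=.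
    by rewrite v_unset eqxx /= => /andP[].
  right; case: progress => [all_set|i_le]; first by have := all_set v; rewrite v_unset.
  apply: leq_ltn_trans i_le _; apply: proper_card; apply/properP; split.
    by apply/subsetP => w; rewrite !inE m2E; case: ifP.
  by exists v; rewrite !inE ?m2E ?eqxx // v_unset.
have all_set (v : 'I_n) : m' rank v != 0.
  case: progress => [//|n_le]; apply: contraTneq n_le => v_unset; rewrite -ltnNge.
  rewrite -[X in _ < X](card_ord n); apply: proper_card; apply/properP; split; first exact: subset_predT.
  by exists v; rewrite // inE v_unset.
split=> //.
- by move=> v; rewrite lt0n all_set r_le.
- by move=> v w; apply: r_inj.
move=> v; apply: leq_ltn_trans (r_later v (all_set v)); apply: subset_leq_card; apply/subsetP => w.
by rewrite !inE (negPf (all_set w)).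
Qed.
Lemma run_color_body env (m : memory) (k : nat) (v : 'I_n) : timed m ->
  run n (upd (upd env 1 v) 2 k) color_body m =
  if (m color v == 0) && ~~ [exists w : 'I_n, [&& clash v w, m rank v < m rank w & m color w == k.+1]]
  then update m color v k.+1 else m.
Proof.
move=> mt; rewrite /color_body run_when holds_and.
set t := Neg _; have -> : holds n m (upd (upd env 1 v) 2 k) t =
    ~~ [exists w : 'I_n, [&& clash v w, m rank v < m rank w & m color w == k.+1]].
  rewrite /t; set t1 := And _ _; rewrite [LHS]/(~~ [exists w : 'I_n, holds n m (upd (upd (upd env 1 v) 2 k) 3 w) t1]).
  congr (~~ _); apply: eq_existsb => w; rewrite /t1 holds_and (holds_conflict (c := v) (c' := w) mt) //.
  by rewrite /= !addn1.
by rewrite /= addn1.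
Qed.

Lemma color_vertex D env (m : memory) (v : 'I_n) : timed m -> m color v = 0 ->
  #|[set w : 'I_n | (m rank v < m rank w) && clash v w]| < D ->
  let m' := run n (upd env 1 v) (Each 2 color_body) m in
  [/\ forall b j : nat, (b != color) || (j != v) -> m' b j = m b j, 0 < m' color v <= D
    & forall w : 'I_n, m rank v < m rank w -> clash v w -> m color w != m' color v].
Proof.
set S := [set w : 'I_n | _] => mt m_v S_lt m'.
(* Each rejected colour occurs at a conflicting vertex of larger rank, different colours at
   different vertices. So a colour at most [D] is accepted, within the [n] iterations of the
   loop. *)
have used_le k : (forall j, j < k -> exists2 w, w \in S & m color w = j.+1) -> k <= #|S|.
  move=> used; rewrite -(size_iota 1 k) -(size_image (fun w : 'I_n => m color w)).
  apply: uniq_leq_size (iota_uniq _ _) _ => j; rewrite mem_iota => /andP[j_gt0 j_lt].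
  case: j j_gt0 j_lt => // j _; rewrite add1n ltnS => /used[w wS <-]; exact: image_f.
pose Inv (k : nat) (m1 : memory) := (forall b j : nat, (b != color) || (j != v) -> m1 b j = m b j) /\
  ((m1 color v = 0 /\ forall j, j < k -> exists2 w, w \in S & m color w = j.+1) \/
   (0 < m1 color v <= D /\ forall w, w \in S -> m color w != m1 color v)).
have [same [[_ used]|[m'_v free]]] : Inv n m'.
- apply: (@foldl_enum_ind n _ Inv (fun m1 (k : 'I_n) => run n (upd (upd env 1 v) 2 k) color_body m1)).
    by split=> //; left.
  move=> k m1 [same alt].
  have same_rank (w : 'I_n) : m1 rank w = m rank w by rewrite same.
  have mt1 : timed m1.
    have [mp mtm madj] := mt; split=> [w wr|w|a b].
    - by rewrite same ?mp.
    - by rewrite same ?mtm.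
    by rewrite same ?madj.
  rewrite run_color_body //; case: alt => [[m1_v used]|[m1_v free]]; last first.
    have -> : (m1 color v == 0) = false by apply: negbTE; rewrite -lt0n; case/andP: m1_v.
    by split=> //; right.
  rewrite m1_v eqxx; case: ifPn => [/existsPn none|].
    split; first by move=> b j; rewrite updE -negb_and => /negPf bj; rewrite bj same // -negb_and bj.
    right; rewrite updE !eqxx; split; first by apply: leq_ltn_trans S_lt; exact: used_le.
    move=> w; rewrite inE => /andP[wr vw]; have := none w; rewrite vw !same_rank wr /= same //.
    by apply/orP; right; rewrite val_eqE eq_sym; case/and5P: vw.
  rewrite negbK => /existsP[w /and3P[vw wr /eqP w_k]]; split=> //; left; split=> // j.
  rewrite ltnS leq_eqVlt => /predU1P[->|/used//]; exists w; first by rewrite inE -!same_rank wr.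
  by rewrite -w_k same //; apply/orP; right; rewrite val_eqE eq_sym; case/and5P: vw.
- have : #|S| < n.
    rewrite -[X in _ < X](card_ord n); apply: proper_card; apply/properP; split; first exact: subset_predT.
    by exists v; rewrite // inE ltnn.
  by rewrite ltnNge used_le.
by split=> // w wr vw; apply: free; rewrite inE wr.
Qed.

Lemma color_spec D env (m : memory) : timed m -> m 0 0 = n -> (forall j, m color j = 0) ->
  (forall v : 'I_n, 0 < m rank v <= n) -> (forall v w : 'I_n, m rank v = m rank w -> v = w) ->
  (forall v : 'I_n, #|[set w : 'I_n | (m rank v < m rank w) && clash v w]| < D) ->
  let m' := run n env color_prog m in
  [/\ same_but color m m', forall v : 'I_n, 0 < m' color v <= D
    & forall v w : 'I_n, clash v w -> m' color v != m' color w].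
Proof.
move=> mt mn m0 r_range r_inj r_later m'.
pose good (m1 : memory) (v : 'I_n) := 0 < m1 color v <= D /\
  forall w : 'I_n, m rank v < m rank w -> clash v w -> m1 color w != m1 color v.
pose Inv (i : nat) (m1 : memory) := same_but color m m1 /\
  forall v : 'I_n, if n < m rank v + i then good m1 v else m1 color v = 0.
have [same colored] : Inv n m'.
  apply: (@foldl_enum_ind n _ Inv (fun m1 (i : 'I_n) => run n (upd env 0 i) (Each 1
      (When (Eq (Plus (Get rank (Var 1)) (Var 0)) (Get 0 (Num 0))) (Each 2 color_body))) m1)).
    by split=> // v; rewrite addn0 ltnNge; have /andP[_ ->] := r_range v.
  move=> i m1 [same colored]; set m2 := run _ _ _ m1.
  pose IInv (k : nat) (m3 : memory) := same_but color m m3 /\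
    forall v : 'I_n, if (n < m rank v + i) || ((m rank v + i == n) && (v < k)) then good m3 v else m3 color v = 0.
  suff [same2 colored2] : IInv n m2.
    split=> // v; have := colored2 v; rewrite ltn_ord andbT addnS ltnS [X in _ -> if X then _ else _]leq_eqVlt.
    by rewrite orbC eq_sym.
  apply: (@foldl_enum_ind n _ IInv (fun m3 (k : 'I_n) => run n (upd (upd env 0 i) 1 k)
      (When (Eq (Plus (Get rank (Var 1)) (Var 0)) (Get 0 (Num 0))) (Each 2 color_body)) m3)).
    by split=> // v; rewrite ltn0 andbF orbF; exact: colored.
  move=> k m3 [same3 colored3]; rewrite run_when.
  have -> : holds n m3 (upd (upd env 0 i) 1 k) (Eq (Plus (Get rank (Var 1)) (Var 0)) (Get 0 (Num 0))) = (m rank k + i == n).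
    by rewrite /= !same3 // mn.
  case: ifPn => [/eqP k_turn|k_wait]; last first.
    split=> // v; have := colored3 v; rewrite [v < k.+1]ltnS [v <= k]leq_eqVlt.
    by rewrite (inj_eq val_inj); have [->|_] := eqVneq v k; rewrite ?(negPf k_wait).
  have mt3 : timed m3 by exact: timed_same same3 mt.
  have m3_k : m3 color k = 0 by have := colored3 k; rewrite k_turn ltnn eqxx ltnn.
  have [|same4 k_range k_free] := @color_vertex D (upd env 0 i) m3 k mt3 m3_k.
    by apply: leq_trans (r_later k); rewrite ltnS; apply/eq_leq/eq_card => w; rewrite !inE !same3.
  set m4 := run _ _ _ m3 in same4 k_range k_free *.
  have other (v : 'I_n) : v != k -> m4 color v = m3 color v.
    by move=> vk; rewrite same4 // (inj_eq val_inj) vk orbT.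
  split; first by move=> b j bc; rewrite same4 ?bc // same3.
  move=> v; have [Ev|vk] := eqVneq v k.
    rewrite Ev k_turn eqxx ltnS leqnn orbT; split=> // w wr kw.
    rewrite other; first by apply: k_free; rewrite ?same3.
    by apply: contraTneq wr => ->; rewrite ltnn.
  have v_turn : m rank v + i != n.
    by apply: contra vk => /eqP v_turn; apply/eqP/r_inj/eqP; rewrite -(eqn_add2r i) v_turn k_turn.
  have := colored3 v; rewrite (negPf v_turn) /= !orbF; case: ifP => [late [v_range v_free]|_]; last by rewrite other.
  split; first by rewrite other.
  move=> w wr vw; rewrite !other //; first exact: v_free.
  apply: contraTneq wr => ->; rewrite -leqNgt -(leq_add2r i) k_turn; exact: ltnW.
have all_good v : good m' v.
  by have := colored v; have /andP[r_gt0 _] := r_range v; rewrite -{1}[n]add0n ltn_add2r r_gt0.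
split=> //; first by move=> v; case: (all_good v).
move=> v w vw; have [lt|gt|Er] := ltngtP (m rank v) (m rank w).
- by have [_ free] := all_good v; rewrite eq_sym; exact: free.
- by have [_ free] := all_good w; apply: free; rewrite // clash_sym.
by case/and5P: vw; rewrite (r_inj _ _ Er) eqxx.
Qed.
End ColorSpec.

(** * The emitted rounds *)

Lemma foldl_flatten (T I S : Type) (Inv : T -> Prop) (out : T -> seq S) (f : T -> I -> T) (g : I -> seq S) z s :
  Inv z -> (forall z i, Inv z -> Inv (f z i) /\ out (f z i) = out z ++ g i) ->
  Inv (foldl f z s) /\ out (foldl f z s) = out z ++ flatten (map g s).
Proof.
move=> inv0 step; elim: s z inv0 => [|i s IHs] z inv0 /=; first by rewrite cats0.
have [inv1 out1] := step z i inv0; have [inv2 ->] := IHs _ inv1.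
by rewrite out1 catA.
Qed.

Lemma rev_enum_ord n : rev (enum 'I_n) = map (@rev_ord n) (enum 'I_n).
Proof.
case: n => [|n]; first by rewrite (size0nil (size_enum_ord 0)).
apply: (@eq_from_nth _ ord0) => [|i]; first by rewrite size_rev size_map.
rewrite size_rev size_enum_ord => lt_i; rewrite nth_rev ?size_enum_ord //.
rewrite (nth_map ord0) ?size_enum_ord //; apply: val_inj => /=.
by rewrite !nth_enum_ord // subSS ltnS leq_subr.
Qed.

Lemma rev_flatten_enum n (S : Type) (g : 'I_n -> seq S) :
  rev (flatten (map g (enum 'I_n))) = flatten [seq rev (g (rev_ord i)) | i <- enum 'I_n].
Proof.
by rewrite rev_flatten -map_rev -(map_rev g) rev_enum_ord -!map_comp.
Qed.

Lemma map_flatten_map (I S S' : Type) (f : S -> S') (g : I -> seq S) s :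
  map f (flatten (map g s)) = flatten [seq map f (g i) | i <- s].
Proof. by elim: s => //= i s IHs; rewrite map_cat IHs. Qed.

Lemma pairwise_flatten (I : Type) (T : eqType) (R : rel T) (g : I -> seq T) (Q : rel I) s :
  pairwise Q s -> (forall i, pairwise R (g i)) ->
  (forall i j, Q i j -> {in g i & g j, forall x y, R x y}) -> pairwise R (flatten (map g s)).
Proof.
move=> + Rg QR; elim: s => //= i s IHs /andP[Qi /IHs R_s].
rewrite pairwise_cat Rg R_s !andbT; apply/allrelP => x y xi.
elim: s Qi {IHs R_s} => //= j s IHs /andP[Qij Qi]; rewrite mem_cat => /orP[yj|].
  exact: QR Qij _ _ xi yj.
exact: IHs.
Qed.

Section OutputSpec.
Variables (n : nat) (r : 'I_n) (par : 'I_n -> 'I_n) (tm : 'I_n -> nat) (col : 'I_n -> nat).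

Definition class t k : {set 'I_n} := [set c | [&& c != r, tm c == t & col c == k.+1]].
Definition chosen (t k : nat) : seq {set 'I_n} := if class t k != set0 then [:: class t k] else [::].
Definition gather_rounds : seq {set 'I_n} :=
  flatten [seq flatten [seq chosen t k | k : 'I_n <- enum 'I_n] | t : 'I_n <- enum 'I_n].

Definition same_off (m m' : memory) := forall b j, b \notin [:: 2; 3] -> m' b j = m b j.

Lemma emit_spec env (m : memory) t (S : {set 'I_n}) :
  (forall (v : 'I_n) m', same_but 3 m m' -> holds n m' (upd env 2 v) t = (v \in S)) ->
  let m' := run n env (emit_prog t) m in
  same_off m m' /\ schedule_output n m' = rcons (schedule_output n m) S.
Proof.
move=> tS m'; rewrite {}/m' /emit_prog run_then; set m1 := run n env _ m.
pose Inv (k : nat) (m' : memory) := [/\ same_but 3 m m',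
  forall v : 'I_n, v < k -> m' 3 (n * m 2 0 + v) = (v \in S) & forall j, j < n * m 2 0 -> m' 3 j = m 3 j].
have [same1 new1 old1] : Inv n m1.
  apply: (@foldl_enum_ind n _ Inv (fun m' (v : 'I_n) =>
      run n (upd env 2 v) (set_entry 3 (Get 2 (Num 0)) (Var 2) (Cond t (Num 1) (Num 0))) m')) => // v m2 [same2 new2 old2].
  rewrite /= tS // same2 //; split.
  - by move=> b j b3; rewrite updE (negPf b3) same2.
  - move=> w; rewrite ltnS leq_eqVlt updE /= eqn_add2l => /predU1P[/val_inj->|lt_w]; first by rewrite eqxx; case: (_ \in S).
    by rewrite ltn_eqF // new2.
  by move=> j lt_j; rewrite updE /= ltn_eqF ?old2 // ltn_addr.
split.
  by move=> b j; rewrite !inE negb_or => /andP[b2 b3]; rewrite /= updE (negPf b2) /= same1.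
rewrite /schedule_output /= updE /= addn1 same1 // mkseqS.
congr rcons.
  apply/eq_in_map => q; rewrite mem_iota add0n => /andP[_ lt_q]; apply/setP => v; rewrite !inE updE /= old1 //.
  by rewrite mulnC; apply: leq_trans (_ : n * q.+1 <= _); rewrite ?leq_mul2l ?lt_q ?orbT // mulnS addnC ltn_add2r.
apply/setP => v; rewrite !inE updE /= mulnC new1 //; by case: (v \in S).
Qed.

Definition scheduled (m : memory) : Prop :=
  [/\ m 0 0 = n, forall v : 'I_n, v != r -> m parent v = par v,
      forall v : 'I_n, m time v = if v == r then 0 else (tm v).+1
    & forall v : 'I_n, m color v = col v].

Lemma same_off_scheduled m m' : same_off m m' -> scheduled m -> scheduled m'.
Proof. by move=> same [m0 mp mt mc]; split=> [|v vr|v|v]; rewrite same // ?mp. Qed.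

Lemma holds_gather (m : memory) (env : nat -> nat) (t k c : 'I_n) (x : nat) : scheduled m ->
  env 0 = t -> env 1 = k -> env x = c -> holds n m env (gather_test (Var x)) = (c \in class t k).
Proof.
case=> _ _ mt mc E0 E1 Ex; rewrite inE /= E0 E1 Ex mt mc !addn1.
by case: (eqVneq c r).  
Qed.

Lemma holds_reverse (m : memory) (env : nat -> nat) (t k c : 'I_n) (x : nat) : scheduled m ->
  env 0 = t -> env 1 = k -> env x = c ->
  holds n m env (reverse_test (Var x)) = (c \in class (rev_ord t) (rev_ord k)).
Proof.
case=> m0 _ mt mc E0 E1 Ex; rewrite inE /= E0 E1 Ex m0 mt mc.
have [_|_] /= := eqVneq c r; first by rewrite add0n ltn_eqF.
have := ltn_ord t; have := ltn_ord k; move: (tm c) (col c) => a b lt_k lt_t.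
by apply/andP/andP => -[/eqP E1' /eqP E2']; split; apply/eqP; lia.
Qed.

Lemma class_test (m : memory) env (t : test) (S : {set 'I_n}) :
  (forall c : 'I_n, holds n m (upd env 2 c) t = (c \in S)) -> holds n m env (Ex 2 t) = (S != set0).
Proof.
move=> tS; rewrite /=; apply/existsP/set0Pn => -[c]; first by rewrite tS; exists c.
by move=> cS; exists c; rewrite tS.
Qed.

(** [t] decides whether a round is emitted and [t'] what it contains; they differ in the broadcast,
    which emits the parents of a class. *)
Lemma output_loop env (m : memory) t t' (S S' : 'I_n -> 'I_n -> {set 'I_n}) : scheduled m ->
  (forall (i j c : 'I_n) m', scheduled m' -> holds n m' (upd (upd (upd env 0 i) 1 j) 2 c) t = (c \in S i j)) ->
  (forall (i j c : 'I_n) m', scheduled m' -> holds n m' (upd (upd (upd env 0 i) 1 j) 2 c) t' = (c \in S' i j)) ->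
  let m' := run n env (Each 0 (Each 1 (When (Ex 2 t) (emit_prog t')))) m in
  scheduled m' /\ schedule_output n m' = schedule_output n m ++
    flatten [seq flatten [seq (if S i j != set0 then [:: S' i j] else [::]) | j : 'I_n <- enum 'I_n] | i : 'I_n <- enum 'I_n].
Proof.
move=> sm tS tS'.
apply: (@foldl_flatten memory 'I_n {set 'I_n} scheduled (@schedule_output n)
  (fun m' (i : 'I_n) => run n (upd env 0 i) (Each 1 (When (Ex 2 t) (emit_prog t'))) m')) => // {sm}m i sm.
apply: (@foldl_flatten memory 'I_n {set 'I_n} scheduled (@schedule_output n)
  (fun m' (j : 'I_n) => run n (upd (upd env 0 i) 1 j) (When (Ex 2 t) (emit_prog t')) m')) => // {sm}m j sm.
rewrite run_when (class_test (S := S i j)); last by move=> c; exact: tS.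
case: ifP => _; last by rewrite cats0.
have [c m' same|same ->] := @emit_spec (upd (upd env 0 i) 1 j) m t' (S' i j).
  apply: tS'; have [m0 mp mt mc] := sm; split=> [|v vr|v|v]; by rewrite same // ?mp.
by rewrite cats1; split=> //; exact: same_off_scheduled same sm.
Qed.

Lemma output_spec env (m : memory) : scheduled m -> m 2 0 = 0 ->
  schedule_output n (run n env output_prog m) = gather_rounds ++ rev (map (parents par) gather_rounds).
Proof.
move=> sm m2; rewrite /output_prog run_then.
have [||sm1 out1] := @output_loop env m (gather_test (Var 2)) (gather_test (Var 2)) (fun t k => class t k) (fun t k => class t k) sm.
- by move=> i j c m' sm'; rewrite (holds_gather (t := i) (k := j) (c := c)).
- by move=> i j c m' sm'; rewrite (holds_gather (t := i) (k := j) (c := c)).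
set m1 := run n env _ m in sm1 out1 *.
have [||_ ->] := @output_loop env m1 (reverse_test (Var 2)) (Ex 3 (And (reverse_test (Var 3)) (Eq (Get parent (Var 3)) (Var 2))))
  (fun t k => class (rev_ord t) (rev_ord k)) (fun t k => parents par (class (rev_ord t) (rev_ord k))) sm1.
- by move=> i j c m' sm'; rewrite (holds_reverse (t := i) (k := j) (c := c)).
- move=> i j c m' sm'; rewrite holds_ex; apply/existsP/imsetP => [[c']|[c' cS ->]].
    rewrite holds_and (holds_reverse (t := i) (k := j) (c := c')) // => /andP[cS /eqP Ec].
    exists c' => //; apply: val_inj; have [_ mp _ _] := sm'.
    by rewrite -[LHS]Ec /= mp //; move: cS; rewrite inE => /and3P[].
  exists c'; rewrite holds_and (holds_reverse (t := i) (k := j) (c := c')) // cS /=.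
  by have [_ mp _ _] := sm'; rewrite mp //; move: cS; rewrite inE => /and3P[].
rewrite out1 {1}/schedule_output m2 cat0s; congr (_ ++ _).
rewrite /gather_rounds map_flatten_map rev_flatten_enum; congr flatten; apply: eq_map => t.
rewrite map_flatten_map rev_flatten_enum; congr flatten; apply: eq_map => k.
by rewrite /chosen; case: ifP.
Qed.

Lemma chosen_class (t k : nat) S : S \in chosen t k -> S = class t k.
Proof. by rewrite /chosen; case: ifP => // _; rewrite inE => /eqP. Qed.

Lemma gather_roundsP S : S \in gather_rounds -> exists t k : 'I_n, S = class t k.
Proof. by case/flatten_mapP=> t _ /flatten_mapP[k _ /chosen_class->]; exists t, k. Qed.

Lemma mem_gather_rounds (v : 'I_n) : v != r -> tm v < n -> 0 < col v <= n ->
  exists2 S, S \in gather_rounds & v \in S.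
Proof.
move=> vr t_lt /andP[c_gt0 c_le]; have k_lt : (col v).-1 < n by rewrite prednK.
pose t := Ordinal t_lt; pose k := Ordinal k_lt.
have vS : v \in class t k by rewrite inE vr /= eqxx prednK ?eqxx.
exists (class t k) => //; apply/flatten_mapP; exists t; first exact: mem_enum.
apply/flatten_mapP; exists k; first exact: mem_enum.
by rewrite /chosen ifT ?mem_head //; apply/set0Pn; exists v.
Qed.

(** The rounds are sorted by [t] first, and the rounds of one [t] contain only vertices of that
    time, so their mutual order is irrelevant. *)
Lemma gather_rounds_order s1 S s2 S' c c' : gather_rounds = s1 ++ S :: s2 -> S' \in S :: s2 ->
  c \in S -> c' \in S' -> tm c <= tm c'.
Proof.
pose R : rel {set 'I_n} := fun S S' => [forall c in S, forall c' in S', tm c <= tm c'].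
have R_class (t k t' k' : nat) : t <= t' -> R (class t k) (class t' k').
  move=> le_t; apply/forall_inP => d; rewrite inE => /and3P[_ /eqP-> _].
  by apply/forall_inP => d'; rewrite inE => /and3P[_ /eqP-> _].
have sorted_enum : pairwise (fun i j : 'I_n => i <= j) (enum 'I_n).
  by rewrite -(pairwise_map val leq) val_enum_ord -sorted_pairwise ?iota_sorted //; exact: leq_trans.
have : pairwise R gather_rounds.
  apply: (pairwise_flatten sorted_enum) => [t|t t' le_t].
    apply: (pairwise_flatten sorted_enum) => [k|k k' _].
      by rewrite /chosen; case: ifP.
    by move=> x y /chosen_class-> /chosen_class->; exact: R_class.
  move=> x y /flatten_mapP[k _ /chosen_class->] /flatten_mapP[k' _ /chosen_class->].
  exact: R_class.
move=> pair Es; have S_in : S \in gather_rounds by rewrite Es mem_cat mem_head orbT.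
move: pair; rewrite Es pairwise_cat => /and3P[_ _ /= /andP[/allP RS _]].
rewrite inE => /predU1P[->|/RS RSS'].
  by have [t [k ->]] := gather_roundsP S_in; rewrite !inE => /and3P[_ /eqP-> _] /and3P[_ /eqP->].
by move=> cS c'S'; have /forall_inP/(_ c cS)/forall_inP/(_ c' c'S') := RSS'.
Qed.

(** The loops visit [n * n] pairs, but a nonempty class has [t < T] and [k < D]. *)
Lemma size_gather_rounds T D : (forall v, v != r -> tm v < T) -> (forall v, v != r -> col v <= D) ->
  size gather_rounds <= T * D.
Proof.
move=> tm_lt col_le.
have few b : \sum_(i < n) (i < b) <= b.
  elim: (n) b => [|m IHm] [|b]; rewrite ?big_ord0 ?big_ord_recl //; first by rewrite big1 // => i _; rewrite ltn0.
  by rewrite add1n ltnS; apply: IHm.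
rewrite size_flatten /shape -map_comp sumnE big_map big_enum /=.
apply: leq_trans (_ : \sum_(t < n) (t < T) * D <= _); last first.
  by rewrite -big_distrl leq_mul2r few orbT.
apply: leq_sum => t _; rewrite size_flatten /shape -map_comp sumnE big_map big_enum /=.
have [lt_t|ge_t] := ltnP t T; last first.
  rewrite big1 // => k _; rewrite /chosen; case: eqP => //= /eqP/set0Pn[v].
  by rewrite inE => /and3P[vr /eqP Et _]; have := tm_lt v vr; rewrite Et ltnNge ge_t.
rewrite mul1n; apply: leq_trans (few D); apply: leq_sum => k _.
rewrite /chosen; case: eqP => //= /eqP/set0Pn[v].
by rewrite inE => /and3P[vr _ /eqP Ek]; have := col_le v vr; rewrite Ek => ->.
Qed.
End OutputSpec.

Lemma graph_input_adj n (G : sgraph 'I_n) (u v : 'I_n) : graph_input G 1 (n * u + v) = adj G u v.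
Proof.
rewrite /graph_input; congr nat_of_bool; apply/existsP/idP => [[u' /existsP[v' /andP[/eqP E]]]|uv].
  by rewrite [u' * n]mulnC in E; have [-> ->] := idx_inj E.
by exists u; apply/existsP; exists v; rewrite uv mulnC eqxx.
Qed.

(** Conflicts join vertices of equal time, so one time class of [X] is enough. Its vertices and
    their parents form a matching: siblings have different times, and a parent other than the root
    has a larger time than its child. The root has no conflicts and settles the case where it
    belongs to [X]. *)
Lemma clash_degenerate (W : finType) (H : sgraph W) n (G : sgraph 'I_n) (r : 'I_n) par tm (X : {set 'I_n}) :
  minor_free H G -> (forall v, v != r -> adj G v (par v)) ->
  (forall v, v != r -> par v != r -> tm v < tm (par v)) ->
  (forall v w, v != r -> w != r -> par v = par w -> tm v = tm w -> v = w) ->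
  X != set0 -> exists2 c, c \in X & #|[set w in X | clash G r par tm c w]| < 2 ^ #|W|.
Proof.
move=> GH par_adj tm_lt tm_inj /set0Pn[c0 c0X].
have [rX|rNX] := boolP (r \in X).
  exists r => //; rewrite (_ : [set w in X | _] = set0) ?cards0 ?expn_gt0 //.
  by apply/setP => w; rewrite !inE /clash eqxx !andbF.
pose Y := [set c in X | tm c == tm c0].
have Y0 : Y != set0 by apply/set0Pn; exists c0; rewrite inE c0X eqxx.
have YX c : c \in Y -> [/\ c \in X, c != r & tm c = tm c0].
  by rewrite inE => /andP[cX /eqP->]; split=> //; apply: contraNneq rNX => <-.
have [||c c'|c cY small] := @matching_degenerate W _ H G Y par GH Y0.
- move=> c c' /YX[_ cr tc] /YX[_ c'r tc'] Epar; apply: tm_inj => //; by rewrite tc.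
- by move=> c /YX[_ cr _]; exact: par_adj.
- move=> /YX[_ cr tc] /YX[_ c'r tc']; apply/eqP => Ec.
  by have := tm_lt c cr; rewrite Ec tc tc' ltnn => /(_ c'r).
have [cX _ tc] := YX c cY; exists c => //; apply: leq_ltn_trans small.
apply: subset_leq_card; apply/subsetP => w; rewrite !inE => /andP[-> /and5P[cw /eqP <- _ _ ->]].
by rewrite tc eqxx eq_sym cw.
Qed.

(** With [L = size sched] and [l = trunc_log 2 n], gathering uses at most [120 * L * l + 64 * L * l
    * (l + 1) <= 248 * L * l ^ 2] times, each with at most [2 ^ #|W|] colours; broadcasting doubles
    248 to 496. *)
Lemma gossip_prog_spec (W : finType) (H : sgraph W) n (G : sgraph 'I_n) sched :
  minor_free H G -> gossip_schedule G sched -> 1 < n ->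
  let s := schedule_output n (run n (fun=> 0) (gossip_prog (2 ^ #|W|)) (graph_input G)) in
  gossip_schedule G s /\ size s <= 496 * 2 ^ #|W| * (size sched * trunc_log 2 n ^ 2).
Proof.
move=> GH gossip n_gt1 s.
have n_gt0 := ltnW n_gt1; pose r := Ordinal n_gt0; have r0 : r = 0 :> nat by [].
have sched_gt0 : 0 < size sched.
  case: sched gossip => // /(_ r)/setP/(_ (Ordinal n_gt1)).
  by rewrite !inE.
have conn u v := gossip_connected u v gossip.
have := @build_spec n G conn sched gossip sched_gt0 (fun=> 0) (graph_input G) (graph_input_adj G) (fun=> erefl) n_gt1.
rewrite {}/s /gossip_prog 5!run_then; set m1 := run n (fun=> 0) build_prog _; set l := trunc_log 2 n.
case=> E [m1E E_adj E_sym deg_le near].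
have adj1 (u v : 'I_n) : m1 1 (n * u + v) = adj G u v by rewrite /m1 run_other // graph_input_adj.
have zero1 a j : a \notin 0 :: 1 :: written build_prog -> m1 a j = 0.
  rewrite in_cons negb_or => /andP[a0]; rewrite in_cons negb_or => /andP[a1 aN]; rewrite /m1 run_other //.
  by case: a a0 a1 {aN} => [|[]].
have l_gt0 : 0 < l by rewrite trunc_log_gt0.
set m2 := run n (fun=> 0) bfs_prog m1.
have [lev [par [m2par E_par par_lt lev_le]]] := bfs_spec r0 (fun=> 0) m1E (fun j => zero1 level j isT) (near r).
rewrite -/m2 in m2par.
have par_adj v : v != r -> adj G v (par v) by move=> /E_par/E_adj; rewrite adj_sym.
set m3 := run n (fun=> 0) time_prog m2.
have [|tm [[m3t m3r tm_n] [tm_lt tm_inj tm_busy]]] := time_spec r0 par_lt (fun=> 0) m2par.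
  by move=> j; rewrite /m2 run_other // zero1.
rewrite -/m3 in m3t m3r.
have timed3 : timed G r par tm m3.
  split=> [v vr|v|u v]; last by rewrite /m3 /m2 !run_other.
    by rewrite /m3 run_other // m2par.
  by case: eqVneq => [->|/m3t].
set m4 := run n (fun=> 0) (rank_prog (2 ^ #|W|)) m3.
have [||same4 r_range r_inj r_later] := @rank_spec n G r par tm (2 ^ #|W|) (fun=> 0) m3 timed3.
- by move=> j; rewrite /m3 /m2 !run_other // zero1.
- by move=> X; exact: clash_degenerate GH par_adj tm_lt tm_inj.
rewrite -/m4 in same4 r_range r_inj r_later.
have timed4 : timed G r par tm m4 by exact: timed_same same4 timed3.
set m5 := run n (fun=> 0) color_prog m4.
(* The output loops try only [n] colours, so the colours must stay below [n] as well as below the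
   constant. *)
have [|||same5 c_range c_clash] := @color_spec n G r par tm (minn (2 ^ #|W|) n) (fun=> 0) m4 timed4 _ _ r_range r_inj.
- by rewrite /m4 /m3 /m2 /m1 !run_other.
- by move=> j; rewrite /m4 /m3 /m2 !run_other // zero1.
- move=> v; rewrite leq_min r_later /= -[X in _ < X](card_ord n); apply: proper_card; apply/properP.
  by split; [exact: subset_predT|exists v; rewrite // inE ltnn].
rewrite -/m5 in same5 c_range c_clash.
pose col (v : 'I_n) := m5 color v.
have sm : scheduled r par tm col m5.
  have [mp mt _] := timed_same (a := color) isT same5 timed4; split=> //.
  by rewrite /m5 /m4 /m3 /m2 /m1 !run_other.
rewrite (output_spec (fun=> 0) sm); last by rewrite /m5 /m4 /m3 /m2 /m1 !run_other.
pose Delta := 64 * (size sched * l); pose B := 120 * (size sched * l).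
have tm_T v : v != r -> tm v < B + Delta * l.+1.
  have Delta_gt0 : 0 < Delta by rewrite !muln_gt0 sched_gt0.
  have children_le u : #|[set w | parent_edge r par w u]| <= Delta.
    apply: leq_trans (deg_le u); apply: subset_leq_card; apply/subsetP => w; rewrite !inE.
    by case/andP=> wr /eqP <-; exact: E_par.
  move: v; apply: (gather_time par_adj par_lt lev_le Delta_gt0 children_le tm_lt tm_busy).
  by rewrite card_ord trunc_log_ltn.
have c_ok v : 0 < col v /\ col v <= 2 ^ #|W| /\ col v <= n.
  by have := c_range v; rewrite leq_min => /and3P[].
split.
  apply: (tree_gossip (r := r) (tm := tm)) => //.
  - by move=> v; exact: connect_up_root par_lt v.
  - by move=> v vr; have [c1 [_ c3]] := c_ok v; apply: mem_gather_rounds; rewrite ?tm_n ?c1.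
  - by move=> S /gather_roundsP[t [k ->]]; rewrite inE eqxx.
  - move=> S /gather_roundsP[t [k ->]] c c'; rewrite !inE => /and3P[cr /eqP tc /eqP cc] /and3P[c'r /eqP tc' /eqP cc'] ne.
    apply/negP => adj_c; have : clash G r par tm c c' by rewrite /clash ne tc tc' eqxx cr c'r adj_c.
    by move/c_clash; rewrite -/(col c) -/(col c') cc cc' eqxx.
  exact: gather_rounds_order.
rewrite size_cat size_rev size_map addnn -mul2n.
have size_le : size (gather_rounds r tm col) <= (B + Delta * l.+1) * 2 ^ #|W|.
  by apply: size_gather_rounds => // v _; have [_ []] := c_ok v.
apply: leq_trans (_ : 2 * ((B + Delta * l.+1) * 2 ^ #|W|) <= _); first by rewrite leq_mul2l size_le.
rewrite mulnA [X in _ <= X]mulnAC leq_mul2r; apply/orP; right.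
have arith L k : 0 < k -> 2 * (120 * (L * k) + 64 * (L * k) * k.+1) <= 496 * (L * (k * k)) by clear; nia.
exact: arith.
Qed.

(** For [n <= 1] the logarithm is 0, and the bound of the theorem leaves no room for a single
    round. *)
Lemma gossip_prog_small n D (m : memory) : n <= 1 -> m 0 0 = n -> (forall a j, 1 < a -> m a j = 0) ->
  schedule_output n (run n (fun=> 0) (gossip_prog D) m) = [::].
Proof.
move=> n_le1 mn m0; rewrite /gossip_prog 5!run_then.
set m5 := run n (fun=> 0) color_prog _.
have m52 : m5 2 0 = 0 by rewrite /m5 !run_other // m0.
case: n n_le1 mn @m5 m52 => [|[|//]] _ mn m5 m52.
  rewrite /schedule_output (_ : run _ _ _ _ 2 0 = 0) //.
  by rewrite /output_prog run_then /= !(size0nil (size_enum_ord 0)).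
have m5t (v : 'I_1) : m5 time v = 0.
  have triv (w : 'I_1) : w != ord0 -> False by rewrite ord1.
  have [|||tm [[_ tm0 _] _]] := @time_spec 1 ord0 id (fun=> 0) erefl _ (fun=> 0) (run 1 (fun=> 0) bfs_prog (run 1 (fun=> 0) build_prog m)).
  - by move=> w /triv.
  - by move=> w /triv.
  - by move=> j; rewrite !run_other // m0.
  by rewrite ord1 /m5 2?run_other.
have sm : scheduled (ord0 : 'I_1) id (fun=> 0) (fun v => m5 color v) m5.
  split=> // [|v|v]; first by rewrite /m5 !run_other.
    by rewrite ord1.
  by rewrite m5t ord1.
rewrite (output_spec (fun=> 0) sm m52) (_ : gather_rounds _ _ _ = [::]) //.
apply: size0nil; apply/eqP; rewrite -leqn0.
by apply: (@size_gather_rounds _ _ _ _ 0 0) => v; rewrite ord1.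
Qed.

Theorem theorem5 (W : finType) (H : sgraph W) :
  exists (p : cmd) (c k C : nat),
  forall (n : nat) (G : sgraph 'I_n), minor_free H G ->
  exists (t : nat) (mem : memory),
    [/\ exec p (graph_input G) t mem,
        t <= c * n ^ k + c
      & forall opt : nat, is_opt G opt ->
          gossip_schedule G (schedule_output n mem) /\
          size (schedule_output n mem) <= C * (opt * trunc_log 2 n ^ 2)].
Proof.
have [c [k correct]] := compile_correct (wf_gossip_prog (2 ^ #|W|)).
exists (compile (gossip_prog (2 ^ #|W|))), c, k, (496 * 2 ^ #|W|) => n G GH.
have [t [M [ex t_le M_run]]] := correct n (graph_input G) erefl.
(* Termination and the time bound come from the compiler and hold for every graph; an optimal
   schedule serves only to judge the output. *)
exists t, M; split=> // opt [[sched gossip <-] _].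
have -> : schedule_output n M = schedule_output n (run n (fun=> 0) (gossip_prog (2 ^ #|W|)) (graph_input G)).
  by rewrite /schedule_output M_run //; apply: eq_mkseq => q; apply/setP => v; rewrite !inE M_run.
have [n_le1|n_gt1] := leqP n 1; last exact: (gossip_prog_spec GH gossip n_gt1).
have input0 a j : 1 < a -> graph_input G a j = 0 by case: a => [|[|a]].
rewrite gossip_prog_small //.
have zero (x : 'I_n) : val x = 0.
  by apply/eqP; rewrite -leqn0 -ltnS; exact: leq_trans (ltn_ord x) n_le1.
by split=> // v; apply/setP => u; rewrite !inE; apply/eqP/val_inj; rewrite !zero.
Qed.
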